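(* Let $k\ge1$ and let $\Gamma$ be a nontrivial finite group of isometries acting freely on the round sphere $S^{2k-1}$. Then there do not exist flat metrics on a compact ($2k$-dimensional, oriented) manifold with exactly one cone singularity modeled on $\Gamma\backslash S^{2k-1}$.
   Context: A flat metric on a compact manifold with one cone singularity modeled on $\Gamma\backslash S^{2k-1}$ means: a flat Riemannian manifold $(M,g)$ for which there are a compact set $K\subset M$ and a diffeomorphism $\Phi:M\setminus K\to(-\epsilon,0)\times N$, $N=\Gamma\backslash S^{2k-1}$, with $g=\Phi^*(dr^2\oplus r^2h)$ on $M\setminus K$, where $h$ is the metric on $N$ induced by the round metric of the unit sphere.
   Formalization: ''Compact with exactly one cone singularity'' is taken to include that M with {r > -δ} removed is compact for 0 < δ < ε (r → 0 is the only end); without it the open cone (-ε,0) × N with K empty would be a counterexample. *)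

(* Defs.v *)
From HB Require Import structures.
From mathcomp Require Import all_boot all_order all_algebra all_fingroup.
From mathcomp Require Import generic_quotient.
From mathcomp Require Import all_classical all_reals all_analysis.
Set Implicit Arguments.
Unset Strict Implicit.
Unset Printing Implicit Defensive.
Import Order.TTheory GRing.Theory Num.Theory.
Import numFieldNormedType.Exports.
Local Open Scope classical_set_scope.
Local Open Scope ring_scope.
Local Open Scope quotient_scope.

(** * Smooth maps between normed spaces *)

(* Used on open sets [U] of finite-dimensional spaces only, where the second
   case is equivalent to the usual definition by partial derivatives. *)
Fixpoint class_C (R : realType) (V W : normedModType R) (r : nat)
    (U : set V) (f : V -> W) : Prop :=
  match r with
  | 0%N => forall x, U x -> {for x, continuous f}
  | r'.+1 => (forall x, U x -> differentiable f x) /\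
             forall v : V, class_C r' U (fun x => 'D_v f x)
  end.

Definition smooth_on (R : realType) (V W : normedModType R)
    (U : set V) (f : V -> W) : Prop := forall r, class_C r U f.

(** * Riemannian manifolds *)

(* Charts are given by their inverses: the parametrization [cpar i] is a
   homeomorphism from the open set [cdom i] of R^n onto an open subset of [T],
   and [cmetric i x] is the Gram matrix of the metric in the coordinate frame at
   [cpar i x].  These are bare data; see [riemannian_manifold]. *)
Record metric_atlas (R : realType) (n : nat) (T : Type) := MetricAtlas {
  cindex : Type ;
  cdom : cindex -> set 'rV[R]_n ;
  cpar : cindex -> 'rV[R]_n -> T ;
  cmetric : cindex -> 'rV[R]_n -> 'M[R]_n }.

Definition parametrization (R : realType) (n : nat) (T : topologicalType)
    (V : set 'rV[R]_n) (phi : 'rV[R]_n -> T) : Prop :=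
  [/\ open V, {in V &, injective phi},
      (forall x, V x -> {for x, continuous phi})
    & forall U : set 'rV[R]_n, open U -> U `<=` V -> open (phi @` U)].

Section Maps.
Variables (R : realType) (m n : nat) (S T : topologicalType).
Variables (g : metric_atlas R m S) (h : metric_atlas R n T).

(* The expression of [f] in the charts [i] and [j], which is meaningful on
   [in_charts A f i j], the part of chart [i] that lies in [A] and is mapped
   into chart [j]. *)
Definition chart_expr (f : S -> T) (i : cindex g) (j : cindex h) :
    'rV[R]_m -> 'rV[R]_n :=
  fun x => 'pinv_(fun=> 0) (cdom j) (cpar j) (f (cpar i x)).

Definition in_charts (A : set S) (f : S -> T) (i : cindex g) (j : cindex h) :
    set 'rV[R]_m :=
  [set x | [/\ cdom i x, A (cpar i x) & (cpar j @` cdom j) (f (cpar i x))]].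

Definition smooth_map (A : set S) (f : S -> T) : Prop :=
  (forall p, A p -> {for p, continuous f}) /\
  forall i j, smooth_on (in_charts A f i j) (chart_expr f i j).

(* [g = f^* h] on [A].  Tangent vectors are row vectors, so that the derivative
   is [v |-> v *m 'J f x]. *)
Definition is_pullback (A : set S) (f : S -> T) : Prop :=
  forall i j x, in_charts A f i j x ->
    cmetric i x = 'J (chart_expr f i j) x
                  *m cmetric j (chart_expr f i j x)
                  *m ('J (chart_expr f i j) x)^T.

End Maps.

Definition diffeomorphism (R : realType) (m n : nat) (S T : topologicalType)
    (g : metric_atlas R m S) (h : metric_atlas R n T)
    (A : set S) (B : set T) (f : S -> T) : Prop :=
  [/\ open A, open B, smooth_map g h A f, set_fun A B f
    & exists f' : T -> S,
        [/\ smooth_map h g B f', set_fun B A f',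
            {in A, cancel f f'} & {in B, cancel f' f}]].

Definition riemannian_isometry (R : realType) (m n : nat)
    (S T : topologicalType) (g : metric_atlas R m S)
    (h : metric_atlas R n T) (A : set S) (B : set T) (f : S -> T) : Prop :=
  diffeomorphism g h A B f /\ is_pullback g h A f.

(* Smoothness of the transition maps, and the transformation rule of the Gram
   matrices, are the last two conditions, on the identity map. *)
Definition riemannian_manifold (R : realType) (n : nat) (M : topologicalType)
    (g : metric_atlas R n M) : Prop :=
  (hausdorff_space M /\ @second_countable M) /\
  [/\ forall i : cindex g, parametrization (cdom i) (cpar i),
      forall p : M, exists i : cindex g, (cpar i @` cdom i) p,
      forall i : cindex g,
        smooth_on (cdom i) (cmetric i) /\
        forall x, cdom i x ->
          (cmetric i x)^T = cmetric i x /\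
          forall v : 'rV[R]_n, v != 0 -> 0 < (v *m cmetric i x *m v^T) 0 0,
      smooth_map g g setT id
    & is_pullback g g setT id].

(* [o i x] tells whether the coordinate frame of chart [i] at [cpar i x] is
   positively oriented. *)
Definition is_orientation (R : realType) (n : nat) (M : topologicalType)
    (g : metric_atlas R n M) (o : cindex g -> 'rV[R]_n -> bool) : Prop :=
  (forall i x, cdom i x -> \forall y \near x, o i y = o i x) /\
  forall i j x, in_charts setT id i j x ->
    o j (chart_expr id i j x)
    = o i x (+) (\det ('J (chart_expr id i j) x) < 0).

Definition orientable (R : realType) (n : nat) (M : topologicalType)
    (g : metric_atlas R n M) : Prop := exists o, @is_orientation R n M g o.

Definition euclidean (R : realType) (n : nat) : metric_atlas R n 'rV[R]_n :=
  @MetricAtlas R n 'rV[R]_n unit (fun=> setT) (fun=> id) (fun _ _ => 1%:M).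

Definition flat (R : realType) (n : nat) (M : topologicalType)
    (g : metric_atlas R n M) : Prop :=
  forall p : M, exists (A : set M) (B : set 'rV[R]_n) (f : M -> 'rV[R]_n),
    A p /\ riemannian_isometry g (euclidean R n) A B f.

(** * The round sphere *)

Definition unit_sphere (R : realType) (n : nat) : set 'rV[R]_n :=
  [set x | (x *m x^T) 0 0 = 1].

(* The sphere S^(n-1) in R^n, with the subspace topology. *)
Notation sphere R n := (set_type (@unit_sphere R n)).

Record sphere_chart (R : realType) (n : nat) := SphereChart {
  sdom : set 'rV[R]_n.-1 ;
  spar : 'rV[R]_n.-1 -> sphere R n ;
  spar_parametrization : parametrization sdom spar ;
  spar_smooth : smooth_on sdom (fun x => \val (spar x)) ;
  spar_immersion :
    forall x, sdom x -> row_free ('J (fun y => \val (spar y)) x) }.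

(* The metric is induced by the inclusion in Euclidean space. *)
Definition round_metric (R : realType) (n : nat) :
    metric_atlas R n.-1 (sphere R n) :=
  @MetricAtlas R n.-1 (sphere R n) (sphere_chart R n)
    (@sdom R n) (@spar R n)
    (fun c x => let J := 'J (fun y => \val (spar c y)) x in J *m J^T).

(** * Quotients by free isometric actions *)

Section OrbitSpace.
Variables (gT : finGroupType) (T : topologicalType) (to : {action gT &-> T}).

Definition same_orbit (x y : T) : bool := `[< exists a : gT, to x a = y >].

Lemma same_orbit_equiv : equiv_class_of same_orbit.
Proof.
have [inj_to toM] : is_action (setTfor gT) to by case: (to).
have to1 x : to x 1%g = x.
  by apply: (inj_to 1%g); rewrite -toM ?inE// mulg1.
split=> [x|x y|y x z].
- by apply/asboolP; exists 1%g.
- by apply/asboolP/asboolP => -[a <-]; exists a^-1%g;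
    rewrite -toM ?inE// mulgV to1.
- move=> /asboolP[a <-] /asboolP[b <-]; apply/asboolP.
  by exists (a * b)%g; rewrite toM ?inE.
Qed.

Canonical same_orbit_equivRel := EquivRelPack same_orbit_equiv.

Definition orbit_space : topologicalType :=
  quotient_topology {eq_quot same_orbit_equivRel}.

Definition orbit_proj (x : T) : orbit_space :=
  \pi_({eq_quot same_orbit_equivRel}) x.

(* The charts of the quotient are those induced by the charts of [T] on which
   the projection is injective, and the projection is a local isometry. *)
Definition orbit_metric (R : realType) (n : nat) (g : metric_atlas R n T) :
    metric_atlas R n orbit_space :=
  @MetricAtlas R n orbit_space
    {i : cindex g | {in cdom i &, injective (orbit_proj \o cpar i)}}
    (fun i => cdom (sval i))
    (fun i => orbit_proj \o cpar (sval i))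
    (fun i => cmetric (sval i)).

End OrbitSpace.

(** * Cones *)

(* The metric dr^2 + r^2 h on the product of the negative half-line with N. *)
Definition cone (R : realType) (n : nat) (N : topologicalType)
    (h : metric_atlas R n N) : metric_atlas R (1 + n) (R * N)%type :=
  let rad (v : 'rV[R]_(1 + n)) : R := lsubmx v 0 0 in
  @MetricAtlas R (1 + n) (R * N)%type (cindex h)
    (fun i => [set v | rad v < 0 /\ cdom i (rsubmx v)])
    (fun i v => (rad v, cpar i (rsubmx v)))
    (fun i v => block_mx 1%:M 0 0 (rad v ^+ 2 *: cmetric i (rsubmx v))).

(* The last condition says that r -> 0 is the only end of [M], that is, that
   adding the tip of the cone to [M] gives a compact space.  It does not follow
   from the others, which the cone itself satisfies for [K] empty. *)
Definition one_cone_singularity (R : realType) (m n : nat)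
    (M N : topologicalType) (g : metric_atlas R m M) (h : metric_atlas R n N) :
    Prop :=
  exists (K : set M) (eps : R) (Phi : M -> R * N),
    [/\ compact K, 0 < eps,
        riemannian_isometry g (cone h) (~` K) [set q | - eps < q.1 < 0] Phi
      & forall delta, 0 < delta < eps ->
          compact (~` [set p | ~ K p /\ - delta < (Phi p).1])].

(* Main.v *)
Require Import Defs.
From HB Require Import structures.
From mathcomp Require Import all_boot all_order all_algebra all_fingroup.
From mathcomp Require Import all_classical all_reals all_analysis.
From mathcomp Require Import ring lra.
Import Order.TTheory GRing.Theory Num.Theory.
Import numFieldNormedType.Exports.
Set Implicit Arguments.
Unset Strict Implicit.
Unset Printing Implicit Defensive.
Local Open Scope classical_set_scope.
Local Open Scope ring_scope.

(* Adding the tip of the cone to the manifold gives a compact flat orbifold with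
   exactly one singular point, whose local group is the linear action of Gamma.
   Being locally modelled on R^n up to rigid motions, it can be developed by
   analytic continuation of charts: it is the quotient of R^n by a
   crystallographic group G, and the nontrivial fixed points of G are the points
   over the tip, which form a single orbit.  By Bieberbach's theorem the
   translations of G form a lattice L of finite index, so for suitable N the group
   G acts on the finite set of N-torsion points of the torus R^n / L through a
   finite group K.  This action is free off the orbit S of the tip, and the order
   of K divides the number of torsion points, hence also the cardinal of S; but
   the cardinal of S is a proper divisor of it, since the stabilizer of the tip is
   the nontrivial group Gamma. *)

(** * Euclidean space *)

(** No universal cover is formed. The developed objects are germs, that is charts composed with
    rigid motions on a ball about 0. Compactness gives one radius [rho] that serves all of them, so
    a germ can always be continued by a vector shorter than [rho]. Such small steps add and commute,
    which makes continuation along any vector well defined, and G consists of the motions that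
    preserve the germ at the tip. Connectedness of the punctured ball in dimension above 1 makes the
    action of Gamma linear; it also shows, as Gamma is nontrivial, that the tip is separated from
    every point of the manifold. In the count, N is a multiple of three numbers. The denominator of
    the translation parts makes G preserve the N-torsion points. The factorial of the order of the
    point group makes the order of K divide N, and N divides the number of torsion points because a
    shortest translation divided by N generates a group acting freely on them. The factor 3 ensures
    that a nontrivial rotation about the tip moves some torsion point. *)

Section Euclid.
Context {R : realType}.
Implicit Types m n p : nat.

Definition dot {n} (x y : 'rV[R]_n) : R := (x *m y^T) 0 0.
Definition enorm {n} (x : 'rV[R]_n) : R := Num.sqrt (dot x x).

Lemma dotE n (x y : 'rV[R]_n) : dot x y = \sum_i x 0 i * y 0 i.
Proof. by rewrite /dot mxE; apply: eq_bigr => i _; rewrite mxE. Qed.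

Lemma dotC n (x y : 'rV[R]_n) : dot x y = dot y x.
Proof. by rewrite !dotE; apply: eq_bigr => i _; rewrite mulrC. Qed.

Lemma dotDl n (x y z : 'rV[R]_n) : dot (x + y) z = dot x z + dot y z.
Proof. by rewrite /dot mulmxDl mxE. Qed.

Lemma dotDr n (x y z : 'rV[R]_n) : dot x (y + z) = dot x y + dot x z.
Proof. by rewrite dotC dotDl !(dotC x). Qed.

Lemma dotZl n a (x y : 'rV[R]_n) : dot (a *: x) y = a * dot x y.
Proof. by rewrite /dot -scalemxAl mxE. Qed.

Lemma dotZr n a (x y : 'rV[R]_n) : dot x (a *: y) = a * dot x y.
Proof. by rewrite dotC dotZl dotC. Qed.

Lemma dotNl n (x y : 'rV[R]_n) : dot (- x) y = - dot x y.
Proof. by rewrite /dot mulNmx mxE. Qed.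

Lemma dotNr n (x y : 'rV[R]_n) : dot x (- y) = - dot x y.
Proof. by rewrite dotC dotNl dotC. Qed.

Lemma dot0l n (x : 'rV[R]_n) : dot 0 x = 0.
Proof. by rewrite /dot mul0mx mxE. Qed.

Lemma dot0r n (x : 'rV[R]_n) : dot x 0 = 0.
Proof. by rewrite dotC dot0l. Qed.

Lemma dot_mulmx m n (x : 'rV[R]_m) (A : 'M[R]_(m, n)) (y : 'rV[R]_n) :
  dot (x *m A) y = dot x (y *m A^T).
Proof. by rewrite /dot trmx_mul trmxK mulmxA. Qed.

Lemma dot_ge0 n (x : 'rV[R]_n) : 0 <= dot x x.
Proof. by rewrite dotE sumr_ge0// => i _; rewrite -expr2 sqr_ge0. Qed.

Lemma dot_eq0 n (x : 'rV[R]_n) : (dot x x == 0) = (x == 0).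
Proof.
apply/eqP/eqP=> [|->]; last by rewrite dot0l.
rewrite dotE => /eqP; rewrite psumr_eq0 => [/allP h|i _]; last first.
  by rewrite -expr2 sqr_ge0.
apply/rowP => i; rewrite mxE; apply/eqP.
by have := h i (mem_index_enum i); rewrite mulf_eq0 orbb.
Qed.

Lemma enorm_ge0 n (x : 'rV[R]_n) : 0 <= enorm x.
Proof. exact: sqrtr_ge0. Qed.
Hint Resolve enorm_ge0 : core.

Lemma sqr_enorm n (x : 'rV[R]_n) : enorm x ^+ 2 = dot x x.
Proof. by rewrite sqr_sqrtr// dot_ge0. Qed.

Lemma enorm_eq0 n (x : 'rV[R]_n) : (enorm x == 0) = (x == 0).
Proof. by rewrite -(sqrf_eq0 (enorm x)) sqr_enorm dot_eq0. Qed.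

Lemma enorm_gt0 n (x : 'rV[R]_n) : (0 < enorm x) = (x != 0).
Proof. by rewrite lt_neqAle enorm_ge0 andbT eq_sym enorm_eq0. Qed.

Lemma enorm0 n : enorm (0 : 'rV[R]_n) = 0.
Proof. by apply/eqP; rewrite enorm_eq0. Qed.

Lemma enormN n (x : 'rV[R]_n) : enorm (- x) = enorm x.
Proof. by rewrite /enorm dotNl dotNr opprK. Qed.

Lemma enormB n (x y : 'rV[R]_n) : enorm (x - y) = enorm (y - x).
Proof. by rewrite -enormN opprB. Qed.

Lemma enormZ n a (x : 'rV[R]_n) : enorm (a *: x) = `|a| * enorm x.
Proof.
by rewrite /enorm dotZl dotZr mulrA -expr2 sqrtrM ?sqr_ge0// sqrtr_sqr.
Qed.

Lemma dot_sqr_le n (x y : 'rV[R]_n) : dot x y ^+ 2 <= dot x x * dot y y.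
Proof.
have [->|y0] := eqVneq y 0; first by rewrite !dot0r expr0n mulr0.
have yy : 0 < dot y y by rewrite lt_neqAle dot_ge0 andbT eq_sym dot_eq0.
have := dot_ge0 (dot y y *: x - dot x y *: y).
rewrite !(dotDl, dotDr, dotNl, dotNr, dotZl, dotZr) (dotC y x) => h.
have {}h : 0 <= dot y y * (dot x x * dot y y - dot x y ^+ 2) by nra.
by rewrite pmulr_rge0// subr_ge0 in h.
Qed.

Lemma dot_le n (x y : 'rV[R]_n) : dot x y <= enorm x * enorm y.
Proof.
apply: le_trans (ler_norm _) _.
rewrite -(@ler_pXn2r _ 2%N)// ?nnegrE ?mulr_ge0 ?normr_ge0//.
by rewrite real_normK ?num_real// exprMn !sqr_enorm dot_sqr_le.
Qed.

Lemma enormD n (x y : 'rV[R]_n) : enorm (x + y) <= enorm x + enorm y.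
Proof.
rewrite -(@ler_pXn2r _ 2%N)// ?nnegrE ?addr_ge0// sqr_enorm.
rewrite !(dotDl, dotDr) (dotC y x) -!sqr_enorm.
by have := dot_le x y; nra.
Qed.

Lemma enorm_sub n (x y : 'rV[R]_n) : enorm (x - y) <= enorm x + enorm y.
Proof. by rewrite -(enormN y) enormD. Qed.

Lemma enorm_triangle n (x y z : 'rV[R]_n) :
  enorm (x - z) <= enorm (x - y) + enorm (y - z).
Proof. by rewrite (le_trans _ (enormD _ _))// addrA subrK. Qed.

Lemma lerB_enorm n (x y : 'rV[R]_n) : enorm x - enorm y <= enorm (x - y).
Proof. by have := enormD (x - y) y; rewrite subrK; lra. Qed.

Lemma ler_dist_enorm n (x y : 'rV[R]_n) : `|enorm x - enorm y| <= enorm (x - y).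
Proof. by rewrite ler_norml lerB_enorm andbT lerNl opprB enormB lerB_enorm. Qed.

Lemma norm_le_enorm n (x : 'rV[R]_n) : `|x| <= enorm x.
Proof.
rewrite [`|x|]mx_normrE; apply/bigmax_leP; split => // -[i j] _ /=.
rewrite (ord1 i) -(@ler_pXn2r _ 2%N)// ?nnegrE//.
rewrite real_normK ?num_real// sqr_enorm dotE (bigD1 j)//= -expr2 lerDl.
by apply: sumr_ge0 => k _; rewrite -expr2 sqr_ge0.
Qed.

Lemma enorm_le_norm n (x : 'rV[R]_n) : enorm x <= n%:R * `|x|.
Proof.
rewrite -(@ler_pXn2r _ 2%N)// ?nnegrE ?mulr_ge0// sqr_enorm dotE.
apply: (@le_trans _ _ (\sum_(i < n) `|x| ^+ 2)).
  apply: ler_sum => i _; rewrite -expr2 -(real_normK (num_real (x 0 i))).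
  rewrite ler_pXn2r// ?nnegrE//.
  rewrite [leRHS]mx_normrE; apply/bigmax_geP; right.
  by exists (0, i).
rewrite sumr_const card_ord -[leLHS]mulr_natl exprMn.
apply: ler_wpM2r; rewrite ?sqr_ge0//.
by case: n x => [|n] x; rewrite ?expr0n// -natrX ler_nat leq_pmulr.
Qed.

(** The topology comes from the sup norm; balls of the rotation-invariant norm describe the same
    neighbourhoods. *)
Lemma near_enorm n (x : 'rV[R]_n) (P : set 'rV[R]_n) :
  (\forall z \near x, P z) <->
  exists2 r, 0 < r & forall z, enorm (z - x) < r -> P z.
Proof.
split=> [/nbhs_normP[r /= r0 h]|[r r0 h]].
  exists r => // z zx; apply: h => /=.
  by rewrite distrC (le_lt_trans (norm_le_enorm _)).
(* [n.+1] instead of [n] keeps the radius positive in dimension 0. *)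
apply/nbhs_normP; exists (r / n.+1%:R) => /=; first by rewrite divr_gt0.
move=> z /=; rewrite distrC ltr_pdivlMr// => xz.
apply: h; apply: le_lt_trans (enorm_le_norm _) _.
apply: le_lt_trans xz; rewrite mulrC ler_wpM2l// ler_nat.
exact: leqnSn.
Qed.

Lemma near_eball n (x : 'rV[R]_n) r : 0 < r ->
  \forall z \near x, enorm (z - x) < r.
Proof. by move=> r0; apply/near_enorm; exists r. Qed.

Lemma near_enorm_lt n (x : 'rV[R]_n) r : enorm x < r ->
  \forall z \near x, enorm z < r.
Proof.
rewrite -subr_gt0 => xr; apply/near_enorm; exists (r - enorm x) => // z zx.
by have := lerB_enorm z x; lra.
Qed.

Lemma near_enorm_sub n (c x : 'rV[R]_n) r : enorm (x - c) < r ->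
  \forall z \near x, enorm (z - c) < r.
Proof.
rewrite -subr_gt0 => xr; apply/near_enorm; exists (r - enorm (x - c)) => // z zx.
by have := enorm_triangle z x c; lra.
Qed.

Lemma near_neq0 n (x : 'rV[R]_n) : x != 0 -> \forall z \near x, z != 0.
Proof.
move=> x0; apply/near_enorm; exists (enorm x); rewrite ?enorm_gt0// => z.
by apply: contraTN => /eqP->; rewrite sub0r enormN ltxx.
Qed.

Lemma continuous_enorm n : continuous (@enorm n).
Proof.
move=> x; apply/(@cvgrPdist_lt _ _ _ (nbhs x) (nbhs_filter x)) => e e0.
apply: filterS (near_eball x e0) => z zx.
by rewrite distrC (le_lt_trans (ler_dist_enorm _ _)).
Qed.

Lemma open_eball n (c : 'rV[R]_n) r : open [set z | enorm (z - c) < r].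
Proof. by rewrite openE => x /= xc; exact: near_enorm_sub. Qed.

Lemma compact_eball n C : compact [set x : 'rV[R]_n | enorm x <= C].
Proof.
apply: bounded_closed_compact.
  exists C; split; first exact: num_real.
  by move=> M CM x /= xC; rewrite (le_trans (norm_le_enorm _))// (le_trans xC)// ltW.
apply: (@preimage_closed _ _ (@enorm n) [set y | y <= C]).
  by apply: in1W; exact: continuous_enorm.
exact: closed_le.
Qed.

(** Source of the finiteness statements on groups below, applied to translation parts and, through
    [mxvec], to linear parts. *)
Lemma totally_bounded n C e : 0 < e ->
  exists s : seq 'rV[R]_n, forall x : 'rV[R]_n, enorm x <= C ->
  exists2 c : 'rV[R]_n, c \in s & enorm (x - c) < e.
Proof.
move=> e0; have := @compact_eball n C; rewrite compact_cover.
move=> /(_ _ setT (fun c => [set z | enorm (z - c) < e])) [].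
- by move=> c _; exact: open_eball.
- by move=> x _; exists x => //=; rewrite subrr enorm0.
move=> D _ cD; exists (finmap.enum_fset D) => x xC.
by have [c cDD xc] := cD x xC; exists c.
Qed.

Definition frobenius {m n} (A : 'M[R]_(m, n)) : R := enorm (mxvec A).

Lemma frobenius_sqr m n (A : 'M[R]_(m, n)) :
  frobenius A ^+ 2 = \sum_j \sum_i A i j ^+ 2.
Proof.
rewrite sqr_enorm dotE exchange_big/= pair_bigA/=.
rewrite (reindex _ (curry_mxvec_bij _ _)) /=.
by apply: eq_bigr => -[i j] _ /=; rewrite mxvecE expr2.
Qed.

(** Cauchy-Schwarz, column by column. *)
Lemma enorm_mulmx m n (x : 'rV[R]_m) (A : 'M[R]_(m, n)) :
  enorm (x *m A) <= frobenius A * enorm x.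
Proof.
rewrite -(@ler_pXn2r _ 2%N)// ?nnegrE ?mulr_ge0//; last exact: enorm_ge0.
rewrite exprMn frobenius_sqr mulr_suml sqr_enorm dotE; apply: ler_sum => j _.
have -> : (x *m A) 0 j = dot x (col j A)^T.
  by rewrite mxE dotE; apply: eq_bigr => i _; rewrite !mxE.
rewrite -expr2 (le_trans (dot_sqr_le _ _))// mulrC sqr_enorm.
apply: ler_wpM2r; rewrite ?dot_ge0// dotE.
by apply: ler_sum => i _; rewrite !mxE -expr2.
Qed.

Lemma frobenius_ge0 m n (A : 'M[R]_(m, n)) : 0 <= frobenius A.
Proof. exact: enorm_ge0. Qed.

Lemma near_mulmx m n (x : 'rV[R]_m) (A : 'M[R]_(m, n)) (P : set 'rV[R]_n) :
  (\forall z \near x *m A, P z) -> \forall z \near x, P (z *m A).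
Proof.
move=> /near_enorm[r r0 h]; apply/near_enorm.
have f0 : 0 < frobenius A + 1 by rewrite ltr_pwDr ?frobenius_ge0.
exists (r / (frobenius A + 1)) => [|z]; first by rewrite divr_gt0.
rewrite ltr_pdivlMr// => zx; apply: h; rewrite -mulmxBl.
apply: le_lt_trans (enorm_mulmx _ _) (le_lt_trans _ zx).
by rewrite mulrC ler_wpM2l// lerDl.
Qed.

Lemma near_addr n (x b : 'rV[R]_n) (P : set 'rV[R]_n) :
  (\forall z \near x + b, P z) -> \forall z \near x, P (z + b).
Proof.
move=> /near_enorm[r r0 h]; apply/near_enorm; exists r => // z zx; apply: h.
by rewrite opprD addrACA subrr addr0.
Qed.

Lemma near_shift n (v : 'rV[R]_n) (P : set 'rV[R]_n) :
  (\forall z \near v, P z) -> \forall z \near (0 : 'rV[R]_n), P (z + v).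
Proof. by move=> h; apply: near_addr; rewrite add0r. Qed.

(** * Orthogonal matrices, acting on row vectors from the right *)

Section Orthogonal.
Context {n : nat}.
Implicit Types (A B : 'M[R]_n) (x y b : 'rV[R]_n).

Definition orthogonal A := A *m A^T = 1%:M.

Lemma orthogonalV A : orthogonal A -> A^T *m A = 1%:M.
Proof. by move=> h; rewrite mulmx1C. Qed.

Lemma orthogonalT A : orthogonal A -> orthogonal A^T.
Proof. by move=> h; rewrite /orthogonal trmxK orthogonalV. Qed.

Lemma orthogonal1 : orthogonal 1%:M.
Proof. by rewrite /orthogonal trmx1 mulmx1. Qed.

Lemma orthogonalM A B : orthogonal A -> orthogonal B -> orthogonal (A *m B).
Proof.
move=> hA hB; rewrite /orthogonal trmx_mul mulmxA -(mulmxA A) hB mulmx1.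
exact: hA.
Qed.

Lemma dot_orthogonal A x y : orthogonal A -> dot (x *m A) (y *m A) = dot x y.
Proof. by move=> h; rewrite dot_mulmx -mulmxA h mulmx1. Qed.

Lemma enorm_orthogonal A x : orthogonal A -> enorm (x *m A) = enorm x.
Proof. by move=> h; rewrite /enorm dot_orthogonal. Qed.

Lemma orthogonalK A x : orthogonal A -> x *m A *m A^T = x.
Proof. by move=> h; rewrite -mulmxA h mulmx1. Qed.

Lemma orthogonalKV A x : orthogonal A -> x *m A^T *m A = x.
Proof. by move=> h; rewrite -mulmxA orthogonalV// mulmx1. Qed.

(** The rows are unit vectors, so the squared norm is [n]; the cruder bound [n] on the norm avoids a
    square root. *)
Lemma frobenius_orthogonal A : orthogonal A -> frobenius A <= n%:R.
Proof.
move=> h; rewrite -(@ler_pXn2r _ 2%N)// ?nnegrE ?frobenius_ge0//.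
rewrite frobenius_sqr exchange_big/=.
rewrite (eq_bigr (fun=> 1)) => [|i _]; last first.
  have := congr1 (fun M : 'M[R]_n => M i i) h; rewrite !mxE eqxx mulr1n => <-.
  by apply: eq_bigr => j _; rewrite mxE expr2.
by rewrite sumr_const card_ord -natrX ler_nat; case: (n) => // k; rewrite leq_pmulr.
Qed.

End Orthogonal.

Lemma mx_ext m n (A B : 'M[R]_(m, n)) : (forall x : 'rV[R]_m, x *m A = x *m B) -> A = B.
Proof. by move=> h; apply/row_matrixP => i; rewrite !rowE h. Qed.

End Euclid.
#[global] Hint Extern 0 (is_true (0 <= enorm _)) => apply: enorm_ge0 : core.

(** * Crystallographic groups *)

Section RotationGap.
Context {R : realType} {n : nat}.
Implicit Types (A S P : 'M[R]_n) (x y : 'rV[R]_n).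

Lemma continuous_enorm_mulmx A : continuous (fun x => enorm (x *m A)).
Proof.
move=> x; apply/(@cvgrPdist_lt _ _ _ (nbhs x) (nbhs_filter x)) => e e0.
have := near_eball (x *m A) e0 => /near_mulmx; apply: filterS => z zx.
by rewrite distrC (le_lt_trans (ler_dist_enorm _ _)).
Qed.

Lemma compact_sphereI P : compact [set x | enorm x = 1 /\ enorm (x *m P) = 0].
Proof.
apply: (@subclosed_compact _ _ [set x : 'rV[R]_n | enorm x <= 1]).
- rewrite (_ : [set _ | _] = (@enorm R n) @^-1` [set 1] `&`
    (fun x => enorm (x *m P)) @^-1` [set 0]); last by [].
  apply: closedI; apply: preimage_closed; try exact: closed_eq.
    by apply: in1W; exact: continuous_enorm.
  by apply: in1W; exact: continuous_enorm_mulmx.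
- exact: compact_eball.
- by move=> x [/= -> _].
Qed.

Lemma enorm_unit x : x != 0 -> enorm ((enorm x)^-1 *: x) = 1.
Proof.
move=> x0; rewrite enormZ ger0_norm ?invr_ge0 ?enorm_ge0// mulVf//.
by rewrite enorm_eq0.
Qed.

(** The operator norm of [A] on the kernel of [P] is attained. It is used with [P = 0] for the whole
    space and with a projection [P] for its orthogonal complement. *)
Lemma max_enorm_mulmx A P : (exists2 x : 'rV[R]_n, x != 0 & x *m P = 0) ->
  exists2 u : 'rV[R]_n, enorm u = 1 /\ u *m P = 0 &
    forall x : 'rV[R]_n, x *m P = 0 -> enorm (x *m A) <= enorm (u *m A) * enorm x.
Proof.
move=> [x0 x00 x0P].
have [|||u] := @EVT_max_rV R n (fun x => enorm (x *m A))
  [set x : 'rV[R]_n | enorm x = 1 /\ enorm (x *m P) = 0].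
- by exists ((enorm x0)^-1 *: x0); rewrite /= enorm_unit// -scalemxAl x0P scaler0 enorm0.
- exact: compact_sphereI.
- by apply: continuous_subspaceT; exact: continuous_enorm_mulmx.
rewrite inE => -[u1 uP] umax.
exists u; first by split=> //; apply/eqP; rewrite -enorm_eq0 uP.
move=> x xP; have [->|xn0] := eqVneq x 0; first by rewrite mul0mx !enorm0 mulr0.
have := umax ((enorm x)^-1 *: x); rewrite inE /= enorm_unit// -scalemxAl xP scaler0 enorm0.
move=> /(_ (conj erefl erefl)).
rewrite -scalemxAl enormZ ger0_norm ?invr_ge0 ?enorm_ge0// mulrC ler_pdivrMr//.
by rewrite enorm_gt0.
Qed.

(** For [w = x S], nonnegativity of the form at [x + t w] reads [2 t |w|^2 + t^2 b >= 0] for all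
    [t], which forces [w = 0]. *)
Lemma psd_ker S x : S^T = S -> (forall y, 0 <= dot (y *m S) y) ->
  dot (x *m S) x = 0 -> x *m S = 0.
Proof.
move=> sS pS xS; apply/eqP; rewrite -dot_eq0.
set w := x *m S; set a := dot w w; set b := dot (w *m S) w.
have a0 : 0 <= a by exact: dot_ge0.
have b0 : 0 <= b by exact: pS.
have h t : 0 <= 2 * t * a + t ^+ 2 * b.
  have := pS (x + t *: w); rewrite mulmxDl -scalemxAl.
  rewrite !(dotDl, dotDr, dotZl, dotZr) xS.
  have -> : dot (w *m S) x = a by rewrite dot_mulmx sS.
  by rewrite -/w -/a -/b; lra.
have [b00|bn0] := eqVneq b 0; first by have := h (-1); rewrite b00; lra.
have bp : 0 < b by lra.
(* The minimum of the quadratic in [t]. *)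
have := h (- a / b).
have -> : 2 * (- a / b) * a + (- a / b) ^+ 2 * b = - (a ^+ 2 / b) by field.
by rewrite oppr_ge0 pmulr_lle0 ?invr_gt0// => a2; have := sqr_ge0 a; nra.
Qed.

(** Equivalent to [P] being symmetric and idempotent. *)
Definition orth_proj P := forall x y, dot (x *m P) (y - y *m P) = 0.

Lemma orth_proj_sqr P x : orth_proj P ->
  enorm x ^+ 2 = enorm (x *m P) ^+ 2 + enorm (x - x *m P) ^+ 2.
Proof.
have sq y z : dot z y = 0 -> dot (y + z) (y + z) = dot z z + dot y y.
  by move=> zy; rewrite !(dotDl, dotDr) (dotC y z) zy; ring.
by move=> oP; have := sq _ _ (oP x x); rewrite subrK !sqr_enorm.
Qed.

(* The row space of [P] is the space of vectors which [A] moves most. *)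
Lemma rotation_gap A : orthogonal A -> A != 1%:M ->
  exists P (c c' : R),
    [/\ [/\ 0 <= c', c' < c & forall x, enorm (x *m (A - 1%:M)) <= c * enorm x],
        orth_proj P, A *m P = P *m A,
        (exists2 u, enorm u = 1 & u *m P = u) &
        (forall x, enorm (x *m P *m (A - 1%:M)) = c * enorm (x *m P)) /\
        (forall x, enorm ((x - x *m P) *m (A - 1%:M)) <= c' * enorm (x - x *m P))].
Proof.
move=> oA A1; set D := A - 1%:M.
have [x0 x0D] : exists x, x *m D != 0.
  apply: contrapT => h; move/eqP: A1; apply; apply: mx_ext => x.
  apply/eqP; rewrite -subr_eq0 -mulmxBr; apply/negPn/negP => xD.
  by apply: h; exists x.
have [|u [u1 _] umax] := @max_enorm_mulmx D 0.
  by exists x0; rewrite ?mulmx0//; apply: contraNneq x0D => ->; rewrite mul0mx.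
have {}umax x : enorm (x *m D) <= enorm (u *m D) * enorm x.
  by apply: umax; rewrite mulmx0.
set c := enorm (u *m D) in umax *.
have c0 : 0 < c.
  rewrite lt_neqAle enorm_ge0 andbT; apply: contraNneq x0D => c0.
  by rewrite -enorm_eq0 eq_le enorm_ge0 andbT (le_trans (umax _))// -c0 mul0r.
(* [S] is positive semidefinite with form [c^2 |x|^2 - |x D|^2]. Its kernel is therefore the set of
   vectors stretched by the full factor [c], which is thus a subspace. *)
set S := (c ^+ 2)%:M - D *m D^T.
have qS x : dot (x *m S) x = c ^+ 2 * enorm x ^+ 2 - enorm (x *m D) ^+ 2.
  rewrite mulmxBr mul_mx_scalar dotDl dotNl dotZl -sqr_enorm mulmxA.
  by rewrite (dot_mulmx (x *m D)) trmxK -sqr_enorm.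
have sS : S^T = S.
  by rewrite /S linearB/= tr_scalar_mx trmx_mul trmxK.
have pS x : 0 <= dot (x *m S) x.
  by rewrite qS subr_ge0 -exprMn ler_pXn2r// ?nnegrE ?mulr_ge0// ltW.
have kS x : enorm (x *m D) = c * enorm x -> x *m S = 0.
  by move=> h; apply: psd_ker => //; rewrite qS h exprMn subrr.
have Sk x : x *m S = 0 -> enorm (x *m D) = c * enorm x.
  move=> h; have := qS x; rewrite h dot0l => /eqP; rewrite eq_sym subr_eq0.
  rewrite -exprMn eqrXn2 ?mulr_ge0 ?enorm_ge0 ?(ltW c0)//.
  by move/eqP.
(* [D D^T = 2 - A - A^T], which commutes with [A]. *)
have AS : A *m S = S *m A.
  have -> : S = (c ^+ 2 - 2)%:M + (A + A^T).
    rewrite /S /D linearB/= trmx1 mulmxBl !mulmxBr !mul1mx !mulmx1.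
    have -> : A *m A^T = 1%:M by exact: oA.
    rewrite raddfB /= -[2]/(1 + 1) raddfD /=.
    by apply/matrixP => i j; rewrite !mxE; ring.
  rewrite !mulmxDl !mulmxDr scalar_mxC oA orthogonalV//.
(* As [S] is symmetric, its kernel and its row space are orthogonal complements; [P] projects onto
   the first along the second. *)
have kS0 : (kermx S :&: S = 0)%MS.
  apply/eqP; rewrite -submx0; apply/rV_subP => v; rewrite sub_capmx => /andP[].
  move=> /sub_kermxP vS /submxP[w vw]; rewrite submx0 -dot_eq0 {2}vw dotC.
  by rewrite dot_mulmx sS vS dot0r.
have kSf x : (x <= kermx S + S)%MS.
  apply: submx_trans (submx1 x) _; rewrite sub1mx /row_full.
  by rewrite (mxrank_disjoint_sum kS0) mxrank_ker subnK// rank_leq_row.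
set P := proj_mx (kermx S) S.
have PS x : x *m P *m S = 0 by apply/sub_kermxP; exact: proj_mx_sub.
have P_S x : exists w, x - x *m P = w *m S.
  by apply/submxP; apply: proj_mx_compl_sub.
have PK x : x *m S = 0 -> x *m P = x.
  by move=> /sub_kermxP xS; rewrite proj_mx_id.
have P0 w : w *m S *m P = 0 by rewrite proj_mx_0// submxMl.
clearbody P; have oP : orth_proj P.
  by move=> x y; have [w ->] := P_S y; rewrite dotC dot_mulmx sS PS dot0r.
have AP : A *m P = P *m A.
  apply: mx_ext => x; rewrite !mulmxA.
  rewrite -{1}(subrK (x *m P) x) 2!mulmxDl; have [w ->] := P_S x.
  rewrite -(mulmxA w) -AS mulmxA P0 add0r PK//.
  by rewrite -(mulmxA (x *m P)) AS mulmxA PS mul0mx.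
have main c' : 0 <= c' -> c' < c ->
    (forall x, enorm ((x - x *m P) *m D) <= c' * enorm (x - x *m P)) ->
  exists P (c c' : R),
    [/\ [/\ 0 <= c', c' < c & forall x, enorm (x *m D) <= c * enorm x],
        orth_proj P, A *m P = P *m A,
        (exists2 u, enorm u = 1 & u *m P = u) &
        (forall x, enorm (x *m P *m D) = c * enorm (x *m P)) /\
        (forall x, enorm ((x - x *m P) *m D) <= c' * enorm (x - x *m P))].
  move=> c'0 c'c h; exists P, c, c'; split=> //.
    by exists u => //; apply: PK; apply: kS; rewrite u1 mulr1.
  by split=> // x; exact: Sk.
have xPP x : (x - x *m P) *m P = 0.
  by have [w ->] := P_S x.
(* [c'] is the norm of [D] on the complement, attained at some [w]; were it equal to [c], then [w]
   would lie in the kernel of [S] as well. *)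
have [[x x0' xP]|none] := pselect (exists2 x : 'rV[R]_n, x != 0 & x *m P = 0).
  have [|w [w1 wP] wmax] := @max_enorm_mulmx D P; first by exists x.
  apply: (main (enorm (w *m D))) => // [|y]; last exact: wmax.
  rewrite lt_neqAle; apply/andP; split; last first.
    by have := umax w; rewrite w1 mulr1.
  apply/eqP => wc; have := @kS w; rewrite wc w1 mulr1 => /(_ erefl) /PK.
  rewrite wP => w0; move: w1; rewrite -w0 enorm0 => /eqP.
  by rewrite eq_sym oner_eq0.
(* Here the complement is zero. *)
apply: (main 0) => // y.
have -> : y - y *m P = 0.
  by apply/eqP/negPn/negP => yP; apply: none; exists (y - y *m P).
by rewrite mul0mx enorm0 mulr0.
Qed.

End RotationGap.

Section Pigeonhole.

Lemma seq_min (R : realType) (T : eqType) (s : seq T) (f : T -> R) (P : T -> Prop) :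
  (exists2 x, x \in s & P x) ->
  exists x, [/\ x \in s, P x & forall y, y \in s -> P y -> f x <= f y].
Proof.
elim: s => [[x]//|a s IH] ex.
have [/IH[x [xs Px xmin]]|no] := pselect (exists2 x, x \in s & P x); last first.
  case: ex => x; rewrite inE => /orP[/eqP->|xs] Px; last by exfalso; apply: no; exists x.
  exists a; split=> //; first exact: mem_head.
  move=> y; rewrite inE => /orP[/eqP->//|ys] Py.
  by exfalso; apply: no; exists y.
have [[Pa ax]|h] := pselect (P a /\ f a <= f x).
  exists a; split=> //; first exact: mem_head.
  move=> y; rewrite inE => /orP[/eqP->//|ys] Py.
  by apply: le_trans ax _; exact: xmin.
exists x; split=> //; first by rewrite inE xs orbT.
move=> y; rewrite inE => /orP[/eqP->|]; last exact: xmin.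
by move=> Pa; have [//|/ltW fax] := leP (f x) (f a); exfalso; exact: h.
Qed.

Lemma pigeonhole (T : eqType) (s : seq T) (f : nat -> T) :
  (forall k, f k \in s) -> exists i j, (i < j)%N /\ f i = f j.
Proof.
move=> fs; apply: contrapT => h.
have uf : uniq (map f (iota 0 (size s).+1)).
  rewrite map_inj_in_uniq ?iota_uniq// => i j _ _ ij.
  have [ij'|ij'|//] := ltngtP i j; exfalso; apply: h.
    by exists i, j.
  by exists j, i.
have := uniq_leq_size uf; move=> /(_ s); rewrite size_map size_iota ltnn.
by move=> h'; apply: notF; apply: h' => _ /mapP[i _ ->].
Qed.

End Pigeonhole.

(** [G A b] means that the motion [x |-> x A + b] belongs to the group, so the translation parts
    form the orbit of 0. The last two fields say that 0 is isolated in its orbit with finite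
    stabilizer, and that the orbit is relatively dense. *)
Record crystal (R : realType) (n : nat) (G : 'M[R]_n -> 'rV[R]_n -> Prop) : Prop :=
  Crystal {
  crystal_orth : forall A b, G A b -> orthogonal A ;
  crystal1 : G 1%:M 0 ;
  crystalM : forall A b A' b', G A b -> G A' b' -> G (A' *m A) (b' *m A + b) ;
  crystalV : forall A b, G A b -> G A^T (- (b *m A^T)) ;
  crystal_stab : exists (rho : R) (s : seq 'M[R]_n), 0 < rho /\
    forall A b, G A b -> enorm b < rho -> b = 0 /\ A \in s ;
  crystal_cocompact : exists C : R, forall x : 'rV[R]_n, exists A b, G A b /\ enorm (x - b) <= C }.

(** * Finiteness of the point group *)

Section Bieberbach.
Context {R : realType} {n : nat} (G : 'M[R]_n -> 'rV[R]_n -> Prop).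
Hypothesis cG : crystal G.
Let orthG := crystal_orth cG.
Let mulG := crystalM cG.
Let invG := crystalV cG.

(* [h o g^-1] *)
Lemma crystal_div A b B c : G A b -> G B c -> G (A^T *m B) (c - b *m A^T *m B).
Proof.
move=> gA gB; have := mulG gB (invG gA); congr (G _ _).
by rewrite mulNmx addrC.
Qed.

(* [g^-1 o h] *)
Lemma crystal_ldiv A b B c : G A b -> G B c -> G (B *m A^T) ((c - b) *m A^T).
Proof.
move=> gA gB; have := mulG (invG gA) gB; congr (G _ _).
by rewrite mulmxBl.
Qed.

(** Two elements whose translation parts lie in one ball of radius [rho / 2] differ by an element of
    translation part shorter than [rho], hence by one of the finite stabilizer of 0. One
    representative per ball of a finite net is enough. *)
Lemma crystal_finite C :
  exists s : seq ('M[R]_n * 'rV[R]_n), forall A b, G A b -> enorm b <= C -> (A, b) \in s.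
Proof.
have [rho [s0 [rho0 stab]]] := crystal_stab cG.
have rho2 : 0 < rho / 2 by lra.
have [cs csP] := @totally_bounded R n C (rho / 2) rho2.
pose rep (c : 'rV[R]_n) : 'M[R]_n * 'rV[R]_n := 
  xget (0, 0) [set g | G g.1 g.2 /\ enorm (g.2 - c) < rho / 2].
exists [seq (A *m (rep c).1, (rep c).2) | A <- s0, c <- cs] => A b gA bC.
have [c ccs bc] := csP b bC.
have [gr rc] : G (rep c).1 (rep c).2 /\ enorm ((rep c).2 - c) < rho / 2.
  rewrite /rep; case: xgetP => [g -> //|/(_ (A, b))/= no].
  by exfalso; apply: no.
have [|e As] := stab _ _ (crystal_ldiv gr gA).
  rewrite enorm_orthogonal; last exact: orthogonalT (orthG gr).
  apply: le_lt_trans (enorm_triangle b c _) _.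
  by rewrite (enormB c) [ltRHS]splitr ltrD.
apply/allpairsP; exists (A *m (rep c).1^T, c); split=> //=.
congr (_, _); first by rewrite -mulmxA orthogonalV ?mulmx1//; exact: orthG gr.
apply/eqP; rewrite -subr_eq0; apply/eqP.
by rewrite -(orthogonalKV (b - _) (orthG gr)) e mul0mx.
Qed.

(** Local finiteness turns the infimum of the translation lengths into a minimum. *)
Lemma crystal_min (Q : 'M[R]_n -> 'rV[R]_n -> Prop) :
  (exists A b, G A b /\ Q A b) ->
  exists A b, [/\ G A b, Q A b & forall A' b', G A' b' -> Q A' b' -> enorm b <= enorm b'].
Proof.
move=> [A0 [b0 [g0 q0]]]; have [s sP] := crystal_finite (enorm b0).
have [|[A b] /= [_ [gA qA] bmin]] := @seq_min R _ s (fun g => enorm g.2)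
  (fun g => G g.1 g.2 /\ Q g.1 g.2).
  by exists (A0, b0) => //; exact: sP.
exists A, b; split=> // A' b' g' q'.
have [b'b|/ltW bb'] := leP (enorm b') (enorm b0).
  by apply: (bmin (A', b')) => //; exact: sP.
by apply: le_trans bb'; apply: (bmin (A0, b0)) => //; exact: sP.
Qed.

(** Approximate [K k *: u] by elements [g k]. By compactness of the orthogonal group two of them
    have nearly equal linear parts, and their quotient has a small rotation and still points along
    [u]. *)
Lemma crystal_dir (u : 'rV[R]_n) (mu : R) : enorm u = 1 -> 0 < mu ->
  exists B b (K : R), [/\ G B b, forall x, enorm (x *m (B - 1%:M)) <= mu * enorm x,
    0 < K & enorm (b - K *: u) <= K / 4].
Proof.
move=> u1 mu0; have [C cC] := crystal_cocompact cG.
have C0 : 0 <= C.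
  by have [A [b [_]]] := cC 0; exact: le_trans.
(* The growth gives [8 K i <= K j] for [i < j], so the total error [K i + 2 C] stays below
   [K j / 4]. *)
pose K k := (8 * C + 8) * 8 ^+ k : R.
have K0 k : 8 * C + 8 <= K k.
  by rewrite ler_peMr ?exprn_ege1//; lra.
have Kp k : 0 < K k by have := K0 k; lra.
have /choice[g gP] : forall k, exists g, G g.1 g.2 /\ enorm (K k *: u - g.2) <= C.
  by move=> k; have [A [b h]] := cC (K k *: u); exists (A, b).
have mu2 : 0 < mu / 2 by lra.
have [cs csP] := @totally_bounded R (n * n) n%:R (mu / 2) mu2.
have /choice[f fP] : forall k, exists c : 'rV[R]_(n * n), c \in cs /\ enorm (mxvec (g k).1 - c) < mu / 2.
  move=> k; have [|c cs' h] := csP (mxvec (g k).1); last by exists c.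
  by apply: frobenius_orthogonal; apply: orthG (gP k).1.
have [i [j [ij fij]]] := @pigeonhole _ cs f (fun k => (fP k).1).
have := fP i; have := fP j; rewrite fij.
have := gP i; have := gP j; move: (g i) (g j) => [A b] [B c] /=.
move=> [gB cj] [gA bi] [_ Bf] [_ Af].
exists (A^T *m B), (c - b *m A^T *m B), (K j); split=> //.
- exact: crystal_div.
- move=> x; have -> : x *m (A^T *m B - 1%:M) = x *m A^T *m (B - A).
    by rewrite !mulmxBr mulmx1 mulmxA orthogonalKV//; exact: orthG gA.
  rewrite (le_trans (enorm_mulmx _ _))// enorm_orthogonal; last first.
    by apply: orthogonalT; exact: orthG gA.
  rewrite ler_wpM2r// /frobenius linearB /=.
  apply/ltW; apply: le_lt_trans (enorm_triangle _ (f j) _) _.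
  by rewrite (enormB (f j)) [ltRHS]splitr ltrD.
have Kij : 8 * K i <= K j.
  rewrite /K mulrCA -exprS ler_wpM2l ?ler_eXn2l//; lra.
have bn : enorm b <= K i + C.
  have := lerB_enorm b (K i *: u); rewrite enormB enormZ u1 mulr1.
  by rewrite ger0_norm ?(ltW (Kp i))//; lra.
have : enorm (c - b *m A^T *m B - K j *: u) <= enorm (c - K j *: u) + enorm b.
  have <- : enorm (b *m A^T *m B) = enorm b.
    rewrite enorm_orthogonal; last exact: orthG gB.
    by rewrite enorm_orthogonal//; apply: orthogonalT; exact: orthG gA.
  by rewrite addrAC enorm_sub.
by rewrite (enormB c); have := K0 i; lra.
Qed.

Lemma orth_proj_le (P : 'M[R]_n) x : orth_proj P -> enorm (x *m P) <= enorm x.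
Proof.
move=> oP; rewrite -(@ler_pXn2r _ 2%N)// ?nnegrE//.
by rewrite (orth_proj_sqr x oP) lerDl sqr_ge0.
Qed.

Lemma orth_projC_le (P : 'M[R]_n) x : orth_proj P -> enorm (x - x *m P) <= enorm x.
Proof.
move=> oP; rewrite -(@ler_pXn2r _ 2%N)// ?nnegrE//.
by rewrite (orth_proj_sqr x oP) lerDr sqr_ge0.
Qed.

(* P. Buser's proof of Bieberbach's theorem: a commutator with a shortest
   non-translation [(A, a)] of small rotation contracts the translation parts. *)
Lemma crystal_small_rotation A a : G A a ->
  (forall x, enorm (x *m (A - 1%:M)) <= 2^-1 * enorm x) -> A = 1%:M.
Proof.
move=> gA0 A0h; apply/eqP/negPn/negP => A01.
pose Q (A : 'M[R]_n) (a : 'rV[R]_n) :=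
  A != 1%:M /\ forall x, enorm (x *m (A - 1%:M)) <= 2^-1 * enorm x.
have [|{A0h A01 gA0}{}A [{}a [gA [A1 Ah] amin]]] := @crystal_min Q.
  by exists A, a.
have oA := orthG gA.
have [P [c [c' [[c'0 c'c cA] oP AP [u u1 uP] [Pc Pc']]]]] := rotation_gap oA A1.
have c2 : c <= 2^-1 by have := Pc u; have := Ah u; rewrite uP u1; lra.
(* With this choice the error [r] below satisfies [|r| <= 2 mu |b| <= 4 mu |b P|], that is, half of
   the gap [c - c'] times [|b P|]. *)
set mu := (c - c') / 8; have mu0 : 0 < mu by rewrite /mu; lra.
(* Elements of still smaller rotation whose translation part leans towards the space that [A] moves
   most. One exists by [crystal_dir], and a shortest one is taken. *)
pose Q' (B : 'M[R]_n) (b : 'rV[R]_n) := [/\ b != 0, enorm (b - b *m P) <= enorm (b *m P)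
  & forall x, enorm (x *m (B - 1%:M)) <= mu * enorm x].
have [|B [b [gB [b0 bP Bmu] bmin]]] := @crystal_min Q'.
  have [B [b [K [gB Bmu K0 bK]]]] := crystal_dir u1 mu0.
  have [e be {}bK] : exists2 e : 'rV[R]_n, b = K *: u + e & enorm e <= K / 4.
    by exists (b - K *: u) => //; rewrite addrC subrK.
  have bPe : b *m P = K *: u + e *m P by rewrite be mulmxDl -scalemxAl uP.
  have Ku : enorm (K *: u) = K by rewrite enormZ u1 mulr1 gtr0_norm.
  have h1 := orth_proj_le e oP; have h2 := orth_projC_le e oP.
  have h3 := lerB_enorm (K *: u) (- (e *m P)); rewrite opprK -bPe enormN Ku in h3.
  have h4 : b - b *m P = e - e *m P by rewrite bPe {1}be opprD addrACA subrr add0r.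
  exists B, b; split=> //; split=> //; last by rewrite h4; lra.
  by apply: contraTneq K0 => b00; move: h3; rewrite b00 mul0mx enorm0; lra.
have oB := orthG gB.
(* Linear and translation parts of the commutator [g h g^-1 h^-1] of [g = (A, a)] and
   [h = (B, b)]. *)
set T := B^T *m A^T *m (B *m A).
set b' := (- (b *m B^T) *m A^T + - (a *m A^T)) *m (B *m A) + (b *m A + a).
have gT : G T b' by exact: mulG (mulG gA gB) (mulG (invG gA) (invG gB)).
have bn0 : 0 < enorm b by rewrite enorm_gt0.
have Tmu x : enorm (x *m (T - 1%:M)) <= mu * enorm x.
  have [y [yAB yBA yx]] : exists y,
      [/\ y *m A *m B = x, x *m T = y *m B *m A & enorm y = enorm x].
    exists (x *m B^T *m A^T); split; rewrite /T ?mulmxA//.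
      by rewrite (orthogonalKV _ oA) (orthogonalKV _ oB).
    by rewrite !enorm_orthogonal//; apply: orthogonalT.
  have -> : x *m (T - 1%:M) = y *m (B - 1%:M) *m (A - 1%:M) - y *m (A - 1%:M) *m (B - 1%:M).
    rewrite !mulmxBr yBA !mulmxBl !mulmx1 yAB.
    by apply/rowP => i; rewrite !mxE; ring.
  have h1 := Ah (y *m (B - 1%:M)); have h2 := Bmu y.
  have h3 := Bmu (y *m (A - 1%:M)); have h4 := Ah y.
  have h5 := enorm_sub (y *m (B - 1%:M) *m (A - 1%:M)) (y *m (A - 1%:M) *m (B - 1%:M)).
  by rewrite yx in h2 h4; nra.
set r := b *m (1%:M - T) - a *m A^T *m (B - 1%:M) *m A.
have b'E : b' = b *m (A - 1%:M) + r.
  rewrite /b' /r mulmxDl !mulNmx -(mulmxA b) -(mulmxA b) -/T.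
  rewrite !mulmxBr !mulmxBl !mulmx1 (orthogonalKV _ oA) !mulmxA.
  by apply/rowP => i; rewrite !mxE; ring.
have rb : enorm r <= 2 * mu * enorm b.
  (* If [B] is not the identity it competes with [A] in the choice of [a], so [|a| <= |b|] and both
     terms of [r] are controlled by [|b|]. *)
  have [B1|B1] := eqVneq B 1%:M.
    have -> : r = 0.
      have T1 : T = 1%:M by rewrite /T B1 trmx1 !mul1mx orthogonalV.
      by rewrite /r T1 B1 !subrr !(mulmx0, mul0mx) subrr.
    by rewrite enorm0; nra.
  have ab : enorm a <= enorm b.
    apply: (amin B b) => //; split=> // x; apply: le_trans (Bmu x) _.
    by rewrite ler_wpM2r// /mu; lra.
  have h1 : enorm (b *m (1%:M - T)) <= mu * enorm b.
    by rewrite -opprB mulmxN enormN.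
  have h2 : enorm (a *m A^T *m (B - 1%:M) *m A) <= mu * enorm a.
    rewrite (enorm_orthogonal _ oA) (le_trans (Bmu _))//.
    by rewrite enorm_orthogonal//; exact: orthogonalT.
  have := enorm_sub (b *m (1%:M - T)) (a *m A^T *m (B - 1%:M) *m A).
  by rewrite -/r; nra.
have b'P : b' *m P = b *m P *m (A - 1%:M) + r *m P.
  by rewrite b'E mulmxDl !mulmxBr !mulmx1 !mulmxBl -(mulmxA b A) AP mulmxA.
have b'PC : b' - b' *m P = (b - b *m P) *m (A - 1%:M) + (r - r *m P).
  by rewrite b'P b'E [(b - _) *m _]mulmxBl opprD addrACA.
have p0 : 0 < enorm (b *m P).
  rewrite lt_neqAle enorm_ge0 andbT eq_sym; apply: contraNneq b0 => p0.
  have : b - b *m P == 0 by rewrite -enorm_eq0 eq_le enorm_ge0 andbT -p0.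
  by move/eqP: p0; rewrite enorm_eq0 => /eqP->; rewrite subr0.
have bp : enorm b <= 2 * enorm (b *m P).
  by have := enormD (b *m P) (b - b *m P); rewrite addrC subrK; lra.
have h1 := orth_proj_le r oP; have h2 := orth_projC_le r oP.
have h3 := lerB_enorm (b *m P *m (A - 1%:M)) (- (r *m P)).
rewrite opprK -b'P enormN Pc in h3.
have h4 := enormD ((b - b *m P) *m (A - 1%:M)) (r - r *m P).
rewrite -b'PC in h4; have h5 := Pc' b.
have h6 := enormD (b *m (A - 1%:M)) r; rewrite -b'E in h6; have h7 := cA b.
have rp : enorm r <= (c - c') / 2 * enorm (b *m P) by move: rb; rewrite /mu; nra.
have h8 : c' * enorm (b - b *m P) <= c' * enorm (b *m P) by rewrite ler_wpM2l.
(* The [P] component is multiplied by [c] and the other one by at most [c'], up to [r]; hence the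
   commutator still satisfies [Q']. Its length is at most [c |b| + |r|] with [c <= 1/2], against the
   choice of [b]. *)
have : enorm b <= enorm b'.
  apply: (bmin T) => //; split=> //; last by lra.
  apply: contraTneq p0 => b'0; rewrite -leNgt.
  by rewrite b'0 mul0mx enorm0 in h3; nra.
apply/negP; rewrite -ltNge; move: rb; rewrite /mu; nra.
Qed.

(** Two linear parts within [1/4] of the same point of a net differ by a rotation to which
    [crystal_small_rotation] applies, so they are equal. *)
Lemma crystal_linear_parts : exists s : seq 'M[R]_n,
  [/\ uniq s, forall A b, G A b -> A \in s & forall A, A \in s -> exists b, G A b].
Proof.
have e4 : 0 < 4^-1 :> R by lra.
have [cs csP] := @totally_bounded R (n * n) n%:R 4^-1 e4.
pose rep (c : 'rV[R]_(n * n)) : 'M[R]_n := xget 0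
  [set A | (exists b, G A b) /\ enorm (mxvec A - c) < 4^-1].
exists (undup [seq A <- map rep cs | `[< exists b, G A b >]]); split.
- exact: undup_uniq.
- move=> A b gA; rewrite mem_undup mem_filter; apply/andP; split.
    by apply/asboolP; exists b.
  have [|c ccs Ac] := csP (mxvec A); first exact: frobenius_orthogonal (orthG gA).
  apply/mapP; exists c => //.
  have [[b' gr] rc] : (exists b, G (rep c) b) /\ enorm (mxvec (rep c) - c) < 4^-1.
    rewrite /rep; case: xgetP => [B -> //|/(_ A) no].
    by exfalso; apply: no; split=> //; exists b.
  have AB : A^T *m rep c = 1%:M; last by rewrite -[LHS]mulmx1 -AB mulmxA (orthG gA) mul1mx.
  apply: (crystal_small_rotation (crystal_div gA gr)) => x.
  have -> : x *m (A^T *m rep c - 1%:M) = x *m A^T *m (rep c - A).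
    by rewrite !mulmxBr mulmx1 mulmxA orthogonalKV//; exact: orthG gA.
  rewrite (le_trans (enorm_mulmx _ _))// enorm_orthogonal; last first.
    by apply: orthogonalT; exact: orthG gA.
  rewrite ler_wpM2r// /frobenius linearB /=.
  have := enorm_triangle (mxvec (rep c)) c (mxvec A); rewrite (enormB c).
  lra.
- by move=> A; rewrite mem_undup mem_filter => /andP[/asboolP].
Qed.

End Bieberbach.

(** Every orbit in [S] has [#|K|] elements. *)
Lemma dvdn_card_free (T : finType) (K : {group {perm T}}) (S : {set T}) :
  (forall t s, t \in S -> s \in K -> s t \in S) ->
  (forall t s, t \in S -> s \in K -> s t = t -> s = 1%g) ->
  (#|K| %| #|S|)%N.
Proof.
move=> KS free.
have aS : [acts K, on S | 'P].
  apply/fintype.subsetP => s sK; rewrite !inE; apply/fintype.subsetP => t tS.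
  by rewrite inE; exact: KS.
rewrite -(acts_sum_card_orbit aS); apply: dvdn_sum => _ /imsetP[t tS ->].
rewrite card_orbit (_ : 'C_K[t | 'P]%g = 1%G) ?indexg1//.
apply/trivgP/fintype.subsetP => s; rewrite inE => /andP[sK /astab1P st].
by apply/set1gP; exact: free tS sK st.
Qed.

(** * Torsion points of the torus and the action of the group on them *)

Section Counting.
Context {R : realType} {n : nat} (G : 'M[R]_n -> 'rV[R]_n -> Prop).
Hypothesis cG : crystal G.
Let orthG := crystal_orth cG.
Let G1 := crystal1 cG.
Let mulG := crystalM cG.
Let invG := crystalV cG.
Hypothesis nontrivial : exists2 A : 'M[R]_n, A != 1%:M & G A 0.
(** [G A' x] for some [A'] says that [x] is in the orbit of 0. *)
Hypothesis fixG : forall (A : 'M[R]_n) (b x : 'rV[R]_n), G A b -> x *m A + b = x ->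
  (A = 1%:M /\ b = 0) \/ exists A', G A' x.

Definition translation (l : 'rV[R]_n) := G 1%:M l.
Local Notation L := translation.

Lemma translation0 : L 0. Proof. exact: G1. Qed.

Lemma translationD l l' : L l -> L l' -> L (l + l').
Proof. by move=> h h'; have := mulG h' h; rewrite /L !mulmx1. Qed.

Lemma translationN l : L l -> L (- l).
Proof. by move=> h; have := invG h; rewrite /L trmx1 mulmx1. Qed.

Lemma translationB l l' : L l -> L l' -> L (l - l').
Proof. by move=> h h'; apply: translationD h _; exact: translationN. Qed.

Lemma translationMn l k : L l -> L (l *+ k).
Proof.
move=> h; elim: k => [|k IH]; first exact: translation0.
by rewrite mulrS; exact: translationD.
Qed.

Lemma translation_sum (I : Type) (r : seq I) (P : pred I) (F : I -> 'rV[R]_n) :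
  (forall i, P i -> L (F i)) -> L (\sum_(i <- r | P i) F i).
Proof.
move=> h; elim/big_rec: _ => [|i x Pi Lx]; first exact: translation0.
exact: translationD (h _ Pi) Lx.
Qed.

Lemma translation_linear_part A b b' : G A b -> G A b' -> L (b' - b).
Proof.
move=> g g'; have := crystal_div cG g g'.
by rewrite /L -mulmxA orthogonalV ?mulmx1//; exact: orthG g.
Qed.

Lemma translationJ A b l : G A b -> L l -> L (l *m A).
Proof.
move=> g h; have := mulG g h; rewrite mul1mx => /(translation_linear_part g).
by rewrite addrK.
Qed.

Lemma crystal_translate A b l : G A b -> L l -> G A (b + l).
Proof. by move=> g h; have := mulG h g; rewrite !mulmx1. Qed.

(** The fixed points of a linear element are stable under scaling. A nonzero one could be brought
    within [rho] of 0, where by [fixG] it would be a point of the orbit of 0 contradicting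
    discreteness. *)
Lemma crystal_fixed_free (A : 'M[R]_n) (x : 'rV[R]_n) : A != 1%:M -> G A 0 -> x *m A = x -> x = 0.
Proof.
move=> A1 gA xA; apply/eqP/negPn/negP => x0.
have [rho [s [rho0 stab]]] := crystal_stab cG.
have xp : 0 < enorm x by rewrite enorm_gt0.
pose t := rho / 2 / enorm x.
have t0 : 0 < t by rewrite !divr_gt0.
have tx : enorm (t *: x) = rho / 2 by rewrite enormZ gtr0_norm// /t divfK// gt_eqF.
have [|[/eqP]|[A' gA']] := @fixG A 0 (t *: x) gA.
- by rewrite addr0 -scalemxAl xA.
- by rewrite (negbTE A1).
have [|+ _] := stab _ _ gA'; first by rewrite tx; lra.
by move/eqP; rewrite scaler_eq0 (gt_eqF t0) (negbTE x0).
Qed.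

(** Correcting by one chosen element for each of the finitely many linear parts turns any element
    into a translation at bounded cost. *)
Lemma translation_cocompact : exists C : R, forall x : 'rV[R]_n,
  exists2 l, L l & enorm (x - l) <= C.
Proof.
have [C cC] := crystal_cocompact cG.
have [s [_ sG Gs]] := crystal_linear_parts cG.
pose r A := xget 0 [set b | G A b].
have rP A : A \in s -> G A (r A).
  by move=> /Gs[b gb]; rewrite /r; case: xgetP => [c -> //|/(_ b)].
exists (C + \sum_(A <- s) enorm (r A)) => x.
have [A [b [gA xb]]] := cC x; have As := sG _ _ gA.
exists (b - r A); first exact: translation_linear_part (rP _ As) gA.
have -> : x - (b - r A) = (x - b) + r A by rewrite opprB addrA addrAC.
apply: le_trans (enormD _ _) (lerD xb _).
by rewrite (big_rem A)//= lerDl sumr_ge0.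
Qed.

Lemma shortest_translation : exists l0, [/\ L l0, l0 != 0 &
  forall l, L l -> enorm l < enorm l0 -> l = 0].
Proof.
have [C cC] := translation_cocompact.
have C0 : 0 <= C by have [l _] := cC 0; exact: le_trans.
have [A A1 _] := nontrivial.
have [x x0] : exists x : 'rV[R]_n, x != 0.
  apply: contrapT => h; move/eqP: A1; apply; apply: mx_ext => x.
  suff -> : x = 0 by rewrite !mul0mx.
  by apply/eqP/negPn/negP => x0; apply: h; exists x.
have [|B [l0 [g0 [B1 l00] lmin]]] := @crystal_min _ _ _ cG (fun A b => A = 1%:M /\ b != 0).
  (* A point at distance [C + 1] from 0 is not approximated by the zero translation. *)
  have [l Ll xl] := cC ((C + 1) *: ((enorm x)^-1 *: x)).
  exists 1%:M, l; split=> //; split=> //; apply: contraTneq xl => ->.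
  by rewrite subr0 enormZ enorm_unit// mulr1 ger0_norm; lra.
rewrite {}B1 in g0; exists l0; split=> // l Ll; apply: contraPP => /eqP l0'.
by apply/negP; rewrite -leNgt; apply: (lmin 1%:M).
Qed.

Definition mxpow (A : 'M[R]_n) k : 'M[R]_n := iter k (mulmx^~ A) 1%:M.

Lemma mxpowD A i j : mxpow A (i + j) = mxpow A j *m mxpow A i.
Proof.
by rewrite /mxpow; elim: i => [|i IH]; rewrite ?mulmx1// addSn /= IH mulmxA.
Qed.

(* Averaging the cocycle [A |-> b mod L] over the point group. *)
Lemma crystal_rational : exists2 m, (0 < m)%N &
  forall A b, G A b -> L (b *+ m).
Proof.
have [s [us sG Gs]] := crystal_linear_parts cG.
have [g g1 gg] := nontrivial.
pose r A := xget 0 [set b | G A b].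
have rP A : A \in s -> G A (r A).
  by move=> /Gs[b gb]; rewrite /r; case: xgetP => [c -> //|/(_ b)].
pose c := \sum_(A <- s) r A.
(* Modulo [L], [r B *m A + b] equals [r (B *m A)]. Summing over [B] and reindexing by [B |-> B *m A]
   gives the identity. *)
have avg A b : G A b -> L (b *+ size s - (c - c *m A)).
  move=> gA.
  have Es : perm_eq [seq B *m A | B <- s] s.
    apply: uniq_perm => //.
      rewrite map_inj_in_uniq// => B C _ _ BC.
      by rewrite -[B]mulmx1 -[C]mulmx1 -(orthG gA) !mulmxA BC.
    have inj : {in s &, injective (mulmx^~ A)}.
      move=> B C _ _ BC.
      by rewrite -[B]mulmx1 -[C]mulmx1 -(orthG gA) !mulmxA BC.
    have [|||//] := @uniq_min_size _ [seq B *m A | B <- s] s.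
    - by rewrite map_inj_in_uniq.
    - move=> _ /mapP[B /rP gB ->]; exact: sG (mulG gA gB).
    - by rewrite size_map.
  have -> : b *+ size s - (c - c *m A) = \sum_(B <- s) (r B *m A + b - r (B *m A)).
    rewrite !big_split/= big_const_seq count_predT iter_addr_0 -mulmx_suml -/c.
    rewrite sumrN; have -> : \sum_(B <- s) r (B *m A) = c.
      by rewrite /c -[RHS](perm_big _ Es) big_map.
    by rewrite opprB addrA [in RHS](addrC (c *m A)).
  rewrite big_seq; apply: translation_sum => B Bs.
  have gBA := mulG gA (rP _ Bs).
  exact: translation_linear_part (rP _ (sG _ _ gBA)) gBA.
have gpow k : G (mxpow g k) 0.
  elim: k => [|k IH]; first exact: G1.
  by have := mulG gg IH; rewrite mul0mx addr0.
have [i [j [ij gij]]] := @pigeonhole _ s (mxpow g) (fun k => sG _ _ (gpow k)).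
have [q q0 gq] : exists2 q, (0 < q)%N & mxpow g q = 1%:M.
  exists (j - i)%N; rewrite ?subn_gt0//.
  have := mxpowD g (j - i) i; rewrite subnK ?(ltnW ij)// -gij => h.
  by rewrite -[LHS]mul1mx -(orthogonalV (orthG (gpow i))) -mulmxA -h.
(* The sum of the [c g^k] is fixed by [g], hence 0. So [q c] is the sum of the [c - c g^k], which
   lie in [L] by [avg] applied to [(g^k, 0)]. *)
have qc : L (c *+ q).
  have sum0 : \sum_(k < q) c *m mxpow g k = 0.
    apply: (crystal_fixed_free g1 gg); rewrite mulmx_suml.
    case: q q0 gq => // q _ gq.
    rewrite big_ord_recr [in RHS]big_ord_recl /= addrC.
    congr (_ + _); first by rewrite -mulmxA; congr mulmx; exact: gq.
    by apply: eq_bigr => k _; rewrite -mulmxA.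
  have -> : c *+ q = \sum_(k < q) (c - c *m mxpow g k).
    by rewrite big_split/= sumr_const card_ord sumrN sum0 subr0.
  apply: translation_sum => k _; have := translationN (avg _ _ (gpow k)).
  by rewrite mul0rn sub0r opprK.
exists (size s * q)%N.
  rewrite muln_gt0 q0 andbT; have := sG _ _ gg; by case: (s).
move=> A b gA; have := translationMn q (avg _ _ gA).
rewrite mulrnBl -mulrnA => h.
rewrite -(subrK ((c - c *m A) *+ q) (b *+ _)); apply: translationD => //.
rewrite mulrnBl; apply: translationB => //; have := translationJ gA qc.
by rewrite -(scaler_nat q c) -scalemxAl scaler_nat.
Qed.

Section FiniteQuotient.
Variables (N : nat) (l0 : 'rV[R]_n).
Hypotheses (N3 : (2 < N)%N) (NG : forall A b, G A b -> L (b *+ N)).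
Hypotheses (Ll0 : L l0) (l00 : l0 != 0).
Hypothesis l0min : forall l, L l -> enorm l < enorm l0 -> l = 0.

Let Y (y : 'rV[R]_n) := L (y *+ N).

Let YL l : L l -> Y l.
Proof. exact: translationMn. Qed.

Let YD y y' : Y y -> Y y' -> Y (y + y').
Proof. by rewrite /Y mulrnDl; exact: translationD. Qed.

Let YJ A b y : G A b -> Y y -> Y (y *m A + b).
Proof.
move=> gA Yy; apply: YD; last exact: NG gA.
by rewrite /Y -scaler_nat scalemxAl scaler_nat; exact: translationJ gA _.
Qed.

(* [X] represents the [N]-torsion points of the torus [R^n / L]. *)
Lemma torsion_representatives : exists (X : seq 'rV[R]_n) (kappa : 'rV[R]_n -> 'rV[R]_n),
  [/\ forall x, L (x - kappa x), forall x y, L (x - y) -> kappa x = kappa y,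
      forall x, Y x -> kappa x \in X & forall x, x \in X -> Y x /\ kappa x = x].
Proof.
have [C cC] := translation_cocompact.
(* The set given to [xget] depends only on the class of [x] modulo [L], so the chosen representative
   does too. *)
pose kappa (x : 'rV[R]_n) : 'rV[R]_n := xget 0 [set y | L (x - y) /\ enorm y <= C].
have kP x : L (x - kappa x) /\ enorm (kappa x) <= C.
  rewrite /kappa; case: xgetP => [y -> //|no].
  have [l Ll xl] := cC x; exfalso; apply: (no (x - l)); split=> //.
  by rewrite opprB addrC subrK.
have kL x y : L (x - y) -> kappa x = kappa y.
  move=> xy; rewrite /kappa; congr xget; apply/seteqP; split=> z /= [h zC]; split=> //.
    by rewrite -(subrK x y) -addrA; apply: translationD h; rewrite -opprB; exact: translationN.
  by rewrite -(subrK y x) -addrA; apply: translationD h.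
have Yk x : Y x -> Y (kappa x).
  move=> Yx; rewrite -(subrK x (kappa x)); apply: YD Yx; apply: YL.
  by rewrite -opprB; apply: translationN; exact: (kP x).1.
have kk x : kappa (kappa x) = kappa x.
  by apply: kL; rewrite -opprB; apply: translationN; exact: (kP x).1.
(* [N] times a torsion representative is a translation of length at most [N C]. *)
have [s sP] := crystal_finite cG (N%:R * C).
exists [seq kappa y | y <- [seq N%:R^-1 *: g.2 | g <- s] & `[< Y y >]], kappa.
split=> //; first by move=> x; exact: (kP x).1.
  move=> x Yx; rewrite -kk; apply: map_f; rewrite mem_filter.
  apply/andP; split; first by apply/asboolP; exact: Yk.
  apply/mapP; exists (1%:M, kappa x *+ N).
    apply: sP; first exact: Yk.
    by rewrite -scaler_nat enormZ ger0_norm// ler_wpM2l// (kP x).2.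
  by rewrite /= -(scaler_nat N (kappa x)) scalerA mulVf ?scale1r// pnatr_eq0; case: (N) N3.
move=> x /mapP[y]; rewrite mem_filter => /andP[/asboolP Yy _] ->.
by split; [exact: Yk|exact: kk].
Qed.

(* The finite group [K] induced by [G] on the [N]-torsion points of the torus acts
   freely off the orbit [S] of [0].  Since [#|K|] divides the number of torsion
   points, it divides [#|S|], which is smaller because [0] has a nontrivial
   stabilizer. *)
Lemma torsion_count (ls : seq 'M[R]_n) :
  (forall A b, G A b -> A \in ls) -> ((size ls)`! %| N)%N -> False.
Proof.
move=> lsG lsN.
have [X [k [kL kE kX Xk]]] := torsion_representatives.
pose T := seq_sub X.
have N0 : N%:R != 0 :> R by rewrite pnatr_eq0; case: (N) N3.
have Nl : (0 : R) < enorm l0 by rewrite enorm_gt0.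
have YT (t : T) : Y (val t) by exact: (Xk _ (valP t)).1.
have kT (t : T) : k (val t) = val t by exact: (Xk _ (valP t)).2.
have [mk mkE] : exists mk : 'rV[R]_n -> T, forall x, Y x -> val (mk x) = k x.
  have Y0 : Y 0 by apply: YL; exact: translation0.
  exists (fun x => insubd (SeqSub (kX 0 Y0)) (k x)) => x Yx.
  by rewrite val_insubd kX.
have permF F : (forall x, Y x -> Y (F x)) ->
    (forall x y, L (x - y) <-> L (F x - F y)) ->
    exists s : {perm T}, forall x, Y x -> val (s (mk x)) = k (F x).
  move=> YF LF.
  have inj : injective (fun t : T => mk (F (val t))).
    move=> t t' /(congr1 val); rewrite !mkE; try exact/YF/YT.
    move=> h; apply: val_inj; rewrite -kT -(kT t'); apply: kE; apply/LF.
    have := translationB (kL (F (val t))) (kL (F (val t'))).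
    by rewrite h opprB addrA subrK.
  exists (perm inj) => x Yx; rewrite permE (mkE (F _)); last exact/YF/YT.
  rewrite mkE//; apply: kE; apply: (LF _ _).1; rewrite -opprB; apply: translationN.
  exact: kL.
have mkT t : mk (val t) = t by apply: val_inj; rewrite mkE// kT.
have mk_eq x y : Y x -> Y y -> (mk x = mk y) <-> L (x - y).
  move=> Yx Yy; split=> [/(congr1 val)|xy]; last by apply: val_inj; rewrite !mkE//; exact: kE.
  rewrite !mkE// => h; have := translationB (kL x) (kL y).
  by rewrite h opprB addrA subrK.
have {permF} permF F : (forall x, Y x -> Y (F x)) ->
    (forall x y, L (x - y) <-> L (F x - F y)) ->
    exists s : {perm T}, forall x, Y x -> s (mk x) = mk (F x).
  move=> YF LF; have [s sP] := permF F YF LF; exists s => x Yx.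
  by apply: val_inj; rewrite sP// mkE//; exact: YF.
pose y0 := N%:R^-1 *: l0.
have y0N : y0 *+ N = l0 by rewrite -scaler_nat scalerA divff ?scale1r.
have Yy0 : Y y0 by rewrite /Y y0N.
have y0n : enorm y0 = enorm l0 / N%:R.
  by rewrite enormZ ger0_norm ?invr_ge0// mulrC.
have [tau tauP] : exists s : {perm T}, forall x, Y x -> s (mk x) = mk (x + y0).
  apply: permF => [x Yx|x y]; first exact: YD.
  by rewrite opprD addrACA subrr addr0.
have tauX j x : Y x -> (tau ^+ j)%g (mk x) = mk (x + y0 *+ j) /\ Y (x + y0 *+ j).
  move=> Yx; elim: j => [|j [IH Yj]]; first by rewrite expg0 perm1 mulr0n addr0.
  rewrite expgSr permM IH tauP// mulrSr addrA; split=> //.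
  exact: YD.
have Y0 : Y 0 by apply: YL; exact: translation0.
(* Otherwise the remainder of [j] modulo [N] would give a nonzero translation shorter than [l0].
   Hence [tau], the translation by [y0], has order divisible by [N]. *)
have Ndvd j : L (y0 *+ j) -> (N %| j)%N.
  rewrite {1}(divn_eq j N) mulrnDr mulnC mulrnA y0N => h.
  have {h} : L (y0 *+ (j %% N)).
    rewrite -(addKr (l0 *+ (j %/ N)) (y0 *+ _)); apply: translationD => //.
    by apply: translationN; exact: translationMn.
  move=> /l0min h; rewrite /dvdn; have := h; rewrite -scaler_nat enormZ ger0_norm// y0n.
  have jN : (j %% N < N)%N by rewrite ltn_mod; case: (N) N3.
  rewrite mulrCA gtr_pMr// ltr_pdivrMr ?ltr0n ?(leq_ltn_trans _ jN)// mul1r ltr_nat.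
  move=> /(_ jN) /eqP; rewrite scaler_eq0 pnatr_eq0 => /orP[//|/eqP y00].
  by move: l00; rewrite -y0N y00 mul0rn eqxx.
have NT : (N %| #|[set: T]%SET|)%N.
  apply: (@dvdn_trans #[tau]%g).
    apply: Ndvd; rewrite -[y0 *+ _]subr0.
    have := (tauX #[tau]%g 0 Y0).1; rewrite expg_order perm1 add0r => h.
    have Yt : Y (y0 *+ #[tau]%g) by have := (tauX #[tau]%g 0 Y0).2; rewrite add0r.
    exact: (mk_eq _ _ Yt Y0).1 (esym h).
  apply: dvdn_card_free => [t s _ _|t s _ /cycleP[j ->] tj]; first by rewrite inE.
  have [+ Yj] := tauX j _ (YT t); rewrite mkT tj -{1}(mkT t) => /esym/mk_eq.
  move=> /(_ Yj (YT t)); rewrite addrC addKr => Lj.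
  apply/permP => t'; rewrite perm1 -{1}(mkT t') (tauX j _ (YT t')).1 -[RHS]mkT.
  have Yj' := (tauX j _ (YT t')).2.
  apply: (mk_eq _ _ Yj' (YT t')).2; have -> // : val t' + y0 *+ j - val t' = y0 *+ j.
  by rewrite addrC addKr.
pose H := [set s : {perm T} | `[< exists A b, G A b /\
  forall x, Y x -> s (mk x) = mk (x *m A + b) >]]%SET.
have HP s : s \in H -> exists A b, G A b /\ forall x, Y x -> s (mk x) = mk (x *m A + b).
  by rewrite inE => /asboolP.
have gperm A b : G A b -> exists2 s, s \in H & forall x, Y x -> s (mk x) = mk (x *m A + b).
  move=> gA; have [|s sP] := permF (fun x => x *m A + b) (fun x => @YJ A b x gA).
    move=> x y; rewrite opprD addrACA subrr addr0 -mulmxBl.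
    split=> [|h]; first exact: translationJ gA.
    by have := translationJ (invG gA) h; rewrite (orthogonalK _ (orthG gA)).
  by exists s => //; rewrite inE; apply/asboolP; exists A, b.
have gH : group_set H.
  apply/group_setP; split.
    rewrite inE; apply/asboolP; exists 1%:M, 0; split=> // x _.
    by rewrite perm1 mulmx1 addr0.
  move=> s s' /HP[A [b [gA sP]]] /HP[A' [b' [gA' sP']]].
  rewrite inE; apply/asboolP; exists (A *m A'), (b *m A' + b'); split.
    exact: mulG.
  move=> x Yx; rewrite permM sP// sP'; last exact: YJ.
  by rewrite mulmxDl mulmxA addrA.
pose K := Group gH.
have Keq A b b' (s s' : {perm T}) : G A b -> G A b' ->
    (forall x, Y x -> s (mk x) = mk (x *m A + b)) ->
    (forall x, Y x -> s' (mk x) = mk (x *m A + b')) -> s = s'.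
  move=> g g' sP sP'; apply/permP => t; rewrite -(mkT t) sP// sP'//.
  apply/mk_eq; try exact: YJ.
  by rewrite opprD addrACA subrr add0r; exact: translation_linear_part g' g.
(* By [Keq] an element of [K] is determined by the linear part of a lift, so [#|K|] is at most
   [size ls] and divides its factorial. *)
have KT : (#|K| %| #|[set: T]%SET|)%N.
  apply: dvdn_trans NT; apply: dvdn_trans lsN; apply: dvdn_fact.
  rewrite cardG_gt0 /=.
  have /choice[f fP] : forall s : {perm T}, exists A, s \in H -> A \in ls /\
      exists b, G A b /\ forall x, Y x -> s (mk x) = mk (x *m A + b).
    move=> s; have [/HP[A [b [gA sP]]]|] := boolP (s \in H); last by exists 1%:M.
    by exists A => _; split; [exact: lsG gA|exists b].
  rewrite cardE -(size_map f); apply: uniq_leq_size.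
    rewrite map_inj_in_uniq ?enum_uniq// => s s'; rewrite !mem_enum.
    move=> /fP[_ [b [g sP]]] /fP[_ [b' [g' sP']]] ff.
    by rewrite ff in g sP; exact: Keq g g' sP sP'.
  by move=> _ /mapP[s + ->]; rewrite mem_enum => /fP[].
pose t0 := mk 0; pose S := orbit 'P K t0.
(* If [s] fixes a torsion class, some lift of [s] fixes a representative. By [fixG] that lift is
   trivial or the class lies in [S]. *)
have KS : (#|K| %| #|~: S|)%N.
  apply: dvdn_card_free => t s; rewrite !finset.in_setC => tS sK.
    apply: contraNN tS => /orbitP[s' s'K]; rewrite /= /aperm => st.
    apply/orbitP; exists (s' * s^-1)%g; first by rewrite groupM ?groupV.
    by rewrite /= /aperm permM st permK.
  have /HP[A [b [gA sP]]] := sK.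
  have := sP _ (YT t); rewrite mkT => -> /[dup] tt.
  rewrite -{2}(mkT t) => /mk_eq; move=> /(_ (YJ gA (YT t)) (YT t)) Ll.
  have := crystal_translate gA (translationN Ll) => gA'.
  have [|[A1 _]|[A' gt]] := fixG (x := val t) gA'.
  - by rewrite addrA subKr.
  - move: gA sP; rewrite A1 => gA sP; apply: (Keq 1%:M b 0) => // x _.
    by rewrite perm1 mulmx1 addr0.
  exfalso; move/negP: tS; apply; have [s' s'H s'P] := gperm _ _ gt.
  apply/orbitP; exists s' => //=; rewrite /aperm s'P// mul0mx add0r.
  exact: mkT.
have cS : (#|S| * #|'C_K[t0 | 'P]%g| = #|K|)%N by rewrite card_orbit_stab.
have C1 : (1 < #|'C_K[t0 | 'P]%g|)%N.
  have [A A1 gA] := nontrivial.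
  have [s sH sP] := gperm _ _ gA.
  rewrite cardG_gt1; apply/trivgPn; exists s.
    rewrite inE sH; apply/astab1P => /=; rewrite /aperm sP// mul0mx addr0.
    by [].
  (* If a nontrivial [A] acted trivially, [y0 A - y0] would be a translation of length at most
     [2 |l0| / N]. As [N > 2] it vanishes, and [y0] is fixed by [A], which [crystal_fixed_free]
     forbids. *)
  apply/eqP => s1; have YA : Y (y0 *m A) by have := YJ gA Yy0; rewrite addr0.
  have := sP _ Yy0; rewrite s1 perm1 addr0 => /esym /(mk_eq _ _ YA Yy0).1 /l0min.
  have yA : enorm (y0 *m A - y0) < enorm l0.
    apply: le_lt_trans (enorm_sub _ _) _; rewrite (enorm_orthogonal _ (orthG gA)) y0n.
    have N2 : (2 : R) < N%:R by rewrite ltr_nat.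
    by rewrite -mulrDl ltr_pdivrMr; nra.
  move=> /(_ yA)/eqP; rewrite subr_eq0 => /eqP /(crystal_fixed_free A1 gA) y00.
  by move: l00; rewrite -y0N y00 mul0rn eqxx.
have S0 : (0 < #|S|)%N by apply/card_gt0P; exists t0; exact: orbit_refl.
have KdS : (#|K| %| #|S|)%N.
  have := cardsC S; rewrite -[RHS]cardsT => SC.
  by rewrite -(dvdn_addl _ KS) SC.
have := dvdn_leq S0 KdS; rewrite -cS leqNgt.
by rewrite ltn_Pmulr.
Qed.

End FiniteQuotient.

(* Here [G] is a crystallographic group whose nontrivial fixed points form the
   single orbit of [0]. *)
Theorem crystal_single_fixed_orbit : False.
Proof.
have [l0 [Ll0 l00 l0min]] := shortest_translation.
have [m m0 mG] := crystal_rational.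
have [s [us sG Gs]] := crystal_linear_parts cG.
pose N := (m * ((size s)`! * 3))%N.
apply: (@torsion_count N l0 _ _ Ll0 l00 l0min s sG).
- by rewrite /N mulnA leq_pmull// muln_gt0 m0 fact_gt0.
- by move=> A b gA; rewrite /N mulrnA; apply: translationMn; exact: mG gA.
- by rewrite /N mulnCA dvdn_mulr.
Qed.

End Counting.

(** * Developing a compact flat orbifold *)

Section RigidMotions.
Context {R : realType} {n : nat}.

Definition motion := ('M[R]_n * 'rV[R]_n)%type.
Implicit Types (g h : motion) (x y : 'rV[R]_n).

Definition move g x := x *m g.1 + g.2.
Definition rigid g := orthogonal g.1.
Definition mcomp g h : motion := (h.1 *m g.1, h.2 *m g.1 + g.2).
Definition minv g : motion := (g.1^T, - (g.2 *m g.1^T)).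
Definition mtrans (v : 'rV[R]_n) : motion := (1%:M, v).
Definition mrot (A : 'M[R]_n) : motion := (A, 0).

Lemma move_comp g h x : move (mcomp g h) x = move g (move h x).
Proof. by rewrite /move /= mulmxDl mulmxA addrA. Qed.

Lemma move_trans v x : move (mtrans v) x = x + v.
Proof. by rewrite /move mulmx1. Qed.

Lemma move_rot A x : move (mrot A) x = x *m A.
Proof. by rewrite /move addr0. Qed.

Lemma move0 g : move g 0 = g.2.
Proof. by rewrite /move mul0mx add0r. Qed.

Lemma moveK g : rigid g -> cancel (move g) (move (minv g)).
Proof.
move=> rg x; rewrite /move /= mulmxDl orthogonalK// addrK.
by [].
Qed.

Lemma moveKV g : rigid g -> cancel (move (minv g)) (move g).
Proof.
move=> rg x; rewrite /move /= mulmxDl mulNmx !orthogonalKV// subrK.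
by [].
Qed.

Lemma move_sub g x y : move g x - move g y = (x - y) *m g.1.
Proof. by rewrite /move opprD addrACA subrr addr0 mulmxBl. Qed.

Lemma enorm_move g x y : rigid g -> enorm (move g x - move g y) = enorm (x - y).
Proof. by move=> rg; rewrite move_sub enorm_orthogonal. Qed.

Lemma move_segment g x y t :
  move g (x + t *: (y - x)) = move g x + t *: (move g y - move g x).
Proof. by rewrite move_sub scalemxAl /move mulmxDl addrAC. Qed.

Lemma rigid_comp g h : rigid g -> rigid h -> rigid (mcomp g h).
Proof. by move=> rg rh; exact: orthogonalM. Qed.

Lemma rigid_inv g : rigid g -> rigid (minv g).
Proof. exact: orthogonalT. Qed.

Lemma rigid_trans v : rigid (mtrans v).
Proof. exact: orthogonal1. Qed.

Lemma near_move g x (P : set 'rV[R]_n) :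
  (\forall z \near move g x, P z) -> \forall z \near x, P (move g z).
Proof.
by move=> h; apply: (near_mulmx (P := fun y => P (y + g.2))); apply: near_addr.
Qed.

Lemma near_move_inv g x (P : set 'rV[R]_n) : rigid g ->
  (\forall z \near x, P (move g z)) -> \forall z \near move g x, P z.
Proof.
move=> rg h; have := @near_move (minv g) (move g x) (P \o move g).
rewrite moveK// => /(_ h); apply: filterS => z /=; by rewrite moveKV.
Qed.

Lemma near_near (x : 'rV[R]_n) (P : set 'rV[R]_n) :
  (\forall z \near x, P z) -> \forall z \near x, \forall w \near z, P w.
Proof. by move=> /nbhs_interior. Qed.

(* Connectedness of the segment, as an induction principle. *)
Lemma segment_ind (Q : set 'rV[R]_n) x y :
  (forall t, 0 <= t <= 1 -> Q (x + t *: (y - x)) ->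
     \forall z \near x + t *: (y - x), Q z) ->
  (forall t, 0 <= t <= 1 -> (forall P : set 'rV[R]_n, nbhs (x + t *: (y - x)) P ->
     exists2 z, P z & Q z) -> Q (x + t *: (y - x))) ->
  Q x -> Q y.
Proof.
move=> Qo Qc Qx.
pose S := [set t : R | `[0, 1]%classic t /\ Q (x + t *: (y - x))].
have cont (t : R) (P : set 'rV[R]_n) : nbhs (x + t *: (y - x)) P ->
    \forall u \near t, P (x + u *: (y - x)).
  move=> /near_enorm[r r0 h]; have d0 : 0 < enorm (y - x) + 1.
    by rewrite ltr_wpDl.
  apply/nbhs_normP; exists (r / (enorm (y - x) + 1)); first by rewrite /= divr_gt0.
  move=> u /=; rewrite ltr_pdivlMr// => tu; apply: h.
  rewrite opprD addrACA subrr add0r -scalerBl enormZ distrC.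
  by apply: le_lt_trans tu; rewrite ler_wpM2l// lerDl.
have SE : S = `[0, 1]%classic.
  apply: (@segment_connected R 0 1).
  - by exists 0; split; rewrite /= ?in_itv/= ?lexx ?ler01// scale0r addr0.
  - exists [set t | `[0, 1]%classic t -> Q (x + t *: (y - x))]^°.
      exact: open_interior.
    apply/seteqP; split=> [t [t01 Qt]|t [t01 /interior_subset h]]; last first.
      by split=> //; exact: h.
    split=> //; have t01' : 0 <= t <= 1 by move: t01; rewrite /= in_itv.
    by apply: filterS (cont t Q (Qo t t01' Qt)) => u Qu _.
  - exists (closure S); first exact: closed_closure.
    apply/seteqP; split=> [t St|t [t01 ct]].
      by split; [case: St|exact: subset_closure].
    split=> //; apply: Qc; first by move: t01; rewrite /= in_itv.
    move=> P /cont /ct [u [[_ Qu] Pu]]; by exists (x + u *: (y - x)).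
have : S 1 by rewrite SE /= in_itv/= ler01 lexx.
by move=> [_]; rewrite scale1r addrC subrK.
Qed.

End RigidMotions.
Arguments motion : clear implicits.

Definition eball {R : realType} {n : nat} (c : 'rV[R]_n) r : set 'rV[R]_n :=
  [set x | enorm (x - c) < r].

(** * Continuation of germs and the deck group *)

Section Development.
Context {R : realType} {n : nat}.
Variables (O : Type) (I : eqType).
Variables (c : I -> 'rV[R]_n) (r : I -> R) (psi : I -> 'rV[R]_n -> O).
Local Notation U i := (eball (c i) (r i)).
Local Notation origin := (0 : 'rV[R]_n).
Implicit Types (v w x y : 'rV[R]_n) (f : 'rV[R]_n -> O).

(* Charts of a compact flat orbifold with the single singular point [psi i0 0]. *)
Hypothesis psi_compat : forall i j (x y : 'rV[R]_n), U i x -> U j y -> psi i x = psi j y ->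
  exists g, [/\ rigid g, move g x = y & \forall z \near x, psi i z = psi j (move g z)].
Hypothesis psi_sep : forall i j (x y : 'rV[R]_n), U i x -> U j y -> psi i x <> psi j y ->
  exists P Q : set 'rV[R]_n, [/\ nbhs x P, nbhs y Q & forall z w, P z -> Q w -> psi i z <> psi j w].
(** Symmetries do not appear only away from [x]: one that is seen arbitrarily close to [x] is a
    symmetry near [x]. This is the closedness used in unique continuation, including at the tip. *)
Hypothesis psi_rigid : forall i (x : 'rV[R]_n) (g : motion R n), U i x -> rigid g -> move g x = x ->
  (forall P : set 'rV[R]_n, nbhs x P ->
     exists2 z, P z & \forall w \near z, psi i (move g w) = psi i w) ->
  \forall w \near x, psi i (move g w) = psi i w.
Variable i0 : I.
Hypothesis c0 : c i0 = 0.
Hypothesis psi_regular : forall i (x : 'rV[R]_n) (g : motion R n),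
  U i x -> psi i x <> psi i0 0 -> rigid g -> move g x = x ->
  (\forall w \near x, psi i (move g w) = psi i w) -> g.1 = 1%:M.
Hypothesis psi_tip : forall x : 'rV[R]_n, U i0 x -> psi i0 x = psi i0 0 -> x = 0.
Variable stab : seq 'M[R]_n.
Hypothesis psi_stab : forall A : 'M[R]_n, orthogonal A ->
  (\forall z \near origin, psi i0 (z *m A) = psi i0 z) -> A \in stab.
Hypothesis psi_nontrivial : exists2 A : 'M[R]_n, A != 1%:M &
  orthogonal A /\ \forall z \near origin, psi i0 (z *m A) = psi i0 z.
(** Half balls cover while charts live on full balls, so around any point some chart contains a
    whole ball of radius [rho]. *)
Variables (cover : seq I) (rho : R).
Hypothesis rho0 : 0 < rho.
Hypothesis rho_r : forall i, i \in i0 :: cover -> rho <= r i / 2.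
Hypothesis psi_cover : forall o, exists i (x : 'rV[R]_n),
  [/\ i \in cover, enorm (x - c i) < r i / 2 & psi i x = o].

Lemma ball_sub i (x y : 'rV[R]_n) : i \in i0 :: cover -> enorm (x - c i) < r i / 2 ->
  enorm (y - x) < rho -> U i y.
Proof.
by move=> /rho_r rr xi yx; have := enorm_triangle y x (c i); rewrite /eball/=; lra.
Qed.

(** Unique continuation along a segment. At a limit point [z] the values agree by separation; a
    transition motion then yields a motion [k] fixing [move h z] that is a symmetry arbitrarily
    close by, and [psi_rigid] concludes. *)
Lemma psi_unique i g j h x y : rigid g -> rigid h ->
  (forall t, 0 <= t <= 1 -> U i (move g (x + t *: (y - x)))) ->
  (forall t, 0 <= t <= 1 -> U j (move h (x + t *: (y - x)))) ->
  (\forall z \near x, psi i (move g z) = psi j (move h z)) ->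
  \forall z \near y, psi i (move g z) = psi j (move h z).
Proof.
move=> rg rh Ug Uh.
apply: (@segment_ind R n (fun x => \forall z \near x, psi i (move g z) = psi j (move h z))).
  by move=> t t01; exact: near_near.
move=> t t01; have {Ug Uh} := (Ug t t01, Uh t t01).
move: (x + _) => z [Uz Uz'] freq.
have fz : psi i (move g z) = psi j (move h z).
  apply: contrapT => /(psi_sep Uz Uz')[P [Q [Pz Qz PQ]]].
  have [w [Pw Qw] /nbhs_singleton] := freq _ (filterI (near_move Pz) (near_move Qz)).
  exact: PQ.
have [s [rs sz near_s]] := psi_compat Uz Uz' fz.
pose k := mcomp s (mcomp g (minv h)).
have rk : rigid k by exact: rigid_comp rs (rigid_comp rg (rigid_inv rh)).
have kE w : move k (move h w) = move s (move g w) by rewrite !move_comp moveK.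
have near_k : \forall w \near move h z, psi j (move k w) = psi j w.
  apply: psi_rigid => //; first by rewrite kE.
  move=> P Pz.
  have := freq _ (filterI (near_move Pz) (near_near (near_move near_s))).
  move=> [w [Pw near_w] Qw]; exists (move h w) => //.
  apply: near_move_inv => //; apply: filterS2 near_w Qw => v h1 h2.
  by rewrite kE -h1.
apply: filterS2 (near_move near_s) (near_move near_k) => w -> <-.
by rewrite kE.
Qed.

Definition germ (f : 'rV[R]_n -> O) i g := [/\ rigid g,
  forall z, enorm z < rho -> U i (move g z) & forall z, enorm z < rho -> f z = psi i (move g z)].

(** The constant value outside the ball makes a development determined by its germ at 0, so that
    [dev_ext] is an equality of functions. *)
Definition isdev (f : 'rV[R]_n -> O) :=
  (exists i g, germ f i g) /\ forall z, ~~ (enorm z < rho) -> f z = psi i0 0.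

Lemma near0_rho : \forall z \near (0 : 'rV[R]_n), enorm z < rho.
Proof. by apply: near_enorm_lt; rewrite enorm0. Qed.

Lemma enorm_segment (x y : 'rV[R]_n) (t e : R) : enorm x < e -> enorm y < e -> 0 <= t <= 1 ->
  enorm (x + t *: (y - x)) < e.
Proof.
move=> xe ye /andP[t0 t1]; rewrite (_ : _ + _ = (1 - t) *: x + t *: y); last first.
  by rewrite scalerBr scalerBl scale1r addrA addrAC.
apply: le_lt_trans (enormD _ _) _; rewrite !enormZ !ger0_norm ?subr_ge0//.
by have [xy|/ltW yx] := leP (enorm x) (enorm y); nra.
Qed.

Lemma germ_near f i g v j h : germ f i g -> enorm v < rho -> rigid h ->
  (forall t, 0 <= t <= 1 -> U j (move h (t *: v))) ->
  (\forall z \near origin, f z = psi j (move h z)) ->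
  \forall z \near v, f z = psi j (move h z).
Proof.
move=> [rg Ug fg] vr rh Uh f0.
have : \forall z \near v, psi i (move g z) = psi j (move h z).
  apply: (@psi_unique _ _ _ _ 0) => //.
  - by move=> t t01; apply: Ug; apply: enorm_segment => //; rewrite enorm0.
  - by move=> t t01; rewrite subr0 add0r; exact: Uh.
  - by apply: filterS2 near0_rho f0 => z /fg ->.
by apply: filterS2 (near_enorm_lt vr) => z /fg ->.
Qed.

Lemma dev_ext f f' : isdev f -> isdev f' -> (\forall z \near origin, f z = f' z) -> f = f'.
Proof.
move=> [[i [g fg]] fo] [[j [h fh]] f'o] ff'; apply/funext => z.
have [zr|zr] := boolP (enorm z < rho); last by rewrite fo// f'o.
have [rh Uh fh'] := fh; rewrite fh'//.
suff /nbhs_singleton : \forall w \near z, f w = psi j (move h w) by [].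
apply: (germ_near fg) => // [t /andP[t0 t1]|].
  by apply: Uh; rewrite enormZ ger0_norm//; have := enorm_ge0 z; nra.
by apply: filterS2 ff' near0_rho => w -> /fh'.
Qed.

(** The development whose germ at 0 is the germ of [f] at [v]; the default [f] is never reached when
    [enorm v < rho], by [tauP]. *)
Definition tau v f : 'rV[R]_n -> O :=
  if pselect (exists f', isdev f' /\ \forall z \near origin, f' z = f (z + v)) is left e
  then sval (cid e) else f.

Lemma germ_chart f i g j y : germ f i g -> U j y -> f 0 = psi j y ->
  exists h, [/\ rigid h, move h 0 = y & \forall z \near origin, f z = psi j (move h z)].
Proof.
move=> [rg Ug fg] Uy f0; have r0 : enorm (0 : 'rV[R]_n) < rho by rewrite enorm0.
have [|s [rs sy near_s]] := psi_compat (Ug _ r0) Uy; first by rewrite -fg.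
exists (mcomp s g); split; [exact: rigid_comp|by rewrite move_comp|].
by apply: filterS2 (near_move near_s) near0_rho => z + /fg ->; rewrite move_comp.
Qed.

Lemma tauP f v : isdev f -> enorm v < rho ->
  isdev (tau v f) /\ \forall z \near origin, tau v f z = f (z + v).
Proof.
move=> [[i [g [rg Ug fg]]] fo] vr; rewrite /tau; case: pselect => [e|]; first by case: cid.
case; have [j [y [jc yj fy]]] := psi_cover (f v).
have jc' : j \in i0 :: cover by rewrite inE jc orbT.
have Uy : U j y.
  by apply: ball_sub yj _ => //; rewrite subrr enorm0.
have [|s [rs sy near_s]] := psi_compat (Ug _ vr) Uy; first by rewrite -fg.
pose k := mcomp s (mcomp g (mtrans v)).
have rk : rigid k by exact: rigid_comp rs (rigid_comp rg (rigid_trans v)).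
have kE z : move k z = move s (move g (z + v)) by rewrite !move_comp move_trans.
(* The chart [j] contains the [rho] ball about the image of [v], so the germ of [f] at [v] extends
   to a full development. *)
exists (fun z => if enorm z < rho then psi j (move k z) else psi i0 0); split.
  split; last by move=> z /negbTE ->.
  exists j, k; split=> // [z zr|z -> //].
  apply: ball_sub yj _ => //; have <- : move k 0 = y by rewrite kE add0r.
  by rewrite enorm_move// subr0.
have near_g : \forall z \near origin, psi i (move g (z + v)) = psi j (move s (move g (z + v))).
  exact: near_shift (near_move near_s).
have near_v : \forall z \near origin, enorm (z + v) < rho.
  exact: near_shift (near_enorm_lt vr).
near=> z; rewrite ifT ?kE; last by near: z; exact: near0_rho.
rewrite fg; last by near: z.
by apply: esym; near: z.
Unshelve. all: by end_near. Qed.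

Lemma tau_unique f f' v : isdev f -> enorm v < rho -> isdev f' ->
  (\forall z \near origin, f' z = f (z + v)) -> f' = tau v f.
Proof.
move=> df vr df' h; have [dt ht] := tauP df vr.
by apply: dev_ext => //; apply: filterS2 h ht => z -> ->.
Qed.

Lemma tau_dev f v : isdev f -> enorm v < rho -> isdev (tau v f).
Proof. by move=> df vr; case: (tauP df vr). Qed.

Lemma tau0 f : isdev f -> tau 0 f = f.
Proof.
move=> df; apply/esym; apply: tau_unique; rewrite ?enorm0//.
by near=> z; rewrite addr0.
Unshelve. all: by end_near. Qed.

(** [f] is defined on the whole segment from [v] to [v + w], which identifies the second
    continuation with a germ of [f]. *)
Lemma tauD f v w : isdev f -> enorm v < rho -> enorm w < rho -> enorm (v + w) < rho ->
  tau w (tau v f) = tau (v + w) f.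
Proof.
move=> df vr wr vwr; have [dt ht] := tauP df vr; have [dtt htt] := tauP dt wr.
apply: tau_unique => //; have [[i [g [rg Ug fg]]] _] := df.
have [[j [h hg]] _] := dt.
suff : \forall z \near w, tau v f z = psi i (move (mcomp g (mtrans v)) z).
  move=> near_w; have near_w' : \forall z \near origin,
      tau v f (z + w) = psi i (move (mcomp g (mtrans v)) (z + w)).
    exact: near_shift near_w.
  have near_vw : \forall z \near origin, enorm (z + (v + w)) < rho.
    exact: near_shift (near_enorm_lt vwr).
  apply: filterS3 htt near_w' near_vw => z -> -> zr.
  by rewrite fg// move_comp move_trans addrAC addrA.
apply: (germ_near hg) => //; first exact: rigid_comp rg (rigid_trans v).
  move=> t t01; rewrite move_comp move_trans; apply: Ug.
  have := @enorm_segment v (v + w) t rho vr vwr t01.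
  by rewrite [v + w]addrC addrK addrC.
have near_v : \forall z \near origin, enorm (z + v) < rho.
  exact: near_shift (near_enorm_lt vr).
by apply: filterS2 ht near_v => z -> /fg ->; rewrite move_comp move_trans.
Qed.

Definition rotf (A : 'M[R]_n) (f : 'rV[R]_n -> O) z := f (z *m A).

Lemma rotfM A B f : rotf A (rotf B f) = rotf (A *m B) f.
Proof. by apply/funext => z; rewrite /rotf mulmxA. Qed.

Lemma rotf1 f : rotf 1%:M f = f.
Proof. by apply/funext => z; rewrite /rotf mulmx1. Qed.

Lemma rotf_dev A f : orthogonal A -> isdev f -> isdev (rotf A f).
Proof.
move=> oA [[i [g [rg Ug fg]]] fo]; split.
  exists i, (mcomp g (mrot A)); split=> [|z zr|z zr]; first exact: rigid_comp.
    by rewrite move_comp move_rot; apply: Ug; rewrite enorm_orthogonal.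
  by rewrite move_comp move_rot /rotf fg// enorm_orthogonal.
by move=> z zr; rewrite /rotf fo// enorm_orthogonal.
Qed.

Lemma tau_rotf A f v : orthogonal A -> isdev f -> enorm v < rho ->
  tau v (rotf A f) = rotf A (tau (v *m A) f).
Proof.
move=> oA df vr; have vr' : enorm (v *m A) < rho by rewrite enorm_orthogonal.
have [dt ht] := tauP df vr'.
apply/esym; apply: tau_unique => //; [exact: rotf_dev|exact: rotf_dev|].
have : \forall z \near origin, tau (v *m A) f (z *m A) = f (z *m A + v *m A).
  by apply: (near_mulmx (P := fun y => tau (v *m A) f y = f (y + v *m A))); rewrite mul0mx.
by apply: filterS => z h; rewrite /rotf h mulmxDl.
Qed.

Definition devn N v := iter N (tau (N%:R^-1 *: v)).

Lemma iter_tau_dev f v k : isdev f -> enorm v < rho -> isdev (iter k (tau v) f).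
Proof. by move=> df vr; elim: k => //= k IH; exact: tau_dev. Qed.

Lemma enorm_divn v N : enorm (N%:R^-1 *: v) = enorm v / N%:R.
Proof. by rewrite enormZ ger0_norm ?invr_ge0// mulrC. Qed.

Lemma devn_valid v N : enorm v < rho * N%:R -> enorm (N%:R^-1 *: v) < rho.
Proof.
case: N => [|N] vN; last by rewrite enorm_divn ltr_pdivrMr ?ltr0n.
by move: vN; rewrite mulr0 ltNge enorm_ge0.
Qed.

Lemma iter_tau f u M : isdev f -> enorm u < rho -> (0 < M)%N ->
  iter M (tau (M%:R^-1 *: u)) f = tau u f.
Proof.
move=> df ur M0; set w : 'rV[R]_n := M%:R^-1 *: u.
have wk k : (k <= M)%N -> enorm (k%:R *: w) < rho.
  move=> kM; rewrite /w scalerA enormZ ger0_norm ?mulr_ge0 ?invr_ge0//.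
  apply: le_lt_trans ur; rewrite ler_piMl//.
  by rewrite ler_pdivrMr ?ltr0n// mul1r ler_nat.
have main k : (k <= M)%N -> iter k (tau w) f = tau (k%:R *: w) f.
  elim: k => [_|k IH kM]; first by rewrite scale0r tau0.
  have w1 : enorm w < rho by have := wk _ M0; rewrite scale1r.
  have kw : k%:R *: w + w = k.+1%:R *: w by rewrite -natr1 scalerDl scale1r.
  have kwr : enorm (k%:R *: w + w) < rho by rewrite kw; exact: wk.
  by rewrite iterS IH ?(ltnW kM)// (tauD df (wk _ (ltnW kM)) w1 kwr) kw.
by rewrite main// /w scalerA divff ?scale1r// pnatr_eq0 -lt0n.
Qed.

(** Refining the subdivision changes nothing; two subdivisions are then compared through a common
    refinement. *)
Lemma devn_mul f v N M : isdev f -> enorm v < rho * N%:R -> (0 < M)%N ->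
  devn (N * M) v f = devn N v f.
Proof.
move=> df vN M0; have vr := devn_valid vN; rewrite /devn iterM natrM invfM mulrC -scalerA.
elim: {1 3}N => //= k ->; apply: iter_tau => //; exact: iter_tau_dev.
Qed.

(** The number of steps makes each of them shorter than [rho]. *)
Definition dev v f := devn (Num.truncn (enorm v / rho)).+1 v f.

Lemma truncn_rho a : a < rho * (Num.truncn (a / rho)).+1%:R.
Proof. by rewrite mulrC -ltr_pdivrMr// truncnS_gt. Qed.

Lemma dev_devn f v N : isdev f -> enorm v < rho * N%:R -> dev v f = devn N v f.
Proof.
move=> df vN; have N0 : (0 < N)%N.
  by case: N vN => //; rewrite mulr0 ltNge enorm_ge0.
rewrite /dev -(@devn_mul _ _ _ N)//; last exact: truncn_rho.
by rewrite mulnC devn_mul.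
Qed.

Lemma dev_isdev f v : isdev f -> isdev (dev v f).
Proof. by move=> df; apply: iter_tau_dev => //; apply: devn_valid; exact: truncn_rho. Qed.

Lemma dev_small f v : isdev f -> enorm v < rho -> dev v f = tau v f.
Proof.
by move=> df vr; rewrite (@dev_devn _ _ 1)// ?mulr1// /devn /= invr1 scale1r.
Qed.

(** Path independence. With a common number of steps, the small continuations along [v] and [w]
    commute because both orders equal [tau] of the sum. *)
Lemma devD f v w : isdev f -> dev (v + w) f = dev w (dev v f).
Proof.
move=> df; set N := (Num.truncn ((enorm v + enorm w) / rho)).+1.
have vwN : enorm v + enorm w < rho * N%:R by exact: truncn_rho.
have vN : enorm v < rho * N%:R by have := enorm_ge0 w; lra.
have wN : enorm w < rho * N%:R by have := enorm_ge0 v; lra.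
have sN : enorm (v + w) < rho * N%:R by have := enormD v w; lra.
rewrite (dev_devn df sN) (dev_devn (dev_isdev v df) wN) (dev_devn df vN).
clearbody N; rewrite /devn scalerDr.
have v'r := devn_valid vN; have w'r := devn_valid wN.
have s'r := devn_valid sN; rewrite scalerDr in s'r.
move: (N%:R^-1 *: v) (N%:R^-1 *: w) v'r w'r s'r => v' w' v'r w'r s'r.
have comm k g : isdev g -> tau v' (iter k (tau w') g) = iter k (tau w') (tau v' g).
  move=> dg; elim: k => //= k IH; have dk := iter_tau_dev k dg w'r.
  by rewrite -IH !tauD// addrC.
elim: {vwN vN wN sN} N => //= k ->; have dk := iter_tau_dev k df v'r.
by rewrite -tauD ?comm//; exact: iter_tau_dev.
Qed.

Lemma dev0 f : isdev f -> dev 0 f = f.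
Proof. by move=> df; rewrite dev_small ?enorm0// tau0. Qed.

Lemma dev_rotf A f v : orthogonal A -> isdev f ->
  dev v (rotf A f) = rotf A (dev (v *m A) f).
Proof.
move=> oA df; rewrite /dev enorm_orthogonal// /devn.
set N := (Num.truncn _).+1.
have vr : enorm (N%:R^-1 *: v) < rho by apply: devn_valid; exact: truncn_rho.
have vr' : enorm (N%:R^-1 *: (v *m A)) < rho.
  by rewrite scalemxAl enorm_orthogonal.
elim: {1 3}N => //= k ->; rewrite tau_rotf//; last exact: iter_tau_dev.
by rewrite scalemxAl.
Qed.

(** As long as the segment stays in one chart, continuation is given by that chart, even over
    distances larger than [rho]. *)
Lemma dev_chart f i g w : isdev f -> rigid g ->
  (forall t, 0 <= t <= 1 -> U i (move g (t *: w))) ->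
  (\forall z \near origin, f z = psi i (move g z)) ->
  \forall z \near origin, dev w f z = psi i (move g (z + w)).
Proof.
move=> df rg Ug f0; rewrite /dev /devn; set N := (Num.truncn _).+1.
have ur : enorm (N%:R^-1 *: w) < rho by apply: devn_valid; exact: truncn_rho.
set u : 'rV[R]_n := N%:R^-1 *: w in ur *.
have uN : N%:R *: u = w by rewrite scalerA divff ?scale1r// pnatr_eq0.
suff main k : (k <= N)%N ->
    \forall z \near origin, iter k (tau u) f z = psi i (move g (z + k%:R *: u)).
  by have := main N (leqnn N); rewrite uN.
elim: k => [_|k IH kN].
  by apply: filterS f0 => z /= ->; rewrite scale0r addr0.
have dk := iter_tau_dev k df ur; have [_ ht] := tauP dk ur.
have [[j [h hg]] _] := dk.
have kw : k%:R *: u + u = k.+1%:R *: u by rewrite -natr1 scalerDl scale1r.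
pose gk := mcomp g (mtrans (k%:R *: u)).
have gkE z : move gk z = move g (z + k%:R *: u) by rewrite move_comp move_trans.
have rgk : rigid gk by exact: rigid_comp rg (rigid_trans _).
have near_u : \forall z \near u, iter k (tau u) f z = psi i (move gk z).
  apply: (germ_near hg) => //.
    move=> t /andP[t0 t1]; rewrite gkE -scalerDl /u scalerA; apply: Ug.
    rewrite mulr_ge0 ?addr_ge0 ?invr_ge0//= ler_pdivrMr ?ltr0n// mul1r.
    have : (k.+1%:R : R) <= N%:R by rewrite ler_nat.
    by rewrite -natr1; lra.
  by apply: filterS (IH (ltnW kN)) => z; rewrite gkE.
by apply: filterS2 ht (near_shift near_u) => z /= -> ->; rewrite gkE -kw addrAC addrA.
Qed.

Definition dev_base z := if enorm z < rho then psi i0 z else psi i0 0.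

Lemma ball_tip z : enorm z < rho -> U i0 z.
Proof.
move=> zr; have r0 : rho <= r i0 / 2 by apply: rho_r; rewrite mem_head.
by have := rho0; rewrite /eball /= c0 subr0; lra.
Qed.

Lemma dev_base_dev : isdev dev_base.
Proof.
split; last by move=> z /negbTE zr; rewrite /dev_base zr.
exists i0, (mtrans 0); split=> [|z zr|z zr]; first exact: rigid_trans.
  by rewrite move_trans addr0; exact: ball_tip.
by rewrite /dev_base zr move_trans addr0.
Qed.

(** Near 0, [rotf A (dev b dev_base)] is the base germ continued to [z *m A + b]: the motion
    [(A, b)] preserves the developing map. *)
Definition deck (A : 'M[R]_n) b := orthogonal A /\ rotf A (dev b dev_base) = dev_base.

Let db := dev_base_dev.

Lemma deckM A b A' b' : deck A b -> deck A' b' -> deck (A' *m A) (b' *m A + b).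
Proof.
move=> [oA hA] [oA' hA']; split; first exact: orthogonalM.
by rewrite addrC devD// -rotfM -dev_rotf ?hA//; exact: dev_isdev.
Qed.

Lemma deckV A b : deck A b -> deck A^T (- (b *m A^T)).
Proof.
move=> [oA hA]; split; first exact: orthogonalT.
have dF := dev_isdev b db.
have FE : dev b dev_base = rotf A^T dev_base.
  by rewrite -[in RHS]hA rotfM orthogonalV// rotf1.
rewrite -mulNmx -dev_rotf; [|exact: orthogonalT|exact: db].
by rewrite -FE -devD// subrr dev0.
Qed.

(** The point [b] lies over the tip, and within the base chart only 0 does. *)
Lemma deck_stab A b : deck A b -> enorm b < rho -> b = 0 /\ A \in stab.
Proof.
move=> [oA hA] br; rewrite dev_small// in hA; have [dt ht] := tauP db br.
have near_A : \forall z \near origin, dev_base z = dev_base (z *m A + b).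
  have : \forall z \near origin, tau b dev_base (z *m A) = dev_base (z *m A + b).
    by apply: (near_mulmx (P := fun y => tau b dev_base y = dev_base (y + b))); rewrite mul0mx.
  by apply: filterS => z <-; rewrite -[in LHS]hA.
have b0 : b = 0.
  have /nbhs_singleton := near_A; rewrite mul0mx add0r /dev_base enorm0 rho0 br.
  by move=> /esym; apply: psi_tip; exact: ball_tip.
split=> //; apply: psi_stab => //; rewrite b0 in near_A.
apply: filterS2 near_A near0_rho => z; rewrite addr0 /dev_base enorm_orthogonal// => + zr.
by rewrite zr.
Qed.

(** Fix one point [y0 i] developing into the half ball of each chart. Any [x] develops into some
    half ball, where it can be reached from [y0 i] by a vector [w] shorter than [r i]. The two germs
    then agree up to a rotation, and this gives a deck motion. *)
Lemma deck_cocompact : exists C : R, forall x, exists A b, deck A b /\ enorm (x - b) <= C.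
Proof.
pose meets i y := exists a, enorm (a - c i) < r i / 2 /\ psi i a = dev y dev_base 0.
have /choice[y0 y0P] : forall i, exists y, (exists y', meets i y') -> meets i y.
  by move=> i; have [[y' my]|] := pselect (exists y', meets i y'); [exists y'|exists 0].
exists (\sum_(i <- cover) (enorm (y0 i) + `|r i|)) => x.
have dx := dev_isdev x db.
have [i [a' [ic a'i a'x]]] := psi_cover (dev x dev_base 0).
have [|a [ai ay]] := y0P i; first by exists x, a'.
set y := y0 i in ay *; have dy := dev_isdev y db.
have half b : enorm (b - c i) < r i / 2 -> U i b.
  by rewrite /eball /=; have := enorm_ge0 (b - c i); lra.
have [[j [g jg]] _] := dy; have [[j' [g' jg']] _] := dx.
have [h [rh h0 near_h]] := germ_chart jg (half _ ai) (esym ay).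
have [h' [rh' h'0 near_h']] := germ_chart jg' (half _ a'i) (esym a'x).
(* In the chart, [h] sends 0 to [a] and [w] to [a']; the segment between them stays in the half ball
   by convexity. *)
pose w : 'rV[R]_n := move (minv h) a'.
have hw : move h w = a' by rewrite moveKV.
have wn : enorm w < r i.
  rewrite -[w]subr0 -(enorm_move _ _ rh) hw h0.
  by have := enorm_triangle a' (c i) a; rewrite (enormB (c i)); lra.
clearbody w; have near_w : \forall z \near origin, dev w (dev y dev_base) z = psi i (move h (z + w)).
  apply: dev_chart => // t t01.
  have := move_segment h 0 w t; rewrite subr0 add0r h0 hw => ->.
  apply: half; have := enorm_segment ai a'i t01; congr (enorm _ < _).
  by rewrite opprB addrA subrK addrAC.
pose B := h'.1 *m h.1^T; have oB : orthogonal B.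
  exact: orthogonalM rh' (orthogonalT rh).
pose q : 'rV[R]_n := y + w.
have xq : dev x dev_base = rotf B (dev q dev_base).
  apply: dev_ext => //; first exact/rotf_dev/dev_isdev.
  have near_B : \forall z \near origin,
      dev w (dev y dev_base) (z *m B) = psi i (move h (z *m B + w)).
    by apply: (near_mulmx (P := fun u => dev w (dev y dev_base) u = psi i (move h (u + w))));
      rewrite mul0mx.
  apply: filterS2 near_h' near_B => z ->; rewrite /rotf devD// => ->.
  congr (psi i _); rewrite -(subrK (move h w) (move h (z *m B + w))) move_sub addrK hw.
  by rewrite /B mulmxA orthogonalKV// -h'0 move0.
exists B^T, (x - q *m B^T); split; last first.
  rewrite opprB addrC subrK enorm_orthogonal; last exact: orthogonalT.
  apply: le_trans (enormD _ _) _; rewrite (big_rem i)//=.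
  have : 0 <= \sum_(i1 <- rem i cover) (enorm (y0 i1) + `|r i1|).
    by apply: sumr_ge0 => k _; rewrite addr_ge0.
  by have := ler_norm (r i); rewrite -/y; lra.
split; first exact: orthogonalT.
rewrite devD// xq -mulNmx -dev_rotf; [|exact: orthogonalT|exact/rotf_dev/dev_isdev].
by rewrite rotfM orthogonalV// rotf1 -devD// subrr dev0.
Qed.

Lemma deck_crystal : crystal deck.
Proof.
split.
- by move=> A b [].
- by split; [exact: orthogonal1|rewrite rotf1 dev0].
- exact: deckM.
- exact: deckV.
- by exists rho, stab; split=> // A b; exact: deck_stab.
- exact: deck_cocompact.
Qed.

Lemma deck_linear A : orthogonal A ->
  (\forall z \near origin, psi i0 (z *m A) = psi i0 z) -> deck A 0.
Proof.
move=> oA hA; split=> //; rewrite dev0//; apply: dev_ext => //; first exact: rotf_dev.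
apply: filterS2 hA near0_rho => z hz zr.
by rewrite /rotf /dev_base enorm_orthogonal// zr.
Qed.

(** The germ at [x] is invariant under [A]. Away from the tip the local group is trivial; at the tip
    the germ is a rotated [dev_base], which exhibits [x] as a point of the orbit of 0. *)
Lemma deck_fixed A b x : deck A b -> x *m A + b = x ->
  (A = 1%:M /\ b = 0) \/ exists A', deck A' x.
Proof.
move=> [oA hA] xAb; set F := dev x dev_base; have dF : isdev F by exact: dev_isdev.
have FA : rotf A F = F.
  rewrite /F -[in RHS]hA dev_rotf//; last exact: dev_isdev.
  by rewrite -devD// addrC xAb.
have [[i [g gF]] _] := dF; have [rg Ug Fg] := gF.
have r00 : enorm origin < rho by rewrite enorm0.
have Ug0 := Ug _ r00.
have [tip|ntip] := pselect (psi i (move g 0) = psi i0 0); last first.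
  (* [A] conjugated into the chart, where [psi_regular] applies. *)
  left; pose k := mcomp g (mcomp (mrot A) (minv g)).
  have rk : rigid k by exact: rigid_comp rg (@rigid_comp _ _ (mrot A) _ oA (rigid_inv rg)).
  have kE z : move k (move g z) = move g (z *m A).
    by rewrite !move_comp moveK// move_rot.
  have kA : k.1 = 1%:M.
    apply: (psi_regular Ug0 ntip rk); first by rewrite kE mul0mx.
    apply: near_move_inv => //; apply: filterS near0_rho => z zr.
    by rewrite kE -Fg ?enorm_orthogonal// -Fg// -[in RHS]FA.
  have A1 : A = 1%:M.
    have gg : g.1 *m g.1^T = 1%:M by exact: rg.
    have kA' : g.1^T *m A *m g.1 = 1%:M by exact: kA.
    have : g.1 *m (g.1^T *m A *m g.1) *m g.1^T = 1%:M by rewrite kA' mulmx1 gg.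
    by rewrite !mulmxA gg mul1mx -mulmxA gg mulmx1.
  split=> //; move: xAb; rewrite A1 mulmx1 => /eqP.
  by rewrite addrC -subr_eq0 addrK => /eqP.
right; have [|h [rh h0 near_h]] := germ_chart gF (ball_tip r00); first by rewrite Fg.
have h2 : h.2 = 0 by rewrite -move0.
have FE : F = rotf h.1 dev_base.
  apply: dev_ext => //; first exact: rotf_dev.
  apply: filterS2 near_h near0_rho => z -> zr.
  by rewrite /rotf /dev_base enorm_orthogonal// zr /move h2 addr0.
exists h.1^T; split; first exact: orthogonalT.
by rewrite -/F FE rotfM orthogonalV// rotf1.
Qed.

Theorem no_single_cone_orbifold : False.
Proof.
have [A A1 [oA hA]] := psi_nontrivial.
apply: (@crystal_single_fixed_orbit R n deck deck_crystal).
  by exists A => //; exact: deck_linear.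
exact: deck_fixed.
Qed.

End Development.

(** * Local isometries of Euclidean space *)

Section Calculus.
Context {R : realType}.
Implicit Types m n p : nat.

Lemma enorm_le_norm_eps n (a : 'rV[R]_n) m (u : 'rV[R]_m) e : 0 < e ->
  `|a| <= e / n.+1%:R * `|u| -> enorm a <= e * enorm u.
Proof.
move=> e0 h; apply: le_trans (enorm_le_norm _) _.
have n1 : (n%:R : R) <= n.+1%:R by rewrite ler_nat.
apply: le_trans (_ : n.+1%:R * (e / n.+1%:R * `|u|) <= _).
  apply: le_trans (ler_wpM2r (normr_ge0 _) n1) _.
  by rewrite ler_wpM2l.
rewrite mulrA mulrCA divff ?mulr1 ?pnatr_eq0//.
by rewrite ler_wpM2l ?norm_le_enorm// ltW.
Qed.

Lemma diff_enorm m n (f : 'rV[R]_m -> 'rV[R]_n) (x : 'rV[R]_m) (e : R) : differentiable f x -> 0 < e ->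
  \forall y \near x, enorm (f y - f x - (y - x) *m 'J f x) <= e * enorm (y - x).
Proof.
move=> df e0; have := diff_locally df => /eqaddoP.
have en : 0 < e / n.+1%:R by rewrite divr_gt0.
move=> /(_ _ en) h.
have : \forall y \near x, (fun h : 'rV[R]_m =>
    enorm (f (h + x) - f x - 'd f x h) <= e * enorm h) (y - x).
  apply: (near_addr (P := fun h => enorm (f (h + x) - f x - 'd f x h) <= e * enorm h)).
  rewrite subrr; apply: filterS h => z h; apply: enorm_le_norm_eps => //.
  by apply: le_trans h; rewrite /= opprD addrA.
by apply: filterS => y; rewrite subrK /jacobian mul_rV_lin1.
Qed.

Lemma enorm_diff m n (f : 'rV[R]_m -> 'rV[R]_n) (x : 'rV[R]_m) (J : 'M[R]_(m, n)) :
  (forall e : R, 0 < e -> \forall y \near x, enorm (f y - f x - (y - x) *m J) <= e * enorm (y - x)) ->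
  differentiable f x /\ 'J f x = J.
Proof.
move=> h; pose L : {linear 'rV[R]_m -> 'rV[R]_n} := mulmxr J.
have cL : continuous L.
  by move=> y P; exact: near_mulmx.
have fL : f \o shift x = cst (f x) + L +o_ (0 : 'rV[R]_m) id.
  apply/eqaddoP => e e0; have em : 0 < e / m.+1%:R by rewrite divr_gt0.
  have : \forall z \near (0 : 'rV[R]_m),
      (fun y => enorm (f y - f x - (y - x) *m J) <= e / m.+1%:R * enorm (y - x)) (z + x).
    exact: near_shift (h _ em).
  apply: filterS => z /=; rewrite addrK => hz.
  rewrite /= opprD addrA; apply: le_trans (norm_le_enorm _) (le_trans hz _).
  rewrite -mulrA ler_wpM2l ?(ltW e0)// ler_pdivrMl//.
  apply: le_trans (enorm_le_norm _) _; rewrite ler_wpM2r// ler_nat.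
  exact: leqnSn.
have dL := diff_unique cL fL.
split; last by rewrite /jacobian dL; apply: mx_ext => y; rewrite mul_rV_lin1.
by apply/diff_locallyP; rewrite dL.
Qed.

Lemma jacobian_comp m n p (f : 'rV[R]_m -> 'rV[R]_n) (g : 'rV[R]_n -> 'rV[R]_p) x :
  differentiable f x -> differentiable g (f x) ->
  'J (g \o f) x = 'J f x *m 'J g (f x).
Proof.
move=> df dg; apply: mx_ext => v.
by rewrite mulmxA /jacobian !mul_rV_lin1 diff_comp.
Qed.

Lemma differentiable_near_eq m n (f g : 'rV[R]_m -> 'rV[R]_n) x :
  (\forall y \near x, f y = g y) -> differentiable f x ->
  differentiable g x /\ 'J g x = 'J f x.
Proof.
move=> fg df; apply: enorm_diff => e e0.
have fgx := nbhs_singleton fg.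
by apply: filterS2 fg (diff_enorm df e0) => y <-; rewrite -fgx.
Qed.

(** Continuity of [Q] suffices: the expansion of [P] at [Q w], multiplied by [K], is solved for
    [Q w - x]. *)
Lemma inverse_diff m n (P : 'rV[R]_m -> 'rV[R]_n) (Q : 'rV[R]_n -> 'rV[R]_m) (x : 'rV[R]_m)
    (K : 'M[R]_(n, m)) :
  differentiable P x -> 'J P x *m K = 1%:M -> K *m 'J P x = 1%:M ->
  Q (P x) = x -> (\forall w \near P x, P (Q w) = w) -> {for P x, continuous Q} ->
  differentiable Q (P x) /\ 'J Q (P x) = K.
Proof.
move=> dP JK KJ QP PQ cQ; apply: enorm_diff => e e0; rewrite QP.
set J := 'J P x in JK KJ *; set c := frobenius K + 1.
have c0 : 0 < c by rewrite ltr_wpDl ?frobenius_ge0.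
have Kc w : enorm (w *m K) <= c * enorm w.
  apply: le_trans (enorm_mulmx _ _) _; rewrite ler_wpM2r//.
  by rewrite /c lerDl.
(* The first bound absorbs [e1 |y|] and gives [|y| <= 2 c |v|]; the second makes the final error
   [2 c^2 e1 |v|] at most [e |v|]. *)
pose e1 := Num.min (2 * c)^-1 (e / (2 * c ^+ 2)).
have e10 : 0 < e1 by rewrite lt_min invr_gt0 divr_gt0 ?mulr_gt0 ?exprn_gt0.
have e1c : e1 * c <= 2^-1.
  by rewrite -ler_pdivlMr// -invfM ge_min lexx.
have e1e : e1 * (2 * c ^+ 2) <= e.
  by rewrite -ler_pdivlMr ?mulr_gt0 ?exprn_gt0// ge_min lexx orbT.
have near_Q : \forall w \near P x, enorm (P (Q w) - P x - (Q w - x) *m J) <= e1 * enorm (Q w - x).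
  apply: (cQ [set y | enorm (P y - P x - (y - x) *m J) <= e1 * enorm (y - x)]).
  by rewrite QP; exact: diff_enorm.
apply: filterS2 near_Q PQ => w + PQw; rewrite PQw.
set y : 'rV[R]_m := Q w - x; set v : 'rV[R]_n := w - P x => h.
have yK : y = y *m J *m K by rewrite -mulmxA JK mulmx1.
have y1 : enorm y <= c * (enorm v + e1 * enorm y).
  rewrite {1}yK; apply: le_trans (Kc _) _; rewrite ler_wpM2l ?(ltW c0)//.
  have := enorm_sub v (v - y *m J); rewrite opprB addrC subrK.
  lra.
have y2 : enorm y <= 2 * c * enorm v.
  by have := enorm_ge0 y; nra.
have -> : y - v *m K = - ((v - y *m J) *m K).
  by clearbody y v; rewrite mulmxBl opprB -yK.
rewrite enormN; apply: le_trans (Kc _) _.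
apply: le_trans (_ : c * (e1 * enorm y) <= _); first by rewrite ler_wpM2l// ltW.
apply: le_trans (_ : c * (e1 * (2 * c * enorm v)) <= _).
  by rewrite ler_wpM2l ?(ltW c0)// ler_wpM2l// ltW.
by have := enorm_ge0 v; nra.
Qed.

(** The scalar mean value theorem for the component of [f] along [u = f y - f x], followed by
    Cauchy-Schwarz and division by [|u|]. *)
Lemma mean_value_enorm m n (f : 'rV[R]_m -> 'rV[R]_n) (x y : 'rV[R]_m) :
  (forall t, 0 <= t <= 1 -> differentiable f (x + t *: (y - x))) ->
  (forall t, 0 <= t <= 1 -> forall v : 'rV[R]_m, enorm (v *m 'J f (x + t *: (y - x))) <= enorm v) ->
  enorm (f y - f x) <= enorm (y - x).
Proof.
move=> df Jf; pose u : 'rV[R]_n := f y - f x.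
pose line (t : R) : 'rV[R]_m := x + t *: (y - x).
pose L : {linear 'rV[R]_n -> 'rV[R]_1} := mulmxr (u^T).
have cL : continuous L by move=> z P; exact: near_mulmx.
have dline (t : R) : is_diff t line ( *:%R^~ (y - x)).
  have h : is_diff t (cst x + *:%R^~ (y - x)) (0 + *:%R^~ (y - x)) by apply: is_diffD.
  by apply: is_diff_eq h _; apply/funext => z; rewrite /= add0r.
pose F (t : R) : 'rV[R]_1 := L (f (line t)).
pose phi (t : R) : R := F t 0 0.
have dphi (t : R) : 0 <= t <= 1 -> is_derive t 1 phi (dot ((y - x) *m 'J f (line t)) u).
  move=> t01; have dft : differentiable f (line t) by exact: df.
  have dl : differentiable line t by [].
  have dfl : differentiable (f \o line) t by exact: differentiable_comp.
  have dLf : differentiable L ((f \o line) t) by exact: linear_differentiable.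
  have dF : differentiable (L \o (f \o line)) t by exact: differentiable_comp.
  have derF := @diff_derivable _ _ _ _ t 1 dF.
  have derphi : derivable phi t 1 by exact: (derivable_mxP _ _ _).1 derF 0 0.
  split=> //; have := congr1 (fun M : 'rV[R]_1 => M 0 0) (derive_mx derF).
  rewrite mxE => <-; rewrite deriveE// diff_comp// diff_lin//= diff_comp//=.
  by rewrite diff_val scale1r /jacobian mul_rV_lin1.
have [||t t01] := @MVT R phi (fun t => dot ((y - x) *m 'J f (line t)) u) 0 1 ltr01.
- by move=> t; rewrite in_itv /= => /andP[t0 t1]; apply: dphi; rewrite !ltW.
- apply: derivable_within_continuous => t; rewrite in_itv /= => t01.
  by have [] := dphi t t01.
rewrite in_itv /= in t01; case/andP: t01 => t0 t1.
have phiE : phi 1 - phi 0 = dot u u.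
  have -> : phi 1 = dot (f y) u by rewrite /phi /F /line scale1r addrC subrK.
  have -> : phi 0 = dot (f x) u by rewrite /phi /F /line scale0r addr0.
  by rewrite -dotNl -dotDl.
rewrite phiE subr0 mulr1 -sqr_enorm => h.
have := dot_le ((y - x) *m 'J f (line t)) u.
have t01 : 0 <= t <= 1 by rewrite !ltW.
rewrite -h; have := Jf t t01 (y - x).
rewrite -/(line t) -/u; have := enorm_ge0 u.
have [->|u0] := eqVneq (enorm u) 0; first by move=> *; exact: enorm_ge0.
move=> u1 h1 h2; have up : 0 < enorm u by rewrite lt_neqAle eq_sym u0.
by apply: le_trans h1; rewrite -(ler_pM2r up) -expr2.
Qed.

Lemma dot_polarization n (a b v w : 'rV[R]_n) : dot a a = dot v v -> dot b b = dot w w ->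
  dot (a - b) (a - b) = dot (v - w) (v - w) -> dot a b = dot v w.
Proof.
move=> av bw; rewrite !(dotDl, dotDr, dotNl, dotNr) (dotC b a) (dotC w v) av bw.
lra.
Qed.

(** By polarization [u] preserves scalar products. The rows of [A] are the rescaled images of the
    basis vectors, and the products with them determine [u v]. *)
Lemma isometry_rigid n (f : 'rV[R]_n -> 'rV[R]_n) (x : 'rV[R]_n) (r : R) : 0 < r ->
  (forall y z : 'rV[R]_n, enorm (y - x) < r -> enorm (z - x) < r -> enorm (f y - f z) = enorm (y - z)) ->
  exists2 g : motion R n, rigid g & forall y : 'rV[R]_n, enorm (y - x) < r -> f y = move g y.
Proof.
move=> r0 iso; pose u (v : 'rV[R]_n) : 'rV[R]_n := f (v + x) - f x.
have udot v w : enorm v < r -> enorm w < r -> dot (u v) (u w) = dot v w.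
  move=> vr wr; have uu z : enorm z < r -> dot (u z) (u z) = dot z z.
    move=> zr; rewrite -!sqr_enorm /u iso ?addrK// ?subrr ?enorm0//.
  apply: (dot_polarization (uu _ vr) (uu _ wr)).
  rewrite -!sqr_enorm /u opprB addrA subrK iso ?addrK//.
  by rewrite opprD addrACA subrr addr0.
pose s := r / 2; have s0 : 0 < s by rewrite /s; lra.
pose e (i : 'I_n) : 'rV[R]_n := delta_mx 0 i.
have edot v i : dot v (e i) = v 0 i.
  by rewrite /dot trmx_delta -colE mxE.
have sr i : enorm (s *: e i) < r.
  rewrite enormZ gtr0_norm// /enorm edot mxE !eqxx sqrtr1 mulr1 /s; lra.
pose A : 'M[R]_n := \matrix_(i, j) (s^-1 *: u (s *: e i)) 0 j.
have rA i : row i A = s^-1 *: u (s *: e i) by apply/rowP => j; rewrite !mxE.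
have uA v : enorm v < r -> u v *m A^T = v.
  move=> vr; apply/rowP => i.
  have -> : (u v *m A^T) 0 i = dot (u v) (row i A).
    by rewrite dotE mxE; apply: eq_bigr => j _; rewrite !mxE.
  by rewrite rA dotZr udot// dotZr edot mulrA mulVf ?mul1r// gt_eqF.
have oA : orthogonal A.
  apply/row_matrixP => i; rewrite row_mul rA -scalemxAl uA// scalerA mulVf ?gt_eqF//.
  by rewrite scale1r row1.
exists (A, f x - x *m A) => // y yr; rewrite /move /=.
have := uA (y - x) yr; rewrite /u subrK => h.
rewrite -[in RHS](subrK x y) mulmxDl -{1}h orthogonalKV//.
by rewrite addrACA subrr addr0 subrK.
Qed.

(** By the mean value inequality both [T] and its inverse [S] are 1-Lipschitz on small balls, so [T]
    preserves distances there. *)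
Lemma local_rigidity n (T S : 'rV[R]_n -> 'rV[R]_n) (W W' : set 'rV[R]_n) :
  open W -> open W' -> (forall x, W x -> W' (T x)) ->
  (forall x, W x -> S (T x) = x) ->
  (forall x, W x -> differentiable T x /\ orthogonal ('J T x)) ->
  (forall x, W' x -> differentiable S x /\ orthogonal ('J S x)) ->
  forall x, W x -> exists2 g, rigid g & \forall z \near x, T z = move g z.
Proof.
move=> oW oW' TW ST dT dS x Wx.
have seg (a b c : 'rV[R]_n) (t e : R) : enorm (a - c) < e -> enorm (b - c) < e -> 0 <= t <= 1 ->
    enorm (a + t *: (b - a) - c) < e.
  move=> ac bc /andP[t0 t1]; rewrite (_ : _ - c = (1 - t) *: (a - c) + t *: (b - c)); last first.
    by apply/rowP => i; rewrite !mxE; ring.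
  apply: le_lt_trans (enormD _ _) _; rewrite !enormZ !ger0_norm ?subr_ge0//.
  by have [h|/ltW h] := leP (enorm (a - c)) (enorm (b - c)); nra.
have mv (F : 'rV[R]_n -> 'rV[R]_n) (c a b : 'rV[R]_n) (e : R) :
    (forall z, enorm (z - c) < e -> differentiable F z /\ orthogonal ('J F z)) ->
    enorm (a - c) < e -> enorm (b - c) < e -> enorm (F b - F a) <= enorm (b - a).
  move=> dF ac bc; apply: mean_value_enorm => t t01.
    by have [] := dF _ (seg _ _ _ _ _ ac bc t01).
  move=> v; rewrite enorm_orthogonal//.
  by have [] := dF _ (seg _ _ _ _ _ ac bc t01).
have /near_enorm[r1 r10 Wr1] : nbhs x W by exact: open_nbhs_nbhs.
have /near_enorm[r2 r20 Wr2] : nbhs (T x) W' by apply: open_nbhs_nbhs; split=> //; exact: TW.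
have cT : {for x, continuous T} by apply: differentiable_continuous; have [] := dT x Wx.
have /near_enorm[r3 r30 Tr3] : \forall z \near x, enorm (T z - T x) < r2.
  exact: (cT [set w | enorm (w - T x) < r2] (near_eball (T x) r20)).
pose r := Num.min r1 r3; have r0 : 0 < r by rewrite lt_min r10.
have rr1 z : enorm (z - x) < r -> enorm (z - x) < r1 by rewrite lt_min => /andP[].
have rr3 z : enorm (z - x) < r -> enorm (T z - T x) < r2.
  by rewrite lt_min => /andP[_ /Tr3].
have [|g rg gT] := @isometry_rigid n T x r r0.
  move=> y z yx zx; apply/eqP; rewrite eq_le.
  rewrite (mv T x z y r1); [|by move=> w /Wr1/dT|exact: rr1|exact: rr1].
  rewrite -{1}(ST y (Wr1 _ (rr1 _ yx))) -{1}(ST z (Wr1 _ (rr1 _ zx))).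
  by rewrite (mv S (T x) _ _ r2); [|by move=> w /Wr2/dS|exact: rr3|exact: rr3].
by exists g => //; apply/near_enorm; exists r.
Qed.

End Calculus.

(** * Inverses of parametrizations *)

Section Parametrizations.
Context {R : realType} {n : nat} {T : topologicalType}.
Variables (V : set 'rV[R]_n) (phi : 'rV[R]_n -> T).
Hypothesis pphi : parametrization V phi.
Local Notation inv := ('pinv_(fun=> 0) V phi).

Lemma par_invK x : V x -> inv (phi x) = x.
Proof. by case: pphi => _ inj _ _ Vx; rewrite pinvKV// inE. Qed.

Lemma par_invKV p : (phi @` V) p -> phi (inv p) = p /\ V (inv p).
Proof. by move=> [x Vx <-]; rewrite par_invK. Qed.

Lemma par_near x : V x -> nbhs (phi x) (phi @` V).
Proof.
case: pphi => oV _ _ op Vx; apply: open_nbhs_nbhs; split; first exact: op.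
by exists x.
Qed.

Lemma par_inv_cont x : V x -> {for phi x, continuous inv}.
Proof.
move=> Vx N; rewrite par_invK// => Nx.
case: pphi => oV _ _ op.
have oVN : open (V `&` N^°) by apply: openI => //; exact: open_interior.
have : nbhs (phi x) (phi @` (V `&` N^°)).
  by apply: open_nbhs_nbhs; split; [apply: op => // y []|exists x].
apply: filterS => _ [y [Vy Ny] <-]; rewrite /= par_invK//.
exact: interior_subset Ny.
Qed.

End Parametrizations.

Lemma pos_def_unitmx (R : realType) n (J : 'M[R]_n) :
  (forall v : 'rV[R]_n, v != 0 -> 0 < (v *m (J *m J^T) *m v^T) 0 0) -> J \in unitmx.
Proof.
move=> h; rewrite -row_free_unit -kermx_eq0; apply/rowV0P => v /sub_kermxP vJ.
apply/eqP/negPn/negP => /h; rewrite !mulmxA vJ !mul0mx mxE ltxx.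
by [].
Qed.

Lemma invmx_gram (R : realType) n (J : 'M[R]_n) : J \in unitmx ->
  invmx J *m (J *m J^T *m invmx J^T) = 1%:M.
Proof.
by move=> uJ; rewrite mulmxA mulmxA mulVmx// mul1mx mulmxV// unitmx_tr.
Qed.

(** * Isometric coordinates and their transition maps *)

Section IsometricCoordinates.
Context {R : realType} {n : nat} {M : topologicalType} (g : metric_atlas R n M).

(** In the last field the Gram matrix [J J^T] is the pullback of the Euclidean metric; first
    derivatives are enough for rigidity. *)
Record isocoord (A : set M) (B : set 'rV[R]_n) (e : M -> 'rV[R]_n) (e' : 'rV[R]_n -> M) : Prop :=
  Isocoord {
  iso_openl : open A ;
  iso_openr : open B ;
  iso_mapl : forall p, A p -> B (e p) ;
  iso_mapr : forall x, B x -> A (e' x) ;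
  isoK : forall p, A p -> e' (e p) = p ;
  isoKV : forall x, B x -> e (e' x) = x ;
  iso_contl : forall p, A p -> {for p, continuous e} ;
  iso_contr : forall x, B x -> {for x, continuous e'} ;
  iso_metric : forall i x, cdom i x -> A (cpar (m := g) i x) ->
    differentiable (e \o cpar (m := g) i) x /\
    cmetric i x = 'J (e \o cpar (m := g) i) x *m ('J (e \o cpar (m := g) i) x)^T }.

Hypothesis par_g : forall i : cindex g, parametrization (cdom i) (cpar i).
Hypothesis cover_g : forall p : M, exists i : cindex g, (cpar i @` cdom i) p.
Hypothesis pos_g : forall (i : cindex g) x, cdom i x -> forall v : 'rV[R]_n,
  v != 0 -> 0 < (v *m cmetric i x *m v^T) 0 0.

Section Transition.
Variables (A1 A2 : set M) (B1 B2 : set 'rV[R]_n).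
Variables (e1 e2 : M -> 'rV[R]_n) (e1' e2' : 'rV[R]_n -> M).
Hypotheses (iso1 : isocoord A1 B1 e1 e1') (iso2 : isocoord A2 B2 e2 e2').

(** Seen from a chart of the atlas, both coordinate systems have Jacobians with the same invertible
    Gram matrix, so the quotient of the Jacobians is orthogonal. *)
Lemma transition_diff w : B1 w -> A2 (e1' w) ->
  differentiable (e2 \o e1') w /\ orthogonal ('J (e2 \o e1') w).
Proof.
move=> Bw A2w; have A1w := iso_mapr iso1 Bw.
have [i [z iz zw]] := cover_g (e1' w).
pose P := e1 \o cpar i; pose H := e2 \o cpar i.
have Pz : P z = w by rewrite /P /= zw (isoKV iso1).
have [dP gP] : differentiable P z /\ cmetric i z = 'J P z *m ('J P z)^T.
  by apply: (iso_metric iso1) => //; rewrite zw.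
have [dH gH] : differentiable H z /\ cmetric i z = 'J H z *m ('J H z)^T.
  by apply: (iso_metric iso2) => //; rewrite zw.
have uJ : 'J P z \in unitmx.
  by apply: pos_def_unitmx => v; rewrite -gP; exact: pos_g.
pose Q := 'pinv_(fun=> 0) (cdom i) (cpar i) \o e1'.
have QP : Q (P z) = z by rewrite /Q /= Pz -zw (par_invK (par_g i)).
have near_w : \forall w' \near w, B1 w' /\ (cpar i @` cdom i) (e1' w').
  have c1 : {for w, continuous e1'} by exact: (iso_contr iso1).
  have h1 : nbhs w B1 by apply: open_nbhs_nbhs; split=> //; exact: iso_openr iso1.
  have h2 : nbhs w (e1' @^-1` (cpar i @` cdom i)).
    by apply: c1; rewrite -zw; exact: (par_near (par_g i)).
  by apply: filterS2 h1 h2.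
have PQ : \forall w' \near P z, P (Q w') = w'.
  rewrite Pz; apply: filterS near_w => w' [Bw' /(par_invKV (par_g i))[h _]].
  by rewrite /P /Q /= h (isoKV iso1).
have cQ : {for P z, continuous Q}.
  rewrite Pz; apply: continuous_comp; first exact: (iso_contr iso1).
  by rewrite -zw; exact: (par_inv_cont (par_g i)).
have [dQ JQ] := inverse_diff dP (mulmxV uJ) (mulVmx uJ) QP PQ cQ.
have dHQ : differentiable (H \o Q) (P z).
  by apply: differentiable_comp; [exact: dQ|rewrite QP].
have near_T : \forall w' \near P z, (H \o Q) w' = (e2 \o e1') w'.
  rewrite Pz; apply: filterS near_w => w' [Bw' /(par_invKV (par_g i))[h _]].
  by rewrite /H /Q /= h.
have [dT JT] := differentiable_near_eq near_T dHQ.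
have dH' : differentiable H (Q (P z)) by rewrite QP.
rewrite -Pz; split; first exact: dT.
rewrite /orthogonal JT (jacobian_comp dQ dH') JQ QP.
rewrite trmx_mul -mulmxA (mulmxA ('J H z)) -gH gP trmx_inv.
exact: invmx_gram.
Qed.

End Transition.

Lemma iso_compat A1 A2 B1 B2 e1 e2 e1' e2' x y :
  isocoord A1 B1 e1 e1' -> isocoord A2 B2 e2 e2' ->
  B1 x -> B2 y -> e1' x = e2' y ->
  exists s, [/\ rigid s, move s x = y & \forall z \near x, e1' z = e2' (move s z)].
Proof.
move=> iso1 iso2 Bx By xy.
have dom B A e e' C : isocoord A B e e' -> open C -> open [set w | B w /\ C (e' w)].
  move=> iso oC; rewrite openE => w [Bw Cw].
  have h1 : nbhs w B by apply: open_nbhs_nbhs; split=> //; exact: iso_openr iso.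
  have h2 : nbhs w (e' @^-1` C) by apply: (iso_contr iso Bw); exact: open_nbhs_nbhs.
  by apply: filterS2 h1 h2.
have oW := dom _ _ _ _ _ iso1 (iso_openl iso2).
have oW' := dom _ _ _ _ _ iso2 (iso_openl iso1).
have A2x : A2 (e1' x) by rewrite xy; exact: (iso_mapr iso2 By).
have [|w [Bw Aw]|w [Bw Aw]|w [Bw Aw]|s rs near_s] := local_rigidity oW oW' _ _ _ _ (conj Bx A2x)
  (T := e2 \o e1') (S := e1 \o e2').
- move=> w [Bw Aw] /=; split; first exact: (iso_mapl iso2 Aw).
  by rewrite (isoK iso2)//; exact: (iso_mapr iso1 Bw).
- by rewrite /= (isoK iso2)// (isoKV iso1).
- exact: (transition_diff iso1 iso2 Bw Aw).
- exact: (transition_diff iso2 iso1 Bw Aw).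
have near_A : \forall w \near x, A2 (e1' w).
  apply: (iso_contr iso1 Bx); apply: open_nbhs_nbhs; split=> //.
  exact: iso_openl iso2.
exists s; split=> //.
  by rewrite -(nbhs_singleton near_s) /= xy (isoKV iso2).
by apply: filterS2 near_s near_A => w <- Aw; rewrite /= (isoK iso2).
Qed.

Lemma flat_isocoord A B f :
  riemannian_isometry g (euclidean R n) A B f -> exists f', isocoord A B f f'.
Proof.
move=> [[oA oB [cf sf] fAB [f' [[cf' _] f'BA fK f'K]]] pf].
exists f'; split=> //.
- by move=> p Ap; apply: fK; rewrite inE.
- by move=> x Bx; apply: f'K; rewrite inE.
move=> i x ix Ax.
(* The Euclidean atlas has a single chart, the identity. *)
have ce : chart_expr (g := g) (h := euclidean R n) f i tt = f \o cpar i.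
  apply/funext => z; rewrite /chart_expr /=.
  have := @pinvK _ _ (fun=> 0) [set: 'rV[R]_n] id (f (cpar i z)).
  by rewrite inE => ->//; exists (f (cpar i z)).
have ich : in_charts (g := g) (h := euclidean R n) A f i tt x.
  by split=> //; exists (f (cpar i x)).
have [d _] := sf i tt 1%N.
rewrite -ce; split; first exact: d.
by rewrite (pf i tt x ich) /= mulmx1.
Qed.

End IsometricCoordinates.

(** * Adding the tip of the cone *)

Section Uniqueness.
Context {R : realType} {n : nat}.
Implicit Types (x y z v : 'rV[R]_n) (g h : motion R n) (A : 'M[R]_n).

Lemma near_motion_eq g h x : (\forall z \near x, move g z = move h z) -> g = h.
Proof.
move=> /near_enorm[r r0 gh].
have xx : move g x = move h x by apply: gh; rewrite subrr enorm0.
have lin : g.1 = h.1.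
  apply: mx_ext => v; have v1 : 0 < enorm v + 1 by rewrite ltr_wpDl.
  pose t : R := r / (2 * (enorm v + 1)).
  have t0 : 0 < t by rewrite divr_gt0// mulr_gt0.
  have : move g (t *: v + x) - move g x = move h (t *: v + x) - move h x.
    rewrite xx gh// addrK enormZ gtr0_norm// /t mulrAC ltr_pdivrMr ?mulr_gt0//.
    by rewrite ltr_pM2l//; have := enorm_ge0 v; lra.
  rewrite !move_sub addrK -!scalemxAl => /(congr1 (fun u => t^-1 *: u)).
  by rewrite !scalerA mulVf ?gt_eqF// !scale1r.
case: g h lin xx {gh} => [A b] [B c] /= ->; rewrite /move /= => /addrI ->.
by [].
Qed.

Lemma enorm_rescale r x : 0 < r -> x != 0 -> enorm ((r / (2 * enorm x)) *: x) = r / 2.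
Proof.
move=> r0; rewrite -enorm_gt0 => x0.
rewrite enormZ gtr0_norm ?divr_gt0 ?mulr_gt0// invfM mulrA mulfVK//.
exact: lt0r_neq0.
Qed.

Lemma near_scale (t : R) x (P : set 'rV[R]_n) :
  (\forall z \near t *: x, P z) -> \forall z \near x, P (t *: z).
Proof.
rewrite -mul_mx_scalar => /near_mulmx; apply: filterS => z.
by rewrite mul_mx_scalar.
Qed.

Lemma mrot_inj A B : mrot A = mrot B :> motion R n -> A = B.
Proof. by case. Qed.

Lemma exists_notin_span x : (1 < n)%N -> exists u : 'rV[R]_n, ~~ (u <= x)%MS.
Proof.
move=> n1; have : ~~ ((1%:M : 'M[R]_n) <= x)%MS.
  apply/negP => /mxrankS; rewrite mxrank1 => h.
  by have := leq_trans n1 (leq_trans h (rank_leq_row x)).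
by move=> /row_subPn[i h]; exists (row i 1%:M).
Qed.

Lemma segment_neq0 x y t : x != 0 -> ~~ (y <= x)%MS -> 0 <= t <= 1 -> x + t *: (y - x) != 0.
Proof.
move=> x0 yx /andP[t0 t1]; apply/eqP => h.
have {}h : t *: y = (t - 1) *: x.
  by apply/eqP; rewrite -subr_eq0 -h scalerBr scalerBl scale1r; apply/eqP; rewrite opprB addrCA.
have [tz|tz] := eqVneq t 0.
  by move: h; rewrite tz scale0r sub0r scaleN1r => /esym/eqP; rewrite oppr_eq0 (negbTE x0).
move/negP: yx; apply; apply/sub_rVP; exists (t^-1 * (t - 1)).
by rewrite -scalerA -h scalerA mulVf// scale1r.
Qed.

(* Connectedness of the punctured ball, as an induction principle. *)
Lemma punctured_ind (Q : set 'rV[R]_n) r : (1 < n)%N ->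
  (forall z, 0 < enorm z < r -> Q z -> \forall w \near z, Q w) ->
  (forall z, 0 < enorm z < r ->
     (forall P : set 'rV[R]_n, nbhs z P -> exists2 w, P w & Q w) -> Q z) ->
  forall x y, 0 < enorm x < r -> 0 < enorm y < r -> Q x -> Q y.
Proof.
move=> n1 Qo Qc; have seg x y : 0 < enorm x < r -> 0 < enorm y < r ->
    (forall t, 0 <= t <= 1 -> x + t *: (y - x) != 0) -> Q x -> Q y.
  move=> /andP[_ xr] /andP[_ yr] nz.
  have pz t : 0 <= t <= 1 -> 0 < enorm (x + t *: (y - x)) < r.
    by move=> t01; rewrite enorm_gt0 nz//= enorm_segment.
  by apply: segment_ind => t t01; [apply: Qo|apply: Qc]; exact: pz.
move=> x y xr yr; have [x0 y0] : x != 0 /\ y != 0.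
  by move: xr yr; rewrite !enorm_gt0 => /andP[? _] /andP[].
have [/sub_rVP[a ya]|yx] := boolP (y <= x)%MS; last first.
  by apply: seg => // t; exact: segment_neq0.
have a0 : a != 0 by apply: contraNneq y0 => a0; rewrite ya a0 scale0r.
(* The segment between collinear points may meet 0; a detour through a point [w] off their line
   avoids it. *)
have [u ux] := exists_notin_span x n1.
have u0 : u != 0 by apply: contraNneq ux => ->; exact: sub0mx.
pose b := r / (2 * enorm u); have r0 : 0 < r by case/andP: xr; exact: lt_trans.
have b0 : 0 < b by rewrite divr_gt0// mulr_gt0// enorm_gt0.
pose w := b *: u; have uw : u = b^-1 *: w by rewrite /w scalerA mulVf ?gt_eqF// scale1r.
have wx : ~~ (w <= x)%MS by apply: contra ux => h; rewrite uw scalemx_sub.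
have wr : 0 < enorm w < r.
  have -> : enorm w = r / 2.
    exact: enorm_rescale.
  by apply/andP; split; lra.
move=> Qx; have Qw : Q w by apply: seg Qx => // t; exact: segment_neq0.
have wy : ~~ (w <= y)%MS.
  by apply: contra wx => h; apply: (submx_trans h); rewrite ya scalemx_sub.
apply: seg Qw => // t /andP[t0 t1].
have -> : w + t *: (y - w) = y + (1 - t) *: (w - y).
  by apply/rowP => j; rewrite !mxE; ring.
by apply: segment_neq0 => //; apply/andP; split; lra.
Qed.

End Uniqueness.

(** Without a finite subcover, the sets containing [A] minus finitely many [H p] form a proper
    filter, whose cluster point [p] contradicts the neighbourhood [H p]. *)
Lemma compact_finite_cover (T : topologicalType) (A : set T) (H : T -> set T) :
  compact A -> (forall p, nbhs p (H p)) ->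
  exists s : seq T, forall q, A q -> exists2 p, p \in s & H p q.
Proof.
move=> cA nH; apply: contrapT => nofin.
pose F : set_system T := [set P | exists s : seq T,
  forall q, A q -> (forall p, p \in s -> ~ H p q) -> P q].
have FF : ProperFilter F.
  split.
    move=> [s sP]; apply: nofin; exists s => q Aq; apply: contrapT => h.
    by apply: (sP q Aq) => p ps Hq; apply: h; exists p.
  split; first by exists [::].
    move=> P Q [s1 sP] [s2 sQ]; exists (s1 ++ s2) => q Aq h.
    by split; [apply: sP|apply: sQ] => // p ps; apply: h; rewrite mem_cat ps ?orbT.
  by move=> P Q PQ [s sP]; exists s => q Aq /(sP q Aq)/PQ.
have [|p [_ clp]] := cA F FF; first by exists [::].
have Fp : F (~` H p) by exists [:: p] => q _; apply; rewrite mem_head.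
by have [q []] := clp _ _ Fp (nH p).
Qed.

(** * A flat manifold whose end is a punctured ball modulo a finite group *)

Section PuncturedBall.
Context {R : realType} {n : nat} {M : topologicalType} (g : metric_atlas R n M).
Hypothesis n1 : (1 < n)%N.
Hypothesis hausM : hausdorff_space M.
Hypothesis par_g : forall i : cindex g, parametrization (cdom i) (cpar i).
Hypothesis cover_g : forall p : M, exists i : cindex g, (cpar i @` cdom i) p.
Hypothesis pos_g : forall (i : cindex g) x, cdom i x -> forall v : 'rV[R]_n,
  v != 0 -> 0 < (v *m cmetric i x *m v^T) 0 0.
Hypothesis flat_g : forall p : M, exists A B e e', A p /\ isocoord g A B e e'.
Implicit Types (x y z w : 'rV[R]_n).

Definition isochart B (e' : 'rV[R]_n -> M) := exists A e, isocoord g A B e e'.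

Lemma isochart_inj B e' x y : isochart B e' -> B x -> B y -> e' x = e' y -> x = y.
Proof.
by move=> [A [e iso]] Bx By /(congr1 e); rewrite !(isoKV iso).
Qed.

Lemma isochart_cont B e' x : isochart B e' -> B x -> {for x, continuous e'}.
Proof. by move=> [A [e iso]] Bx; exact: (iso_contr iso). Qed.

Lemma isochart_near B e' x : isochart B e' -> B x -> nbhs x B.
Proof. by move=> [A [e iso]] Bx; apply: open_nbhs_nbhs; split=> //; exact: iso_openr iso. Qed.

Lemma isochart_compat B1 B2 e1 e2 x y : isochart B1 e1 -> isochart B2 e2 ->
  B1 x -> B2 y -> e1 x = e2 y ->
  exists s, [/\ rigid s, move s x = y & \forall z \near x, e1 z = e2 (move s z)].
Proof.
by move=> [A1 [f1 iso1]] [A2 [f2 iso2]]; exact: (iso_compat par_g cover_g pos_g iso1 iso2).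
Qed.

Lemma isochart_germ_inj B e' x (f h : 'rV[R]_n -> 'rV[R]_n) : isochart B e' -> B (f x) -> B (h x) ->
  {for x, continuous f} -> {for x, continuous h} ->
  (\forall z \near x, e' (f z) = e' (h z)) -> \forall z \near x, f z = h z.
Proof.
move=> iso Bf Bh cf ch eq.
have h1 : nbhs x (f @^-1` B) by apply: cf; exact: isochart_near iso Bf.
have h2 : nbhs x (h @^-1` B) by apply: ch; exact: isochart_near iso Bh.
apply: filterS2 (filterI h1 h2) eq => z [Bfz Bhz].
exact: (isochart_inj iso Bfz Bhz).
Qed.

Lemma move_cont (s : motion R n) x : {for x, continuous (move s)}.
Proof. by move=> P; exact: near_move. Qed.

Variables (phi : 'rV[R]_n -> M) (eps : R).
Hypothesis eps0 : 0 < eps.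
Hypothesis phi_iso : forall x, 0 < enorm x < eps -> exists2 B, isochart B phi & B x.

Lemma punctured_near r x : 0 < enorm x < r -> \forall z \near x, 0 < enorm z < r.
Proof.
move=> /andP[]; rewrite enorm_gt0 => x0 xr.
by apply: filterS2 (near_neq0 x0) (near_enorm_lt xr) => z; rewrite enorm_gt0 => -> ->.
Qed.

Lemma phi_cont x : 0 < enorm x < eps -> {for x, continuous phi}.
Proof. by move=> /phi_iso[B iso Bx]; exact: isochart_cont iso Bx. Qed.

(** Continuation over the connected punctured ball: a motion into one isometric chart that
    represents [phi] near one point represents it everywhere. *)
Lemma phi_unique B e' s r x : isochart B e' -> rigid s -> r <= eps -> 0 < enorm x < r ->
  (forall z, 0 < enorm z < r -> B (move s z)) ->
  (\forall z \near x, phi z = e' (move s z)) ->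
  forall y, 0 < enorm y < r -> phi y = e' (move s y).
Proof.
move=> iso rs re xr sB near_x y yr.
have sub z : 0 < enorm z < r -> 0 < enorm z < eps.
  by move=> /andP[-> h] /=; exact: lt_le_trans re.
suff /nbhs_singleton : \forall z \near y, phi z = e' (move s z) by [].
apply: (punctured_ind (Q := fun x => \forall z \near x, phi z = e' (move s z)) n1 _ _ xr yr near_x).
  by move=> z _ /near_near.
move=> z zr freq.
have eqz : phi z = e' (move s z).
  apply: hausM => P Q Pz Qz.
  have ce : {for z, continuous (e' \o move s)}.
    apply: continuous_comp; first exact: move_cont.
    by apply: isochart_cont iso _; exact: sB.
  have Pz' : nbhs z (phi @^-1` P) := phi_cont (sub _ zr) Pz.
  have Qz' : nbhs z ((e' \o move s) @^-1` Q) := ce _ Qz.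
  have [w [Pw Qw] /nbhs_singleton] := freq _ (filterI Pz' Qz').
  by move=> E; exists (phi w); split=> //; rewrite E.
have [B1 iso1 B1z] := phi_iso (sub _ zr).
have [s' [rs' s'z near_z]] := isochart_compat iso1 iso B1z (sB _ zr) eqz.
suff -> : s = s' by [].
have Bs'z : \forall w \near z, B (move s' w).
  by apply: near_move; rewrite s'z; exact: isochart_near iso (sB _ zr).
have [w [[near_w Bw] wr] near_w'] :=
  freq _ (filterI (filterI (near_near near_z) Bs'z) (punctured_near zr)).
apply: (@near_motion_eq _ _ _ _ w).
apply: (isochart_germ_inj iso) => //; [exact: sB|exact: move_cont|exact: move_cont|].
by apply: filterS2 near_w near_w' => v -> ->.
Qed.

Variables (gT : finGroupType) (act : gT -> 'rV[R]_n -> 'rV[R]_n).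
Hypothesis gT1 : (1 < #|gT|)%N.
Hypothesis act_orbit : forall x y, 0 < enorm x < eps -> 0 < enorm y < eps ->
  phi x = phi y <-> exists a, act a x = y.
Hypothesis enorm_act : forall a x, x != 0 -> enorm (act a x) = enorm x.
Hypothesis act_scale : forall a (t : R) x, 0 < t -> x != 0 -> act a (t *: x) = t *: act a x.
Hypothesis act_cont : forall a x, x != 0 -> {for x, continuous (act a)}.
Hypothesis act_free : forall a x, x != 0 -> act a x = x -> a = 1%g.

Lemma exists_punctured (P : set 'rV[R]_n) x : nbhs x P -> exists2 z, z != 0 & P z.
Proof.
move=> /near_enorm[r r0 h]; have [x0|x0] := eqVneq x 0; last first.
  by exists x => //; apply: h; rewrite subrr enorm0.
have [u ux] := exists_notin_span (0 : 'rV[R]_n) n1.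
have u0 : u != 0 by apply: contraNneq ux => ->; exact: sub0mx.
have e0 : 0 < enorm u by rewrite enorm_gt0.
exists ((r / (2 * enorm u)) *: u).
  by rewrite scaler_eq0 negb_or u0 andbT gt_eqF// divr_gt0// mulr_gt0.
by apply: h; rewrite x0 subr0 enorm_rescale//; lra.
Qed.

Lemma nontrivial_elt : exists a : gT, a != 1%g.
Proof.
apply: contrapT => h; move: gT1; rewrite -cardsT.
have -> : [set: gT]%SET = [set 1%g]%SET.
  apply/setP => a; rewrite !inE; apply/esym/negPn/negP => a1; apply: h; by exists a.
by rewrite cards1.
Qed.

(* [phi \o act a = phi], and [phi] is an isometric chart near both points. *)
Lemma act_local_move a x : 0 < enorm x < eps ->
  exists2 s, rigid s & \forall z \near x, act a z = move s z.
Proof.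
move=> xe; have x0 : x != 0 by case/andP: xe; rewrite enorm_gt0.
have axe : 0 < enorm (act a x) < eps by rewrite enorm_act.
have [B1 iso1 Bx] := phi_iso xe; have [B2 iso2 Bax] := phi_iso axe.
have E : phi x = phi (act a x) by apply/act_orbit => //; exists a.
have [s [rs sx near_s]] := isochart_compat iso1 iso2 Bx Bax E.
exists s => //; apply: (isochart_germ_inj iso2) => //; rewrite ?sx//.
- exact: act_cont.
- exact: move_cont.
apply: filterS2 near_s (punctured_near xe) => z <- ze; apply/esym/act_orbit => //.
  by rewrite enorm_act//; case/andP: ze; rewrite enorm_gt0.
by exists a.
Qed.

(** The action is locally a rigid motion and commutes with scaling, so the translation part
    vanishes: comparing two points of one ray gives [d *: s.2 = 0]. *)
Lemma act_local_linear a x : x != 0 ->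
  exists2 A, orthogonal A & \forall z \near x, act a z = z *m A.
Proof.
move=> x0; have ex : 0 < enorm x by rewrite enorm_gt0.
pose t := eps / (2 * enorm x); have t0 : 0 < t by rewrite divr_gt0// mulr_gt0.
have tx : 0 < enorm (t *: x) < eps.
  by rewrite /t enorm_rescale// divr_gt0//= ltr_pdivrMr// ltr_pMr// ltr1n.
have [s rs near_s] := act_local_move a tx.
have s2 : s.2 = 0.
  have /near_enorm[r r0 h] := near_s.
  pose d := r / (2 * enorm (t *: x)).
  have e0 : 0 < enorm (t *: x) by case/andP: tx.
  have d0 : 0 < d by rewrite divr_gt0// mulr_gt0.
  have E1 : act a (t *: x) = move s (t *: x) by apply: h; rewrite subrr enorm0.
  have E2 : act a ((1 + d) *: (t *: x)) = move s ((1 + d) *: (t *: x)).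
    apply: h; rewrite scalerDl scale1r addrC addKr enorm_rescale//; first lra.
    by rewrite -enorm_gt0.
  move: E2; rewrite act_scale ?E1; [|by rewrite ltr_pwDl// ltW|by rewrite -enorm_gt0].
  rewrite /move scalerDr scalemxAl => /addrI; rewrite scalerDl scale1r => /eqP.
  by rewrite -subr_eq0 addrC addKr scaler_eq0 (gt_eqF d0)/= => /eqP.
exists s.1 => //.
have : \forall z \near x, act a (t *: z) = move s (t *: z).
  exact: near_scale near_s.
move=> h; apply: filterS2 (near_neq0 x0) h => z z0.
rewrite act_scale// /move s2 addr0 -scalemxAl => /(congr1 (fun u => t^-1 *: u)).
by rewrite !scalerA mulVf ?gt_eqF// !scale1r.
Qed.

(** The local matrix is locally constant on the connected set of nonzero vectors. *)
Lemma act_linear a : exists2 A, orthogonal A & forall x, x != 0 -> act a x = x *m A.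
Proof.
have [u u0 _] := @exists_punctured setT 0 filterT.
have [A oA near_u] := act_local_linear a u0; exists A => // x x0.
suff /nbhs_singleton : \forall z \near x, act a z = z *m A by [].
pose r := enorm u + enorm x + 1.
have [ur xr] : 0 < enorm u < r /\ 0 < enorm x < r.
  have := enorm_ge0 u; have := enorm_ge0 x.
  by split; apply/andP; split; rewrite /r ?enorm_gt0//; lra.
apply: (punctured_ind (Q := fun x => \forall z \near x, act a z = z *m A) n1 _ _ ur xr near_u).
  by move=> z _ /near_near.
move=> z /andP[]; rewrite enorm_gt0 => z0 _ freq.
have [A' oA' near_z] := act_local_linear a z0.
have [w near_w near_w'] := freq _ (near_near near_z).
suff -> : A = A' by [].
apply: mrot_inj; apply: (@near_motion_eq _ _ _ _ w).
by apply: filterS2 near_w near_w' => v; rewrite !move_rot => -> ->.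
Qed.

Definition act_mx a : 'M[R]_n := s2val (cid2 (act_linear a)).

Lemma orthogonal_act a : orthogonal (act_mx a).
Proof. by rewrite /act_mx; case: cid2. Qed.

Lemma actE a x : x != 0 -> act a x = x *m act_mx a.
Proof. by rewrite /act_mx; case: cid2 => /= A _; apply. Qed.

Lemma phi_act a x : 0 < enorm x < eps -> phi (x *m act_mx a) = phi x.
Proof.
move=> xe; have x0 : x != 0 by case/andP: xe; rewrite enorm_gt0.
by apply/esym/act_orbit; rewrite ?enorm_orthogonal//; [exact: orthogonal_act|exists a; exact: actE].
Qed.

(** Some [a] agrees with [A] at [x]; near [x] both matrices lift the same map, and [phi] is
    injective near [x *m A]. *)
Lemma phi_germ (A : 'M[R]_n) x : orthogonal A -> 0 < enorm x < eps ->
  (\forall z \near x, phi (z *m A) = phi z) -> exists a, A = act_mx a.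
Proof.
move=> oA xe near_x; have x0 : x != 0 by case/andP: xe; rewrite enorm_gt0.
have xAe : 0 < enorm (x *m A) < eps by rewrite enorm_orthogonal.
have [a ax] : exists a, act a x = x *m A.
  by apply/act_orbit => //; rewrite (nbhs_singleton near_x).
exists a; apply: mrot_inj; apply: (@near_motion_eq _ _ _ _ x).
have [B iso Bx] := phi_iso xAe.
apply: (isochart_germ_inj iso); rewrite ?move_rot -?actE// ?ax//; try exact: move_cont.
apply: filterS2 near_x (punctured_near xe) => z E ze.
by rewrite !move_rot phi_act.
Qed.

(** If [phi] came near [p] at arbitrarily small vectors, [phi_unique] would make it injective on a
    punctured ball. But it is invariant under a nontrivial [a], which acts freely. *)
Lemma tip_avoid (p : M) : exists P : set M, nbhs p P /\
  exists2 d, 0 < d <= eps & forall x, 0 < enorm x < d -> ~ P (phi x).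
Proof.
have [A [B [e [e' [Ap iso]]]]] := flat_g p.
have ic : isochart B e' by exists A, e.
have Bp : B (e p) := iso_mapl iso Ap.
have /near_enorm[r r0 rB] := isochart_near ic Bp.
exists [set q | A q /\ enorm (e q - e p) < r / 4]; split.
  have h1 : nbhs p A by apply: open_nbhs_nbhs; split=> //; exact: iso_openl iso.
  have h2 : nbhs p (e @^-1` [set x | enorm (x - e p) < r / 4]).
    by apply: (iso_contl iso Ap); apply: near_eball; lra.
  exact: filterI h1 h2.
(* Two points of the ball of radius [d] are less than [r / 2] apart, so their images stay within [r]
   of [e p]. *)
pose d := Num.min eps (r / 4).
have [d0 de dr] : [/\ 0 < d, d <= eps & d <= r / 4].
  by split; rewrite /d ?lt_min ?ge_min ?lexx ?orbT//; apply/andP; split=> //; lra.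
exists d; rewrite ?d0// => x xd [Ax xr].
have xe : 0 < enorm x < eps by case/andP: xd => -> /= /lt_le_trans; apply.
have [B1 iso1 B1x] := phi_iso xe.
have [|s [rs sx near_s]] := isochart_compat iso1 ic B1x (iso_mapl iso Ax).
  by rewrite (isoK iso).
have sB z : 0 < enorm z < d -> B (move s z).
  move=> /andP[_ zd]; apply: rB.
  have := enorm_triangle (move s z) (move s x) (e p).
  have := enorm_sub z x; rewrite enorm_move// sx => h1 h2.
  by case/andP: xd => _ xd; lra.
have E := phi_unique ic rs de xd sB near_s.
have [a a1] := nontrivial_elt.
have x0 : x != 0 by rewrite -enorm_gt0; case/andP: xd.
move/eqP: a1; apply; apply: (act_free x0).
have xad : 0 < enorm (x *m act_mx a) < d by rewrite enorm_orthogonal//; exact: orthogonal_act.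
have := phi_act a xe; rewrite E// E// => /(isochart_inj ic (sB _ xad) (sB _ xd)).
by move=> /(can_inj (moveK rs)); rewrite actE.
Qed.

Hypothesis compact_end : forall d, 0 < d < eps -> compact (~` (phi @` [set x | 0 < enorm x < d])).

Lemma flat_ball (p : M) : exists F : (M -> 'rV[R]_n) * ('rV[R]_n -> M) * set M * R,
  [/\ isocoord g F.1.2 (eball (F.1.1.1 p) F.2) F.1.1.1 F.1.1.2, 0 < F.2 & F.1.2 p].
Proof.
have [A [B [e [e' [Ap iso]]]]] := flat_g p.
have /near_enorm[r r0 rB] : nbhs (e p) B.
  by apply: open_nbhs_nbhs; split; [exact: iso_openr iso|exact: (iso_mapl iso Ap)].
have oA : open (A `&` e @^-1` eball (e p) r).
  rewrite openE => q [Aq qr].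
  have h1 : nbhs q A by apply: open_nbhs_nbhs; split=> //; exact: iso_openl iso.
  have h2 : nbhs q (e @^-1` eball (e p) r).
    by apply: (iso_contl iso Aq); apply: open_nbhs_nbhs; split=> //; exact: open_eball.
  exact: filterI h1 h2.
exists (e, e', A `&` e @^-1` eball (e p) r, r); split=> //=; last first.
  by split=> //; rewrite /eball/= subrr enorm0.
split.
- exact: oA.
- exact: open_eball.
- by move=> q [].
- move=> x xr; split; first exact: (iso_mapr iso (rB _ xr)).
  by rewrite /= (isoKV iso (rB _ xr)).
- by move=> q [Aq _]; exact: isoK iso _ Aq.
- by move=> x /rB; exact: isoKV iso _.
- by move=> q [Aq _]; exact: iso_contl iso _ Aq.
- by move=> x /rB; exact: iso_contr iso _.
- by move=> i x ix [Ax _]; exact: (iso_metric iso).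
Qed.

Definition ball_data (p : M) := sval (cid (flat_ball p)).
Definition bcoord p := (ball_data p).1.1.1.
Definition bpar p := (ball_data p).1.1.2.
Definition bdom p := (ball_data p).1.2.
Definition brad p := (ball_data p).2.

Lemma ball_dataP p : [/\ isocoord g (bdom p) (eball (bcoord p p) (brad p)) (bcoord p) (bpar p),
  0 < brad p & bdom p p].
Proof. by rewrite /bdom /brad /bcoord /bpar /ball_data; case: cid. Qed.

(* The orbifold obtained by adding the tip, which is [None]. *)
Definition ocenter (i : option M) : 'rV[R]_n := if i is Some p then bcoord p p else 0.
Definition oradius (i : option M) : R := if i is Some p then brad p else eps.
Definition opar (i : option M) (x : 'rV[R]_n) : option M :=
  if i is Some p then Some (bpar p x) else if x == 0 then None else Some (phi x).
Local Notation U i := (eball (ocenter i) (oradius i)).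

Lemma opar_chart i x : U i x -> (i = None /\ x = 0) \/
  exists B e', [/\ isochart B e', B x & \forall z \near x, opar i z = Some (e' z)].
Proof.
case: i => [p|] Ux; last first.
  have [->|x0] := eqVneq x 0; [by left|right].
  have [|B iso Bx] := @phi_iso x.
    by rewrite enorm_gt0 x0/=; move: Ux; rewrite /eball/= subr0.
  by exists B, phi; split=> //; apply: filterS (near_neq0 x0) => z /negbTE /= ->.
right; have [iso _ _] := ball_dataP p.
exists (eball (bcoord p p) (brad p)), (bpar p); split=> //; last exact: filterE.
by exists (bdom p), (bcoord p).
Qed.

Lemma opar_tip i x : U i x -> opar i x = None -> i = None /\ x = 0.
Proof.
by move=> /opar_chart[//|[B [e' [_ _ /nbhs_singleton ->]]]].
Qed.

Lemma opar0 : opar None 0 = None. Proof. by rewrite /= eqxx. Qed.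

Lemma opar_act a z : enorm z < eps -> opar None (z *m act_mx a) = opar None z.
Proof.
move=> ze /=; have oa := orthogonal_act a.
rewrite -!enorm_eq0 enorm_orthogonal// enorm_eq0; case: eqVneq => // z0.
by rewrite phi_act// enorm_gt0 z0.
Qed.

Lemma opar_compat i j x y : U i x -> U j y -> opar i x = opar j y ->
  exists s, [/\ rigid s, move s x = y & \forall z \near x, opar i z = opar j (move s z)].
Proof.
move=> Ux Uy; have [[-> ->]|[B1 [e1 [iso1 B1x near_x]]]] := opar_chart Ux.
  rewrite opar0 => /esym/(opar_tip Uy)[-> ->]; exists (mtrans 0).
  by split; [exact: rigid_trans|rewrite move_trans addr0|near=> z; rewrite move_trans addr0].
have [[-> ->]|[B2 [e2 [iso2 B2y near_y]]]] := opar_chart Uy.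
  by rewrite opar0 (nbhs_singleton near_x).
rewrite (nbhs_singleton near_x) (nbhs_singleton near_y) => -[exy].
have [s [rs sx near_s]] := isochart_compat iso1 iso2 B1x B2y exy.
exists s; split=> //; rewrite -sx in near_y.
by apply: filterS3 near_x near_s (near_move near_y) => z -> -> ->.
Unshelve. all: by end_near. Qed.

Lemma opar_sep_tip j y : U j y -> opar j y <> None ->
  exists P Q : set 'rV[R]_n, [/\ nbhs (0 : 'rV[R]_n) P, nbhs y Q &
    forall z w, P z -> Q w -> opar None z <> opar j w].
Proof.
move=> Uy; have [[-> ->]|[B [e [iso By near_y]]]] := opar_chart Uy.
  by rewrite opar0.
move=> _; have [P [eP [d /andP[d0 de] dP]]] := tip_avoid (e y).
exists (eball 0 d), [set w | P (e w) /\ opar j w = Some (e w)]; split.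
- exact: near_eball.
- by apply: filterI near_y; exact: (isochart_cont iso By) eP.
move=> z w; rewrite /eball/= subr0 => zd [Pw ->]; case: eqVneq => // z0 [zw].
by apply: (dP z); rewrite ?zw// enorm_gt0 z0.
Qed.

Lemma opar_sep i j x y : U i x -> U j y -> opar i x <> opar j y ->
  exists P Q : set 'rV[R]_n, [/\ nbhs x P, nbhs y Q &
    forall z w, P z -> Q w -> opar i z <> opar j w].
Proof.
move=> Ux Uy; have [[-> ->]|[B1 [e1 [iso1 B1x near_x]]]] := opar_chart Ux.
  by rewrite opar0 => h; apply: opar_sep_tip => // /esym.
have [[-> ->]|[B2 [e2 [iso2 B2y near_y]]]] := opar_chart Uy.
  rewrite opar0 => /(opar_sep_tip Ux)[P [Q [nP nQ PQ]]].
  by exists Q, P; split=> // z w Qz Pw /esym; exact: PQ.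
rewrite (nbhs_singleton near_x) (nbhs_singleton near_y) => exy.
have [[P Q]/= [nP nQ PQ]] : exists PQ : set M * set M,
    [/\ nbhs (e1 x) PQ.1, nbhs (e2 y) PQ.2 & forall q, PQ.1 q -> PQ.2 q -> False].
  apply: contrapT => h; apply: exy; congr Some; apply: hausM => P Q nP nQ.
  apply: contrapT => PQ; apply: h; exists (P, Q); split=> // q Pq Qq.
  by apply: PQ; exists q.
exists [set z | P (e1 z) /\ opar i z = Some (e1 z)], [set w | Q (e2 w) /\ opar j w = Some (e2 w)].
split.
- by apply: filterI near_x; exact: (isochart_cont iso1 B1x) nP.
- by apply: filterI near_y; exact: (isochart_cont iso2 B2y) nQ.
by move=> z w [Pz ->] [Qw ->] [zw]; apply: PQ Pz _; rewrite zw.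
Qed.

(** Away from the tip charts are injective, so a local symmetry is trivial. *)
Lemma opar_local_inj i B e' x s : isochart B e' -> B x -> rigid s -> move s x = x ->
  (\forall z \near x, opar i z = Some (e' z)) ->
  \forall z \near x, (\forall w \near z, opar i (move s w) = opar i w) -> s = mtrans 0.
Proof.
move=> iso Bx rs sx near_x.
have nB := isochart_near iso Bx.
have near_x' : \forall z \near move s x, opar i z = Some (e' z) /\ B z.
  by rewrite sx; exact: filterI.
apply: filterS2 (near_near (filterI near_x nB)) (near_near (near_move near_x')) => z h1 h2 h3.
apply: (@near_motion_eq _ _ _ _ z).
have [[_ Bz] [_ Bsz]] := (nbhs_singleton h1, nbhs_singleton h2).
apply: (isochart_germ_inj iso) => //; rewrite ?move_trans ?addr0//; try exact: move_cont.
apply: filterS3 h1 h2 h3 => w [E1 _] [E2 _] E3; rewrite move_trans addr0.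
by move: E3; rewrite E1 E2 => -[].
Qed.

(** At the tip, a symmetry near one nearby nonzero point is some [act_mx a] by [phi_germ], hence a
    symmetry of the whole ball. *)
Lemma opar_rigid i x s : U i x -> rigid s -> move s x = x ->
  (forall P : set 'rV[R]_n, nbhs x P ->
     exists2 z, P z & \forall w \near z, opar i (move s w) = opar i w) ->
  \forall w \near x, opar i (move s w) = opar i w.
Proof.
move=> Ux rs sx freq; have [[iN x0]|[B [e [iso Bx near_x]]]] := opar_chart Ux; last first.
  have [z /[apply] ->] := freq _ (opar_local_inj iso Bx rs sx near_x).
  by near=> w; rewrite move_trans addr0.
rewrite {}x0 in sx freq Ux *; rewrite {}iN in freq Ux *.
have s2 : s.2 = 0 by rewrite -(move0 s).
have sE w : move s w = w *m s.1 by rewrite /move s2 addr0.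
have [|z ze near_z] := freq [set z | enorm z < eps]; first by apply: near_enorm_lt; rewrite enorm0.
have [y y0 [near_y ye]] := exists_punctured (filterI (near_near near_z) (near_enorm_lt ze)).
have [|||a sa] := @phi_germ s.1 y => //.
- by rewrite enorm_gt0 y0.
- apply: filterS2 near_y (near_neq0 y0) => w /=; rewrite sE => + w0.
  by rewrite -!enorm_eq0 enorm_orthogonal// enorm_eq0 (negbTE w0) => -[].
near=> w; rewrite sE sa opar_act//.
by near: w; apply: near_enorm_lt; rewrite enorm0.
Unshelve. all: by end_near. Qed.

Lemma opar_regular i x s : U i x -> opar i x <> opar None 0 -> rigid s -> move s x = x ->
  (\forall w \near x, opar i (move s w) = opar i w) -> s.1 = 1%:M.
Proof.
rewrite opar0 => Ux; have [[-> ->]|[B [e [iso Bx near_x]]]] := opar_chart Ux.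
  by rewrite opar0.
move=> _ rs sx h.
by have /nbhs_singleton/(_ h) -> := opar_local_inj iso Bx rs sx near_x.
Qed.

Lemma opar_stab (A : 'M[R]_n) : orthogonal A ->
  (\forall z \near (0 : 'rV[R]_n), opar None (z *m A) = opar None z) ->
  A \in [seq act_mx a | a <- enum gT].
Proof.
move=> oA near0; have e0 : enorm (0 : 'rV[R]_n) < eps by rewrite enorm0.
have [y y0 [near_y ye]] := exists_punctured (filterI (near_near near0) (near_enorm_lt e0)).
have [|||a ->] := @phi_germ A y => //.
- by rewrite enorm_gt0 y0.
- apply: filterS2 near_y (near_neq0 y0) => w /= + w0.
  by rewrite -!enorm_eq0 enorm_orthogonal// enorm_eq0 (negbTE w0) => -[].
by apply: map_f; rewrite mem_enum.
Qed.

Lemma opar_nontrivial : exists2 A : 'M[R]_n, A != 1%:M &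
  orthogonal A /\ \forall z \near (0 : 'rV[R]_n), opar None (z *m A) = opar None z.
Proof.
have [a /eqP a1] := nontrivial_elt; exists (act_mx a).
  have [u u0 _] := @exists_punctured setT 0 filterT.
  by apply/eqP => E; apply: a1; apply: (act_free u0); rewrite actE// E mulmx1.
split; first exact: orthogonal_act.
have e0 : enorm (0 : 'rV[R]_n) < eps by rewrite enorm0.
by apply: filterS (near_enorm_lt e0) => z; exact: opar_act.
Qed.

Lemma opar_cover : exists cover : seq (option M), forall o, exists i x,
  [/\ i \in cover, enorm (x - ocenter i) < oradius i / 2 & opar i x = o].
Proof.
have he : 0 < eps / 2 < eps by rewrite divr_gt0//= ltr_pdivrMr// ltr_pMr// ltr1n.
pose H p := bdom p `&` bcoord p @^-1` eball (bcoord p p) (brad p / 2).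
have [|D cD] := compact_finite_cover (H := H) (compact_end he).
  move=> p; have [iso r0 dp] := ball_dataP p.
  have h1 : nbhs p (bdom p) by apply: open_nbhs_nbhs; split=> //; exact: iso_openl iso.
  have h2 : nbhs p (bcoord p @^-1` eball (bcoord p p) (brad p / 2)).
    by apply: (iso_contl iso dp); apply: near_eball; rewrite divr_gt0.
  exact: filterI h1 h2.
exists (None :: [seq Some p | p <- D]).
case=> [q|]; last first.
  by exists None, 0; rewrite /= subrr enorm0 mem_head eqxx divr_gt0.
have [[x /andP[x0 xe] <-]|/cD[p pD [dq qr]]] :=
  pselect ((phi @` [set x | 0 < enorm x < eps / 2]) q).
  exists None, x; rewrite mem_head/= subr0; split=> //.
  by rewrite enorm_gt0 in x0; rewrite (negbTE x0).
have [iso r0 _] := ball_dataP p.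
exists (Some p), (bcoord p q); split=> //=; last by rewrite (isoK iso).
by rewrite inE/=; apply: map_f.
Qed.

Lemma seq_pos_lower_bound (s : seq (option M)) : exists2 rho, 0 < rho &
  forall i, i \in s -> rho <= oradius i / 2.
Proof.
have pos i : 0 < oradius i / 2.
  by rewrite divr_gt0//; case: i => [p|//=]; have [] := ball_dataP p.
elim: s => [|i s [rho rho0 IH]]; first by exists 1.
exists (Num.min rho (oradius i / 2)); first by rewrite lt_min rho0 pos.
move=> j; rewrite inE => /predU1P[->|/IH h]; rewrite ge_min ?lexx ?orbT// h.
by [].
Qed.

Theorem no_cone_end : False.
Proof.
have [cover coverP] := opar_cover.
have [rho rho0 rho_r] := seq_pos_lower_bound (None :: cover).
apply: (no_single_cone_orbifold (I := option M) opar_compat opar_sep opar_rigid (i0 := None) _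
  opar_regular _ opar_stab opar_nontrivial rho0 rho_r coverP) => //.
by move=> x Ux; rewrite opar0 => /(opar_tip Ux)[].
Qed.

End PuncturedBall.

(** * Charts of the sphere *)

Section SmoothFamilies.
Context {R : realType}.

Lemma class_C_family (V W : normedModType R) (P : set (V -> W)) :
  (forall f, P f -> (forall x, differentiable f x) /\ forall v, P (fun x => 'D_v f x)) ->
  forall f, P f -> forall U, smooth_on U f.
Proof.
move=> h f Pf U r; elim: r f Pf => [|r IH] f Pf /=.
  by move=> x _; apply: differentiable_continuous; have [] := h f Pf.
by have [df Df] := h f Pf; split=> [x _|v]; [exact: df|exact: IH].
Qed.

Lemma differentiable_row (V : normedModType R) n (f : V -> 'rV[R]_n) x :
  (forall j, differentiable (fun y => f y 0 j) x) -> differentiable f x.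
Proof.
move=> df; have -> : f = \sum_(j < n) (fun y => f y 0 j *: (delta_mx 0 j : 'rV[R]_n)).
  by apply/funext => y; rewrite fct_sumE [LHS]row_sum_delta.
by apply: differentiable_sum => j; apply: differentiableZl; exact: df.
Qed.

Context {m : nat}.
Implicit Types f g : 'rV[R]_m -> R.

(* Closed under directional derivatives, hence made of smooth functions; the
   inverse stereographic projections belong to it. *)
Inductive ratfun : ('rV[R]_m -> R) -> Prop :=
| rat_cst a : ratfun (fun=> a)
| rat_coord i : ratfun (fun y => y 0 i)
| rat_inv : ratfun (fun y => (1 + dot y y)^-1)
| rat_add f g : ratfun f -> ratfun g -> ratfun (fun y => f y + g y)
| rat_mul f g : ratfun f -> ratfun g -> ratfun (fun y => f y * g y).

Lemma rat_ext f g : ratfun g -> f =1 g -> ratfun f.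
Proof. by move=> rg /funext ->. Qed.

Lemma rat_sum (I : Type) (r : seq I) (F : I -> 'rV[R]_m -> R) :
  (forall i, ratfun (F i)) -> ratfun (fun y => \sum_(i <- r) F i y).
Proof.
move=> rF; elim: r => [|i r IH].
  by under eq_fun do rewrite big_nil; exact: rat_cst.
by under eq_fun do rewrite big_cons; exact: rat_add.
Qed.

Lemma rat_dot : ratfun (fun y => dot y y).
Proof.
under eq_fun do rewrite dotE.
by apply: rat_sum => i; apply: rat_mul; exact: rat_coord.
Qed.

Lemma diff_coord (y : 'rV[R]_m) i :
  differentiable (fun y : 'rV[R]_m => y 0 i) y /\
  forall v : 'rV[R]_m, 'D_v (fun y : 'rV[R]_m => y 0 i) y = v 0 i.
Proof.
have d := @differentiable_coord _ _ _ y 0 i; split=> // v.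
have := congr1 (fun M : 'rV[R]_m => M 0 i) (@derive_mx R _ 1 m id y v (@derivable_id _ _ _ _)).
by rewrite derive_id mxE => <-.
Qed.

Lemma dot1_neq0 (y : 'rV[R]_m) : 1 + dot y y != 0.
Proof. by rewrite gt_eqF// ltr_pwDl// dot_ge0. Qed.

Lemma diff_dot (y : 'rV[R]_m) : differentiable (fun y : 'rV[R]_m => dot y y) y /\
  forall v, 'D_v (fun y : 'rV[R]_m => dot y y) y = \sum_i 2 * (v 0 i * y 0 i).
Proof.
have E : (fun y : 'rV[R]_m => dot y y) = \sum_(i < m) ((fun y : 'rV[R]_m => y 0 i) * (fun y => y 0 i)).
  by apply/funext => z; rewrite fct_sumE dotE.
have d i : differentiable ((fun y : 'rV[R]_m => y 0 i) * (fun y => y 0 i)) y.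
  by apply: differentiableM; exact: (diff_coord y i).1.
split; first by rewrite E; apply: differentiable_sum.
move=> v; rewrite E derive_sum; last by move=> i; exact: diff_derivable.
apply: eq_bigr => i _; have [di Di] := diff_coord y i.
rewrite deriveM; try exact: diff_derivable.
by rewrite !Di /GRing.scale /=; ring.
Qed.

Lemma ratfun_diff f : ratfun f -> (forall x, differentiable f x) /\
  forall v, ratfun (fun x => 'D_v f x).
Proof.
elim=> [a|i||{}f g rf [df Df] rg [dg Dg]|{}f g rf [df Df] rg [dg Dg]].
- split=> [x|v]; first exact: differentiable_cst.
  by apply: (rat_ext (rat_cst 0)) => x; rewrite derive_cst.
- split=> [x|v]; first exact: (diff_coord x i).1.
  by apply: (rat_ext (rat_cst (v 0 i))) => x; rewrite (diff_coord x i).2.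
- have d1 y : differentiable (fun y : 'rV[R]_m => 1 + dot y y) y.
    apply: (@differentiableD _ _ _ (fun=> 1 : R) (fun y : 'rV[R]_m => dot y y)) => //.
    exact: (diff_dot y).1.
  split=> [y|v]; first by apply: differentiableV => //; exact: dot1_neq0.
  have r1 : ratfun (fun y => \sum_i 2 * (v 0 i * y 0 i)).
    apply: rat_sum => i; apply: rat_mul; first exact: rat_cst.
    by apply: rat_mul; [exact: rat_cst|exact: rat_coord].
  have r2 := rat_mul (rat_cst (-1)) (rat_mul (rat_mul rat_inv rat_inv) r1).
  apply: (rat_ext r2) => y; rewrite deriveV; [|exact: dot1_neq0|exact: diff_derivable].
  rewrite (@deriveD _ _ _ (fun=> 1 : R) (fun y : 'rV[R]_m => dot y y)) ?derive_cst ?(diff_dot y).2 ?add0r//.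
    by rewrite /GRing.scale /= expr2 invfM mulN1r mulNr.
  by apply: diff_derivable; exact: (diff_dot y).1.
- split=> [x|v]; first exact: (@differentiableD _ _ _ f g).
  apply: (rat_ext (rat_add (Df v) (Dg v))) => x.
  by rewrite (@deriveD _ _ _ f g)//; exact: diff_derivable.
- split=> [x|v]; first exact: (@differentiableM _ _ f g).
  apply: (rat_ext (rat_add (rat_mul rf (Dg v)) (rat_mul rg (Df v)))) => x.
  by rewrite (@deriveM _ _ f g)//; exact: diff_derivable.
Qed.

Lemma smooth_ratfun_row n (f : 'rV[R]_m -> 'rV[R]_n) :
  (forall j, ratfun (fun y => f y 0 j)) -> (forall x, differentiable f x) /\ forall U, smooth_on U f.
Proof.
have main (h : 'rV[R]_m -> 'rV[R]_n) : (forall j, ratfun (fun y => h y 0 j)) ->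
    (forall x, differentiable h x) /\ forall v, forall j, ratfun (fun y => 'D_v h y 0 j).
  move=> rh; have dh x : differentiable h x.
    by apply: differentiable_row => j; exact: (ratfun_diff (rh j)).1.
  split=> // v j; apply: (rat_ext ((ratfun_diff (rh j)).2 v)) => y.
  by rewrite derive_mx ?mxE//; exact: diff_derivable.
move=> rf; split; first exact: (main f rf).1.
move=> U r; have := @class_C_family 'rV[R]_m 'rV[R]_n [set h | forall j, ratfun (fun y => h y 0 j)] main f rf U r.
exact.
Qed.

End SmoothFamilies.

(** * Stereographic projection *)

Section Stereographic.
Context {R : realType} {m : nat} (sg : R).
Hypothesis sg2 : sg ^+ 2 = 1.

(** Inverse projection from the pole whose first coordinate is [sg], with [sg] equal to 1 or -1. *)
Definition stereo (y : 'rV[R]_m) : 'rV[R]_m.+1 :=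
  \row_j ((if unlift ord0 j is Some i then 2 * y 0 i else sg * (dot y y - 1))
          * (1 + dot y y)^-1).

Definition unstereo (x : 'rV[R]_m.+1) : 'rV[R]_m :=
  \row_i (x 0 (lift ord0 i) * (1 - sg * x 0 ord0)^-1).

Lemma stereo_sphere y : dot (stereo y) (stereo y) = 1.
Proof.
rewrite dotE big_ord_recl !mxE unlift_none.
under eq_bigr do rewrite !mxE liftK.
set s := dot y y; have s1 : 1 + s != 0 by exact: dot1_neq0.
rewrite (eq_bigr (fun i => 4 * (1 + s)^-1 ^+ 2 * (y 0 i * y 0 i))); last first.
  by move=> i _; ring.
rewrite -mulr_sumr -dotE -/s.
have -> : sg * (s - 1) * (1 + s)^-1 * (sg * (s - 1) * (1 + s)^-1) =
    sg ^+ 2 * ((s - 1) ^+ 2 / (1 + s) ^+ 2) by field.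
by rewrite sg2; field.
Qed.

Lemma stereoK : cancel stereo unstereo.
Proof.
move=> y; apply/rowP => i; rewrite !mxE liftK unlift_none.
set s := dot y y; have s1 : 1 + s != 0 by exact: dot1_neq0.
have -> : 1 - sg * (sg * (s - 1) * (1 + s)^-1) = 1 - sg ^+ 2 * ((s - 1) * (1 + s)^-1) by ring.
rewrite sg2 mul1r (_ : 1 - _ = 2 / (1 + s)); last by field.
by field.
Qed.

Lemma unstereoK x : dot x x = 1 -> 1 - sg * x 0 ord0 != 0 -> stereo (unstereo x) = x.
Proof.
move=> x1; set x0 := x 0 ord0; set d := 1 - sg * x0 => d0.
have sE : dot (unstereo x) (unstereo x) = (1 - x0 ^+ 2) / d ^+ 2.
  rewrite dotE; under eq_bigr do rewrite !mxE -/x0 -/d.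
  rewrite (eq_bigr (fun i => d^-1 ^+ 2 * (x 0 (lift ord0 i) * x 0 (lift ord0 i)))); last first.
    by move=> i _; ring.
  rewrite -mulr_sumr; move: x1; rewrite dotE big_ord_recl -/x0 => <-.
  by rewrite -expr2; field.
have dE : d ^+ 2 = 1 - 2 * (sg * x0) + x0 ^+ 2.
  by rewrite /d sqrrB expr1n mul1r exprMn sg2 mul1r mulr_natl.
have sE1 : 1 + dot (unstereo x) (unstereo x) = 2 / d.
  rewrite sE; have -> : 1 - x0 ^+ 2 = 2 * d - d ^+ 2 by rewrite dE /d; ring.
  by field.
apply/rowP => j; rewrite mxE sE1; case: unliftP => [i ->|->].
  by rewrite mxE -/x0 -/d; field.
rewrite (_ : dot _ _ - 1 = 2 / d - 2); last by rewrite -sE1; ring.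
have -> : sg * (2 / d - 2) * (2 / d)^-1 = sg * (1 - d) by field.
by rewrite /d opprB addrC subrK mulrA -expr2 sg2 mul1r.
Qed.

Lemma stereo_smooth : (forall y, differentiable stereo y) /\ forall U, smooth_on U stereo.
Proof.
apply: smooth_ratfun_row => j.
case E : (unlift ord0 j) => [i|].
  apply: (rat_ext (rat_mul (rat_mul (rat_cst 2) (rat_coord i)) rat_inv)) => y.
  by rewrite mxE E.
apply: (rat_ext (rat_mul (rat_mul (rat_cst sg) (rat_add rat_dot (rat_cst (-1)))) rat_inv)) => y.
by rewrite mxE E.
Qed.

Lemma unstereo_diff (x : 'rV[R]_m.+1) : 1 - sg * x 0 ord0 != 0 -> differentiable unstereo x.
Proof.
move=> d0; apply: differentiable_row => i.
rewrite (_ : (fun _ => _) = (fun x : 'rV[R]_m.+1 => x 0 (lift ord0 i)) *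
   (fun x : 'rV[R]_m.+1 => (1 - sg * x 0 ord0)^-1)); last first.
  by apply/funext => z; rewrite mxE.
apply: differentiableM; first exact: differentiable_coord.
apply: (@differentiableV _ _ (fun x : 'rV[R]_m.+1 => 1 - sg * x 0 ord0)) => //.
apply: (@differentiableB _ _ _ (fun=> 1 : R) (fun x : 'rV[R]_m.+1 => sg * x 0 ord0)) => //.
by apply: (@differentiableZ _ _ _ (fun x : 'rV[R]_m.+1 => x 0 ord0)); exact: differentiable_coord.
Qed.

End Stereographic.

Section SphereCharts.
Context {R : realType}.

Lemma sphereP n (u : sphere R n) : dot (val u) (val u) = 1.
Proof. by have := set_valP u. Qed.

Definition mk_sphere n (x : 'rV[R]_n) (x1 : dot x x = 1) : sphere R n :=
  exist _ x (mem_set x1).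

Lemma nbhs_sphere n (u : sphere R n) (P : set (sphere R n)) :
  nbhs u P <-> exists2 Q : set 'rV[R]_n, nbhs (val u) Q & forall v : sphere R n, Q (val v) -> P v.
Proof.
split=> [[_ [[W oW <-] Wu WP]]|[Q Qu QP]].
  by exists W; [exact: open_nbhs_nbhs|move=> v Wv; exact: WP].
have c := @initial_continuous (sphere R n) _ set_val u.
by apply: filterS (c Q Qu : nbhs u (set_val @^-1` Q)) => v /QP.
Qed.

Lemma continuous_into_sphere n (T : topologicalType) (f : T -> sphere R n) x :
  {for x, continuous (fun y => val (f y))} -> {for x, continuous f}.
Proof.
move=> cf P /nbhs_sphere[Q Qx QP].
by apply: filterS (cf Q Qx : nbhs x [set y | Q (val (f y))]) => y /QP.
Qed.

Lemma continuous_val_sphere n : continuous (fun u : sphere R n => val u : 'rV[R]_n).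
Proof. exact: initial_continuous. Qed.

(** Charts inside any given neighbourhood are needed because charts of the quotient must project
    injectively. *)
Lemma sphere_chart_at n (u : sphere R n) (W : set (sphere R n)) : (0 < n)%N ->
  nbhs u W -> exists (c : sphere_chart R n) y,
  [/\ sdom c y, spar c y = u & forall z, sdom c z -> W (spar c z)].
Proof.
case: n u W => // m u W _ /nbhs_interior Wu.
(* The pole is chosen different from [u]. *)
have [sg sg2 sgu] : exists2 sg : R, sg ^+ 2 = 1 & 1 - sg * val u 0 ord0 != 0.
  have [u0|u0] := eqVneq (val u 0 ord0) 1; last first.
    by exists 1; rewrite ?expr1n// mul1r subr_eq0 eq_sym.
  by exists (-1); rewrite ?sqrrN ?expr1n// u0 mulN1r opprK (_ : 1 + 1 = 2).
pose s (y : 'rV[R]_m) := mk_sphere (stereo_sphere sg2 y).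
have [ds ss] := stereo_smooth (m := m) sg.
have cs y : {for y, continuous s}.
  apply: continuous_into_sphere; apply: differentiable_continuous; exact: ds.
pose V := s @^-1` W^°.
have den (y : 'rV[R]_m) : 1 - sg * stereo sg y 0 ord0 != 0.
  rewrite mxE unlift_none; have s1 := dot1_neq0 y.
  have -> : 1 - sg * (sg * (dot y y - 1) * (1 + dot y y)^-1) =
    1 - sg ^+ 2 * ((dot y y - 1) / (1 + dot y y)) by ring.
  rewrite sg2 (_ : _ - _ = 2 / (1 + dot y y)); last by field.
  by rewrite mulf_neq0 ?invr_eq0.
have vs y : val (s y) = stereo sg y by [].
have us (v : sphere R m.+1) : 1 - sg * val v 0 ord0 != 0 -> s (unstereo sg (val v)) = v.
  by move=> dv; apply: val_inj; rewrite vs unstereoK// sphereP.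
have pV : parametrization V s.
  split.
  - rewrite openE => y Vy; apply: (cs y (W^°)).
    by apply: open_nbhs_nbhs; split=> //; exact: open_interior.
  - by move=> x y _ _ /(congr1 val); rewrite !vs => /(congr1 (unstereo sg)); rewrite !stereoK.
  - by move=> x _; exact: cs.
  - move=> U oU _; rewrite openE => _ [y Uy <-]; apply/nbhs_sphere.
    have du := @unstereo_diff R m sg (val (s y)) (den y).
    have h1 : nbhs (val (s y)) [set z : 'rV[R]_m.+1 | U (unstereo sg z)].
      apply: (differentiable_continuous du); rewrite vs stereoK//.
      exact: open_nbhs_nbhs.
    have h2 : nbhs (val (s y)) [set z : 'rV[R]_m.+1 | 1 - sg * z 0 ord0 != 0].
      have c : {for val (s y), continuous (fun z : 'rV[R]_m.+1 => 1 - sg * z 0 ord0)}.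
        apply: differentiable_continuous.
        apply: (@differentiableB _ _ _ (fun=> 1 : R) (fun x : 'rV[R]_m.+1 => sg * x 0 ord0)) => //.
        by apply: (@differentiableZ _ _ _ (fun x : 'rV[R]_m.+1 => x 0 ord0)); exact: differentiable_coord.
      have o : open [set a : R | a != 0] by exact: open_neq.
      by apply: (c [set a | a != 0]); apply: open_nbhs_nbhs; split=> //; exact: den.
    eexists; first exact: (filterI h1 h2).
    by move=> v [Uv dv]; exists (unstereo sg (val v)) => //; exact: us.
have imm y : V y -> row_free ('J (fun y => val (s y)) y).
  move=> _; apply/row_freeP; exists ('J (unstereo sg) (stereo sg y)).
  have du := @unstereo_diff R m sg _ (den y).
  rewrite -(jacobian_comp (ds y) du).
  have -> : unstereo sg \o stereo sg = (fun z : 'rV[R]_m => z) by apply: funext => z; rewrite /= stereoK.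
  apply: mx_ext => v; rewrite /jacobian mul_rV_lin1 mulmx1.
  rewrite (_ : 'd (fun z : 'rV[R]_m => z) y = id :> ('rV[R]_m -> 'rV[R]_m)) //.
  exact: (diff_val (is_diff_def := is_diff_id y)).
exists (@SphereChart R m.+1 V s pV (ss V) imm), (unstereo sg (val u)); split=> /=.
- by rewrite /V /preimage /= us//; exact: nbhs_singleton Wu.
- exact: us.
- by move=> z /interior_subset.
Qed.

End SphereCharts.

(** * Polar coordinates on the cone *)

Section ConeDerivative.
Context {R : realType} {m n : nat}.
Variable (sigma : 'rV[R]_m -> 'rV[R]_n).

(** Differentiate [dot (sigma z) (sigma z) = 1]. *)
Lemma jacobian_unit_orthogonal y : (forall z, dot (sigma z) (sigma z) = 1) ->
  differentiable sigma y -> sigma y *m ('J sigma y)^T = 0.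
Proof.
move=> s1 ds; apply/rowP => k; rewrite [RHS]mxE.
have [dd Dd] := diff_dot (sigma y).
pose f := (fun w : 'rV[R]_n => dot w w) \o sigma.
have df : differentiable f y by exact: differentiable_comp.
have : 'D_(delta_mx 0 k) f y = 0.
  by rewrite (_ : f = fun=> 1) ?derive_cst//; apply: funext => z; exact: s1.
rewrite deriveE// /f diff_comp//= -deriveE// Dd.
have -> : 'd sigma y (delta_mx 0 k) = row k ('J sigma y).
  by rewrite rowE /jacobian mul_rV_lin1.
rewrite -mulr_sumr => /eqP; rewrite mulf_eq0 pnatr_eq0/= => /eqP h.
by rewrite mxE -[RHS]h; apply: eq_bigr => i _; rewrite !mxE mulrC.
Qed.

Definition radius (v : 'rV[R]_(1 + m)) : R := lsubmx v 0 0.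
(** Polar coordinates; the sign is there because the radial coordinate of the cone is negative. *)
Definition cone_point (v : 'rV[R]_(1 + m)) : 'rV[R]_n := - radius v *: sigma (rsubmx v).

Lemma diff_radius (v : 'rV[R]_(1 + m)) : differentiable radius v /\
  forall h : 'rV[R]_(1 + m), 'D_h radius v = radius h.
Proof.
have -> : radius = fun w : 'rV[R]_(1 + m) => w 0 (lshift m 0).
  by apply: funext => w; rewrite /radius mxE.
exact: diff_coord.
Qed.

Lemma diff_rsubmx (v : 'rV[R]_(1 + m)) :
  differentiable (fun w : 'rV[R]_(1 + m) => rsubmx w) v /\
  forall h : 'rV[R]_(1 + m), 'D_h (fun w : 'rV[R]_(1 + m) => rsubmx w) v = rsubmx h.
Proof.
have E j : (fun w : 'rV[R]_(1 + m) => rsubmx w 0 j) = fun w : 'rV[R]_(1 + m) => w 0 (rshift 1 j).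
  by apply: funext => w; rewrite mxE.
have d : differentiable (fun w : 'rV[R]_(1 + m) => rsubmx w) v.
  by apply: differentiable_row => j; rewrite E; exact: (diff_coord v _).1.
split=> // h; rewrite derive_mx; last exact: diff_derivable.
by apply/rowP => j; rewrite !mxE E (diff_coord v _).2.
Qed.

Lemma cone_point_diff (v : 'rV[R]_(1 + m)) : differentiable sigma (rsubmx v) ->
  differentiable cone_point v /\
  'J cone_point v = col_mx (- sigma (rsubmx v)) (- radius v *: 'J sigma (rsubmx v)).
Proof.
move=> ds; have [dr Dr] := diff_radius v; have [dq Dq] := diff_rsubmx v.
pose tau (w : 'rV[R]_(1 + m)) : 'rV[R]_n := sigma (rsubmx w).
have dt : differentiable tau v by exact: (@differentiable_comp _ _ _ _ (fun w : 'rV[R]_(1 + m) => rsubmx w)).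
have Dt h : 'D_h tau v = rsubmx h *m 'J sigma (rsubmx v).
  pose q (w : 'rV[R]_(1 + m)) := rsubmx w.
  have Jq : h *m 'J q v = rsubmx h by rewrite -Dq deriveE// /jacobian mul_rV_lin1.
  rewrite -Jq -mulmxA -(jacobian_comp (f := q) dq ds) deriveE//.
  by rewrite /jacobian mul_rV_lin1.
have dtj j : differentiable (fun w => tau w 0 j) v.
  exact: (differentiable_comp dt (differentiable_coord _ _ _)).
have Dtj h j : 'D_h (fun w => tau w 0 j) v = 'D_h tau v 0 j.
  by rewrite derive_mx ?mxE//; exact: diff_derivable.
have E j : (fun w => cone_point w 0 j) = (- radius) * (fun w => tau w 0 j).
  by apply: funext => w; rewrite /cone_point mxE.
have dN : differentiable (- radius) v by exact: differentiableN.
have dc : differentiable cone_point v.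
  by apply: differentiable_row => j; rewrite E; exact: differentiableM.
split=> //; apply: mx_ext => h.
have -> : h *m 'J cone_point v = 'D_h cone_point v.
  by rewrite deriveE// /jacobian mul_rV_lin1.
rewrite derive_mx; last exact: diff_derivable.
rewrite -{2}(hsubmxK h) mul_row_col -scalemxAr; apply/rowP => j; rewrite [LHS]mxE E.
rewrite deriveM; [|exact: diff_derivable|exact: diff_derivable].
rewrite deriveN; last exact: diff_derivable.
rewrite Dr Dtj Dt [RHS]mxE [X in _ = X + _]mxE big_ord1 [X in _ = _ + X]mxE.
rewrite [X in _ = _ * X + _]mxE [(- radius) v]/(- (radius v)) /GRing.scale /= /tau /radius.
by rewrite addrC mulrN mulrN [in LHS](mulrC (sigma _ _ _)).
Qed.

(** The Euclidean metric in polar coordinates is the cone metric over the sphere; the mixed terms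
    vanish by [jacobian_unit_orthogonal]. *)
Lemma cone_point_gram (v : 'rV[R]_(1 + m)) : (forall z, dot (sigma z) (sigma z) = 1) ->
  differentiable sigma (rsubmx v) ->
  'J cone_point v *m ('J cone_point v)^T = block_mx 1%:M 0 0
    (radius v ^+ 2 *: ('J sigma (rsubmx v) *m ('J sigma (rsubmx v))^T)).
Proof.
move=> s1 ds; have so := jacobian_unit_orthogonal s1 ds.
have so' : 'J sigma (rsubmx v) *m (sigma (rsubmx v))^T = 0.
  by rewrite -[LHS]trmxK trmx_mul trmxK so trmx0.
rewrite (cone_point_diff ds).2 tr_col_mx mul_col_row.
have tN p q (X : 'M[R]_(p, q)) : (- X)^T = - X^T by apply/matrixP => i j; rewrite !mxE.
have tZ p q a (X : 'M[R]_(p, q)) : (a *: X)^T = a *: X^T by apply/matrixP => i j; rewrite !mxE.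
rewrite !(tN, tZ) !mulNmx !mulmxN -!scalemxAl -!scalemxAr so so' !scaler0 !oppr0.
congr block_mx; rewrite ?opprK ?scalerA//.
  by apply/matrixP => i j; rewrite (ord1 i) (ord1 j) -[LHS]/(dot _ _) s1 mxE eqxx.
by rewrite mulNr mulrN opprK -expr2.
Qed.

End ConeDerivative.

(** * The quotient of the sphere *)

Section Orbits.
Context {R : realType} {n : nat} {gT : finGroupType} (to : {action gT &-> sphere R n}).
Hypothesis to_cont : forall a, continuous (fun u => to u a).
Hypothesis to_free : forall (u : sphere R n) (a : gT), to u a = u -> a = 1%g.
Local Notation pi := (orbit_proj to).

Lemma action_id (u : sphere R n) : to u 1%g = u.
Proof.
have [inj_to toM] : is_action (setTfor gT) to by case: (to).
by apply: (inj_to 1%g); rewrite -toM ?inE// mulg1.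
Qed.

Lemma orbit_projP (u v : sphere R n) : pi u = pi v <-> exists a, to u a = v.
Proof.
rewrite /orbit_proj; split.
  by move=> /eqquotP/asboolP.
by move=> h; apply/eqquotP/asboolP.
Qed.

Lemma orbit_proj_surj (q : orbit_space to) : exists u, pi u = q.
Proof. by exists (generic_quotient.repr q); exact: generic_quotient.reprK. Qed.

Lemma continuous_orbit_proj : continuous pi.
Proof. exact: pi_continuous. Qed.

Lemma open_orbit_proj (U : set (sphere R n)) : open U -> open (pi @` U).
Proof.
move=> oU; rewrite /open /= /quotient_open.
have -> : pi @^-1` (pi @` U) = \bigcup_(a : gT) ((fun u => to u a) @^-1` U).
  apply/seteqP; split=> [u [v Uv /esym/orbit_projP[a av]]|u [a _ Ua]].
    by exists a => //=; rewrite av.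
  by exists (to u a) => //; apply/esym/orbit_projP; exists a.
apply: bigcup_open => a _; apply: open_comp => // u _; exact: to_cont.
Qed.

(** Each nontrivial [a] moves [u] by [2 d a], so points within [d a] of [u] cannot be exchanged by
    [a] when their images stay within [d a] of the image of [u]. *)
Lemma orbit_proj_local_inj (u : sphere R n) :
  exists2 W, nbhs u W & forall v w, W v -> W w -> pi v = pi w -> v = w.
Proof.
pose d a := enorm (val u - val (to u a)) / 2.
exists [set v | forall a : gT, a != 1%g ->
    enorm (val v - val u) < d a /\ enorm (val (to v a) - val (to u a)) < d a].
  apply: (@filter_forall _ gT (fun a => [set v : sphere R n | a != 1%g ->
    enorm (val v - val u) < d a /\ enorm (val (to v a) - val (to u a)) < d a]) (nbhs u)) => a.
  have [->|a1] := eqVneq a 1%g; first exact: filterE.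
  have d0 : 0 < d a.
    rewrite divr_gt0// enorm_gt0 subr_eq0; apply: contraNneq a1 => E.
    by apply/eqP; apply: (to_free (u := u)); apply: val_inj.
  have h1 : nbhs u [set v : sphere R n | enorm (val v - val u) < d a].
    by apply: (continuous_val_sphere (near_eball (val u) d0)).
  have h2 : nbhs u [set v : sphere R n | enorm (val (to v a) - val (to u a)) < d a].
    by apply: (to_cont (continuous_val_sphere (near_eball (val (to u a)) d0))).
  by apply: filterS2 h1 h2 => v.
move=> v w Wv Ww /orbit_projP[a av].
have [a1|a1] := eqVneq a 1%g; first by rewrite -av a1 action_id.
have [h1 h2] := Wv a a1; have [h3 h4] := Ww a a1.
exfalso; have tri : enorm (val u - val (to u a)) <=
    enorm (val w - val u) + enorm (val w - val (to u a)).
  by rewrite (enormB (val w)); exact: enorm_triangle.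
move: tri h3 h2; rewrite av /d.
by move: (enorm _) (enorm _) (enorm _) => A B C; lra.
Qed.

End Orbits.

(** * Flat coordinates on the end of the manifold *)

Section ConeChart.
Context {R : realType} {n : nat} (n0 : (0 < n)%N).
Context {gT : finGroupType} (to : {action gT &-> sphere R n}).
Hypothesis to_cont : forall a, continuous (fun u => to u a).
Hypothesis to_free : forall (u : sphere R n) (a : gT), to u a = u -> a = 1%g.
Local Notation pi := (orbit_proj to).
Implicit Types (x y z : 'rV[R]_n).

Lemma enorm_sphere (u : sphere R n) : enorm (val u) = 1.
Proof. by rewrite /enorm sphereP sqrtr1. Qed.

Definition north : sphere R n.
Proof.
apply: (@mk_sphere R n (delta_mx 0 (Ordinal n0))).
by rewrite /dot trmx_delta mul_delta_mx mxE !eqxx.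
Defined.

Lemma dot_direction x : x != 0 -> dot ((enorm x)^-1 *: x) ((enorm x)^-1 *: x) = 1.
Proof.
move=> x0; have e0 : enorm x != 0 by rewrite enorm_eq0.
by rewrite dotZl dotZr -sqr_enorm; field.
Qed.

Definition direction x : sphere R n :=
  if eqVneq x 0 is NeqNotEq x0 then mk_sphere (dot_direction x0) else north.

Lemma val_direction x : x != 0 -> val (direction x) = (enorm x)^-1 *: x.
Proof. by rewrite /direction; case: eqVneq. Qed.

Lemma directionK x : x != 0 -> enorm x *: val (direction x) = x.
Proof. by move=> x0; rewrite val_direction// scalerA mulfV ?scale1r// enorm_eq0. Qed.

Lemma direction_polar (t : R) (u : sphere R n) : 0 < t ->
  [/\ t *: val u != 0, enorm (t *: val u) = t & direction (t *: val u) = u].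
Proof.
move=> t0; have et : enorm (t *: val u) = t by rewrite enormZ enorm_sphere gtr0_norm// mulr1.
have nz : t *: val u != 0 by rewrite -enorm_gt0 et.
split=> //; apply: val_inj; rewrite val_direction// et scalerA mulVf ?scale1r//.
exact: lt0r_neq0.
Qed.

Lemma continuous_direction x : x != 0 -> {for x, continuous direction}.
Proof.
move=> x0; apply: continuous_into_sphere.
have h : {for x, continuous (fun z : 'rV[R]_n => (enorm z)^-1 *: z)}.
  apply: (@cvgZ _ _ _ _ (nbhs_filter x)); last exact: cvg_id.
  by apply: (@cvgV _ _ _ (nbhs_filter x)); [rewrite enorm_eq0|exact: continuous_enorm].
move=> P Px; have {}Px : nbhs ((enorm x)^-1 *: x) P by rewrite -val_direction.
by apply: filterS2 (near_neq0 x0) (h P Px) => z z0 /=; rewrite val_direction.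
Qed.

(** The extension of the action on the sphere that is homogeneous of degree 1. *)
Definition polar_act a x : 'rV[R]_n := enorm x *: val (to (direction x) a).

Lemma polar_act_polar a x : x != 0 ->
  enorm (polar_act a x) = enorm x /\ direction (polar_act a x) = to (direction x) a.
Proof.
by rewrite -enorm_gt0 => /(direction_polar (to (direction x) a))[].
Qed.

Lemma polar_act_scale a (t : R) x : 0 < t -> x != 0 -> polar_act a (t *: x) = t *: polar_act a x.
Proof.
move=> t0 x0; have tx : t *: x = (t * enorm x) *: val (direction x).
  by rewrite -scalerA directionK.
have e0 : 0 < t * enorm x by rewrite mulr_gt0// enorm_gt0.
have [_ E D] := direction_polar (direction x) e0.
by rewrite /polar_act tx E D scalerA.
Qed.

Lemma continuous_polar_act a x : x != 0 -> {for x, continuous (polar_act a)}.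
Proof.
move=> x0; apply: (@cvgZ _ _ _ _ (nbhs_filter x)); first exact: continuous_enorm.
have c1 : {for x, continuous (fun z => to (direction z) a)}.
  by move=> P /to_cont; exact: continuous_direction.
exact: (continuous_comp c1 (@continuous_val_sphere R n _)).
Qed.

Lemma polar_act_free a x : x != 0 -> polar_act a x = x -> a = 1%g.
Proof.
move=> x0 E; have [_ D] := polar_act_polar a x0.
by apply: (to_free (u := direction x)); rewrite -D E.
Qed.

Lemma polar_orbit x y : x != 0 -> y != 0 -> enorm x = enorm y ->
  pi (direction x) = pi (direction y) <-> exists a, polar_act a x = y.
Proof.
move=> x0 y0 xy; split=> [/orbit_projP[a E]|[a <-]].
  by exists a; rewrite /polar_act E xy directionK.
by apply/orbit_projP; exists a; have [] := polar_act_polar a x0.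
Qed.

Context {M : topologicalType} (g : metric_atlas R n M).
Hypothesis par_g : forall i : cindex g, parametrization (cdom i) (cpar i).
Hypothesis cover_g : forall p : M, exists i : cindex g, (cpar i @` cdom i) p.
Local Notation N := (orbit_metric to (round_metric R n)).
Variables (K : set M) (eps : R) (Phi : M -> R * orbit_space to) (Phi' : R * orbit_space to -> M).
Local Notation strip := [set q : R * orbit_space to | - eps < q.1 < 0].
Hypothesis eps0 : 0 < eps.
Hypothesis open_end : open (~` K).
Hypothesis smooth_Phi : smooth_map g (cone N) (~` K) Phi.
Hypothesis Phi_fun : forall p, ~ K p -> strip (Phi p).
Hypothesis cont_Phi' : forall q, strip q -> {for q, continuous Phi'}.
Hypothesis Phi'_fun : forall q, strip q -> ~ K (Phi' q).
Hypothesis PhiK : forall p, ~ K p -> Phi' (Phi p) = p.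
Hypothesis Phi'K : forall q, strip q -> Phi (Phi' q) = q.
Hypothesis pull_Phi : is_pullback g (cone N) (~` K) Phi.

Definition cone_param x : M := Phi' (- enorm x, pi (direction x)).

Lemma cone_strip x : 0 < enorm x < eps -> strip (- enorm x, pi (direction x)).
Proof. by move=> /andP[h1 h2] /=; rewrite ltrN2 h2 oppr_lt0. Qed.

Lemma cone_param_orbit x y : 0 < enorm x < eps -> 0 < enorm y < eps ->
  cone_param x = cone_param y <-> exists a, polar_act a x = y.
Proof.
move=> xe ye; have [x0 y0] : x != 0 /\ y != 0.
  by move: xe ye; rewrite !enorm_gt0 => /andP[? _] /andP[].
split=> [/(congr1 Phi)|[a axy]].
  rewrite /cone_param !Phi'K; try exact: cone_strip.
  by case=> /oppr_inj exy; rewrite polar_orbit.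
have exy : enorm x = enorm y by rewrite -axy; have [] := polar_act_polar a x0.
rewrite /cone_param exy; congr (Phi' (_, _)).
by rewrite polar_orbit//; exists a.
Qed.

Lemma continuous_cone_param x : 0 < enorm x < eps -> {for x, continuous cone_param}.
Proof.
move=> xe; have x0 : x != 0 by case/andP: xe; rewrite enorm_gt0.
have c : {for x, continuous (fun z : 'rV[R]_n => (- enorm z, pi (direction z)))}.
  move=> P [[P1 P2] /= [h1 h2] sub].
  have h1' : nbhs x [set z : 'rV[R]_n | P1 (- enorm z)].
    by apply: (@cvgN _ _ _ _ (nbhs_filter x) _ _ (@continuous_enorm R n x)).
  have h2' : nbhs x [set z : 'rV[R]_n | P2 (pi (direction z))].
    exact: (continuous_direction x0 (continuous_orbit_proj h2)).
  by apply: filterS2 h1' h2' => z a b; apply: sub.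
by move=> P /(cont_Phi' (cone_strip xe)); exact: c.
Qed.

Lemma cone_param_image d : 0 < d < eps ->
  cone_param @` [set x | 0 < enorm x < d] = [set p | ~ K p /\ - d < (Phi p).1].
Proof.
move=> /andP[d0 de]; apply/seteqP; split=> [_ [x /andP[x0 xd] <-]|p [Kp pd]].
  have xe : 0 < enorm x < eps by rewrite x0 (lt_trans xd).
  split; first exact: Phi'_fun (cone_strip xe).
  by rewrite /cone_param Phi'K ?ltrN2//; exact: cone_strip.
have [p1 p2] : - eps < (Phi p).1 /\ (Phi p).1 < 0 by apply/andP; exact: Phi_fun Kp.
have [u pu] := orbit_proj_surj (Phi p).2.
have r0 : 0 < - (Phi p).1 by rewrite oppr_gt0.
have [nz E D] := direction_polar u r0.
exists (- (Phi p).1 *: val u); first by rewrite /= E r0 ltrNl.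
by rewrite /cone_param E D pu opprK -[RHS]PhiK// [in RHS](surjective_pairing (Phi p)).
Qed.

(** Locally, [Phi] read in a chart of the cone and followed by polar coordinates is a coordinate
    system inverse to [cone_param]. It is isometric by [cone_point_gram] and the pullback condition
    on [Phi]. *)
Lemma cone_param_chart x : 0 < enorm x < eps ->
  exists B, [/\ B x & exists A e, isocoord g A B e cone_param].
Proof.
move=> xe; have x0 : x != 0 by case/andP: xe; rewrite enorm_gt0.
(* The sphere chart is taken so small that it descends to the quotient. *)
have [W nW injW] := orbit_proj_local_inj to_cont to_free (direction x).
have [c [y0 [cy0 cdir cW]]] := sphere_chart_at n0 nW.
have pc := spar_parametrization c.
have injc : {in sdom c &, injective (pi \o spar c)}.
  move=> y z; rewrite !inE => cy cz /(injW _ _ (cW _ cy) (cW _ cz)).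
  by case: pc => _ inj _ _; apply: inj; rewrite inE.
pose j : cindex (cone N) := exist _ c injc.
have cparE v : cpar (m := cone N) j v = (radius v, pi (spar c (rsubmx v))) by [].
have cdomE v : cdom (m := cone N) j v = (radius v < 0 /\ sdom c (rsubmx v)) by [].
pose inv := 'pinv_(fun=> 0) (cdom (m := cone N) j) (cpar (m := cone N) j).
have invK v : cdom (m := cone N) j v -> inv (cpar (m := cone N) j v) = v.
  move=> jv; apply: pinvKV; last by rewrite inE.
  move=> v1 v2; rewrite !inE !cparE => -[_ d1] [_ d2] [r12 /injc s12].
  rewrite -(hsubmxK v1) -(hsubmxK v2) s12 ?inE//; congr row_mx.
  by apply/matrixP => a b; rewrite (ord1 a) (ord1 b).
pose sigma (y : 'rV[R]_n.-1) : 'rV[R]_n := val (spar c y).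
have sigma1 (y : 'rV[R]_n.-1) : dot (sigma y) (sigma y) = 1 by exact: sphereP.
pose P := cone_point sigma.
have dsigma (y : 'rV[R]_n.-1) : sdom c y -> differentiable sigma y.
  by have [d _] := spar_smooth c 1%N; exact: d.
pose e p := P (inv (Phi p)).
pose A : set M := [set p | ~ K p /\ (cpar (m := cone N) j @` cdom (m := cone N) j) (Phi p)].
pose B : set 'rV[R]_n := [set z | 0 < enorm z < eps /\ (spar c @` sdom c) (direction z)].
have Pv v : cdom (m := cone N) j v ->
    [/\ P v != 0, enorm (P v) = - radius v & direction (P v) = spar c (rsubmx v)].
  by move=> [r0 _]; apply: direction_polar; rewrite oppr_gt0.
have AB v p : ~ K p -> cdom (m := cone N) j v -> Phi p = cpar (m := cone N) j v ->
    [/\ e p = P v, B (P v) & cone_param (P v) = p].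
  move=> Kp jv pv; have [nz E D] := Pv _ jv.
  have /andP[r1 r2] := Phi_fun Kp; move: r1; rewrite pv cparE/= => r1.
  split; first by rewrite /e pv invK.
    split; first by rewrite /= enorm_gt0 nz E ltrNl.
    by rewrite /= D; exists (rsubmx v) => //; case: jv.
  by rewrite /cone_param E D opprK -[RHS]PhiK// pv.
have BA z : B z -> exists v, [/\ cdom (m := cone N) j v, ~ K (cone_param z),
    Phi (cone_param z) = cpar (m := cone N) j v & P v = z].
  move=> [ze [y cy yz]]; have z0 : z != 0 by case/andP: ze; rewrite enorm_gt0.
  exists (row_mx (- enorm z)%:M y).
  have rE : radius (row_mx (- enorm z)%:M y) = - enorm z.
    by rewrite /radius row_mxKl mxE eqxx mulr1n.
  split.
  - by rewrite cdomE rE row_mxKr oppr_lt0; case/andP: ze.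
  - exact: Phi'_fun (cone_strip ze).
  - by rewrite cparE rE row_mxKr yz /cone_param Phi'K//; exact: cone_strip.
  - by rewrite /P /cone_point rE row_mxKr opprK /sigma yz directionK.
have oimg : open (cpar (m := cone N) j @` cdom (m := cone N) j).
  have os : open (spar c @` sdom c) by case: pc => od _ _; apply.
  rewrite openE => _ [v [r0 cv] <-]; rewrite cparE.
  have no : nbhs (pi (spar c (rsubmx v)) : orbit_space to) (pi @` (spar c @` sdom c)).
    apply: open_nbhs_nbhs; split; first exact: (open_orbit_proj to_cont).
    by exists (spar c (rsubmx v)) => //; exists (rsubmx v).
  exists ([set r : R | r < 0], pi @` (spar c @` sdom c)) => /=.
    split; first by apply: open_nbhs_nbhs; split=> //; exact: open_lt.
    exact: no.
  move=> [r q] /= [rlt [_ [y cy <-] <-]].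
  have rE : radius (row_mx r%:M y) = r by rewrite /radius row_mxKl mxE eqxx mulr1n.
  by exists (row_mx r%:M y); rewrite -/(radius _) rE row_mxKr.
have oA : open A.
  rewrite openE => p [Kp pj].
  have h1 : nbhs p (~` K) by apply: open_nbhs_nbhs.
  have h2 : nbhs p (Phi @^-1` (cpar (m := cone N) j @` cdom (m := cone N) j)).
    by apply: (smooth_Phi.1 _ Kp); apply: open_nbhs_nbhs.
  exact: filterI h1 h2.
have oB : open B.
  rewrite openE => z [ze zc].
  have z0 : z != 0 by case/andP: ze; rewrite enorm_gt0.
  have os : open (spar c @` sdom c) by case: pc => od _ _; apply.
  have h2 : nbhs z (direction @^-1` (spar c @` sdom c)).
    by apply: (continuous_direction z0); apply: open_nbhs_nbhs.
  apply: filterS2 (filterI (near_neq0 z0) (near_enorm_lt (proj2 (andP ze)))) h2 => w [w0 we] wc.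
  by split=> //; rewrite enorm_gt0 w0.
have metric i z : cdom i z -> A (cpar (m := g) i z) ->
    differentiable (e \o cpar (m := g) i) z /\
    cmetric i z = 'J (e \o cpar (m := g) i) z *m ('J (e \o cpar (m := g) i) z)^T.
  move=> iz [Kz [v jv vz]].
  have ch : in_charts (g := g) (h := cone N) (~` K) Phi i j z by split=> //; exists v.
  pose ce := chart_expr (g := g) (h := cone N) Phi i j.
  have cez : ce z = v by rewrite /ce /chart_expr -vz; exact: invK.
  have dce : differentiable ce z by have [d _] := smooth_Phi.2 i j 1%N; exact: d.
  have ds : differentiable sigma (rsubmx v) by apply: dsigma; case: jv.
  have [dP _] := cone_point_diff ds.
  have dP' : differentiable P (ce z) by rewrite cez.
  have E : e \o cpar (m := g) i = P \o ce by [].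
  rewrite E; split; first exact: differentiable_comp.
  rewrite (jacobian_comp dce dP') trmx_mul mulmxA -(mulmxA _ ('J P _)).
  by rewrite cez (cone_point_gram sigma1 ds) (pull_Phi ch) -/ce cez.
exists B; split.
  by split=> //; exists y0.
exists A, e; apply: Isocoord; [exact: oA|exact: oB| | | | | | |exact: metric].
- by move=> p [Kp [v jv vp]]; have [-> Bv _] := AB v p Kp jv (esym vp).
- by move=> z /BA[v [jv Kz E _]]; split=> //; exists v.
- by move=> p [Kp [v jv vp]]; have [-> _] := AB v p Kp jv (esym vp).
- by move=> z /BA[v [jv Kz E Pz]]; have [-> _ _] := AB v _ Kz jv E.
(* Continuity of [e] follows from differentiability in a chart of the atlas. *)
- move=> p [Kp [v jv vp]]; have [i [z iz zp]] := cover_g p.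
  have [] := metric i z iz _; first by rewrite zp; split=> //; exists v.
  move=> /differentiable_continuous ce _.
  have ci := par_inv_cont (par_g i) iz; rewrite zp in ci.
  have near_p : \forall q \near p, e q = (e \o cpar i) ('pinv_(fun=> 0) (cdom i) (cpar i) q).
    by rewrite -zp; apply: filterS (par_near (par_g i) iz) => q /(par_invKV (par_g i))[/= ->].
  move=> Q Qp.
  have Qz : nbhs ('pinv_(fun=> 0) (cdom i) (cpar i) p) [set w : 'rV[R]_n | Q ((e \o cpar i) w)].
    have pz : 'pinv_(fun=> 0) (cdom i) (cpar i) p = z by rewrite -zp (par_invK (par_g i)).
    by rewrite pz; apply: ce; rewrite /= zp.
  have h := ci _ Qz.
  by apply: filterS2 near_p h => q /= ->.
- by move=> z [ze _]; exact: continuous_cone_param.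
Qed.

End ConeChart.

Theorem corollary10p2 (R : realType) (k : nat) (hk : (1 <= k)%N)
    (Gamma : finGroupType) (to : {action Gamma &-> sphere R (2 * k)})
    (Gamma_nontrivial : (1 < #|Gamma|)%N)
    (Gamma_isometries : forall a : Gamma,
       riemannian_isometry (round_metric R (2 * k)) (round_metric R (2 * k))
         setT setT (fun x => to x a))
    (Gamma_free : forall (x : sphere R (2 * k)) (a : Gamma),
       to x a = x -> a = 1%g) :
  ~ exists (M : topologicalType) (g : metric_atlas R (2 * k) M),
      [/\ riemannian_manifold g, orientable g, flat g
        & one_cone_singularity g (orbit_metric to (round_metric R (2 * k)))].
Proof.
case=> M [g [[[hausM _] [par_g cover_g pos_g _ _]] _ flat_g]].
move=> [K [eps [Phi [_ eps0 [[oK _ sPhi fPhi [Phi' [[cPhi' _] fPhi' PhiK Phi'K]]] pPhi] cptPhi]]]].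
(* Punctured balls are connected from dimension 2 on. *)
have n1 : (1 < 2 * k)%N by rewrite mul2n -addnn; apply: leq_trans (leq_add hk hk).
have n0 : (0 < 2 * k)%N by exact: ltnW.
have to_cont a : continuous (fun u => to u a).
  by move=> u; have [[_ _ [c _] _ _] _] := Gamma_isometries a; exact: c.
have to_free (u : sphere R (2 * k)) a : to u a = u -> a = 1%g by exact: Gamma_free.
have PhiK' p : ~ K p -> Phi' (Phi p) = p by move=> Kp; apply: PhiK; rewrite inE.
have Phi'K' q : - eps < q.1 < 0 -> Phi (Phi' q) = q by move=> hq; apply: Phi'K; rewrite inE.
have pos i x : cdom i x ->
    forall v : 'rV[R]_(2 * k), v != 0 -> 0 < (v *m cmetric (m := g) i x *m v^T) 0 0.
  by move=> ix; have [_ /(_ x ix)[_]] := pos_g i.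
have flat_iso p : exists A B e e', A p /\ isocoord g A B e e'.
  have [A [B [f [Ap /flat_isocoord[f' iso]]]]] := flat_g p.
  by exists A, B, f, f'.
apply: (@no_cone_end R (2 * k) M g n1 hausM par_g cover_g pos flat_iso
  (cone_param n0 (to := to) Phi') eps eps0 _ Gamma (polar_act n0 to) Gamma_nontrivial).
- move=> x xe.
  have [B [Bx [A [e iso]]]] := cone_param_chart n0 to_cont to_free par_g cover_g oK sPhi
    fPhi cPhi' fPhi' PhiK' Phi'K' pPhi xe.
  by exists B => //; exists A, e.
- by move=> x y xe ye; apply: (cone_param_orbit n0 Phi'K').
- by move=> a x x0; have [] := polar_act_polar n0 to a x0.
- by move=> a t x; exact: polar_act_scale.
- by move=> a x; exact: continuous_polar_act.
- by move=> a x; exact: polar_act_free.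
- move=> d de; rewrite (cone_param_image n0 fPhi fPhi' PhiK' Phi'K' de).
  exact: cptPhi.
Qed.
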